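(* Let $L$ be a projective Finsler metric defined on the whole real projective $n$-space $\mathbb{RP}^n$. Then $L$ is the sum of a reversible projective Finsler metric and an exact $1$-form; that is, there exist a reversible projective Finsler metric $F$ on $\mathbb{RP}^n$ and a smooth function $f : \mathbb{RP}^n \to \mathbb{R}$ such that $L(v) = F(v) + df(v)$ for all $v \in T\mathbb{RP}^n$.
   Context: A Finsler metric on a smooth manifold $M$ is a function $F : TM \to [0,\infty)$ that is smooth outside the zero section and whose restriction $F_x$ to each tangent space $T_xM$ is a possibly asymmetric, quadratically convex norm: $F_x$ is positive away from $0$, positively homogeneous of degree one ($F_x(\lambda v)=\lambda F_x(v)$ for $\lambda \ge 0$, with $F_x(-v) \neq F_x(v)$ allowed), and the Hessian of $F_x^2$ is positive definite at every nonzero vector. The metric is reversible if $F(-v)=F(v)$ for all $v \in TM$. Geodesics are the extremals of the length functional $\gamma \mapsto \int F(\dot\gamma)\,dt$. A Finsler metric (not necessarily reversible) on $\mathbb{RP}^n$ is called projective if its geodesics lie on projective lines. A $1$-form is regarded as a function on the tangent bundle that is linear on each tangent space.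
   Formalization: The formal theorem assumes n ≥ 2; for n = 1 the statement is false, since every Finsler metric on the projective line is projective and L = 2|dt| + dt has the non-exact odd part dt. *)

(* Defs.v *)
From HB Require Import structures.
From mathcomp Require Import all_boot all_order all_algebra.
From mathcomp Require Import generic_quotient.
From mathcomp Require Import all_classical all_reals all_analysis.
From mathcomp Require Import ring.

Set Implicit Arguments.
Unset Strict Implicit.
Unset Printing Implicit Defensive.

Import Order.TTheory GRing.Theory Num.Theory.
Import numFieldNormedType.Exports.

Local Open Scope classical_set_scope.
Local Open Scope ring_scope.
Local Open Scope quotient_scope.

Section Smoothness.
Context {R : realType}.

(* [:: v1; ...; vk] gives the iterated directional derivative D_v1 ... D_vk f *)
Fixpoint iterD {U W : normedModType R} (vs : seq U) (f : U -> W) : U -> W :=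
  if vs is v :: vs' then fun x => 'D_v (iterD vs' f) x else f.

(* C^oo on a neighbourhood of x: directional derivatives of every order exist
   and are Frechet differentiable (hence continuous) near x. *)
Definition smooth_at {U W : normedModType R} (f : U -> W) (x : U) : Prop :=
  \forall y \near x, forall vs : seq U, differentiable (iterD vs f) y.

End Smoothness.

Section ProjectiveSpace.
Variables (R : realType) (n : nat).

Definition nzvec := {x : 'rV[R]_n.+1 | x != 0}.

Definition proj_rel (x y : nzvec) : bool :=
  `[< exists2 a : R, a != 0 & val y = a *: val x >].

Lemma proj_rel_refl : reflexive proj_rel.
Proof. by move=> x; apply/asboolP; exists 1; rewrite ?oner_neq0 ?scale1r. Qed.

Lemma proj_rel_sym : symmetric proj_rel.
Proof.
suff H x y : proj_rel x y -> proj_rel y x by move=> x y; apply/idP/idP; exact: H.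
move=> /asboolP[a a0 e]; apply/asboolP; exists a^-1; first by rewrite invr_eq0.
by rewrite e scalerA mulVf// scale1r.
Qed.

Lemma proj_rel_trans : transitive proj_rel.
Proof.
move=> y x z /asboolP[a a0 e] /asboolP[b b0 e']; apply/asboolP.
by exists (b * a); rewrite ?mulf_neq0// e' e scalerA.
Qed.

Canonical proj_equiv := EquivRel proj_rel proj_rel_refl proj_rel_sym proj_rel_trans.

Definition RP := {eq_quot proj_rel}.
HB.instance Definition _ := Choice.on RP.
HB.instance Definition _ := EqQuotient.on RP.

(* (x, v) represents the image of v under the differential at x of the
   projection R^(n+1) \ {0} -> RP^n.  As [c(t)] = [a(t) c(t)], two pairs have
   the same image iff they differ by (x, v) |-> (a x, a v + b x), a != 0. *)
Definition tan_rel (s t : nzvec * 'rV[R]_n.+1) : bool :=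
  `[< exists2 a : R, a != 0 &
      val t.1 = a *: val s.1 /\ exists b : R, t.2 = a *: s.2 + b *: val s.1 >].

Lemma tan_rel_refl : reflexive tan_rel.
Proof.
move=> x; apply/asboolP; exists 1; first exact: oner_neq0.
by rewrite !scale1r; split=> //; exists 0; rewrite scale0r addr0.
Qed.

Lemma tan_rel_sym : symmetric tan_rel.
Proof.
suff H x y : tan_rel x y -> tan_rel y x by move=> x y; apply/idP/idP; exact: H.
move=> /asboolP[a a0 [e [b e']]]; apply/asboolP.
exists a^-1; first by rewrite invr_eq0.
split; first by rewrite e scalerA mulVf// scale1r.
exists (- (a^-1 * b * a^-1)); rewrite e e' scalerDr !scalerA mulVf// scale1r.
by rewrite mulNr -[_ * a^-1 * a]mulrA mulVf// mulr1 scaleNr addrK.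
Qed.

Lemma tan_rel_trans : transitive tan_rel.
Proof.
move=> y x z /asboolP[a a0 [e [b f]]] /asboolP[a' a0' [e' [b' f']]].
apply/asboolP; exists (a' * a); first by rewrite mulf_neq0.
split; first by rewrite e' e scalerA.
exists (a' * b + b' * a).
by rewrite f' f e scalerDr !scalerA scalerDl addrA.
Qed.

Canonical tan_equiv := EquivRel tan_rel tan_rel_refl tan_rel_sym tan_rel_trans.

Definition TRP := {eq_quot tan_rel}.
HB.instance Definition _ := Choice.on TRP.
HB.instance Definition _ := EqQuotient.on TRP.

Definition base (u : TRP) : RP := \pi_RP (repr u).1.

(* The i-th affine chart is y_j = x_(lift i j) / x_i; [insert i 1 y] is the
   representative of the point with coordinates y whose i-th entry is 1. *)
Definition insert (i : 'I_n.+1) (c : R) (y : 'rV[R]_n) : 'rV[R]_n.+1 :=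
  \row_j (if unlift i j is Some k then y ord0 k else c).

Lemma insert1_neq0 i y : insert i 1 y != 0.
Proof.
apply/eqP => /rowP/(_ i); rewrite !mxE unlift_none => /eqP.
by rewrite oner_eq0.
Qed.

Definition insert1 (i : 'I_n.+1) (y : 'rV[R]_n) : nzvec :=
  exist _ (insert i 1 y) (insert1_neq0 i y).

Definition chart_point (i : 'I_n.+1) (y : 'rV[R]_n) : RP := \pi_RP (insert1 i y).

(* the tangent vector at [chart_point i y] with components w in the i-th chart *)
Definition chart_vec (i : 'I_n.+1) (y w : 'rV[R]_n) : TRP :=
  \pi_TRP (insert1 i y, insert i 0 w).

Definition in_chart (i : 'I_n.+1) (p : RP) : bool := val (repr p) ord0 i != 0.

Definition coord (i : 'I_n.+1) (p : RP) : 'rV[R]_n :=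
  \row_j (val (repr p) ord0 (lift i j) / val (repr p) ord0 i).

(* components of a tangent vector: the derivative of x_j / x_i along (x, v) *)
Definition tcoord (i : 'I_n.+1) (u : TRP) : 'rV[R]_n :=
  let x := val (repr u).1 in let v := (repr u).2 in
  \row_j ((v ord0 (lift i j) * x ord0 i - x ord0 (lift i j) * v ord0 i)
          / x ord0 i ^+ 2).

(* some chart around p; there is always one, and the choice is immaterial *)
Definition chart_at (p : RP) : 'I_n.+1 := odflt ord0 [pick i | in_chart i p].

(* [coord] and [tcoord], computed on representatives, invert the chart maps. *)

Lemma repr_pi_RP (x : nzvec) :
  exists2 a : R, a != 0 & val (repr (\pi_RP x)) = a *: val x.
Proof.
have : x = repr (\pi_RP x) %[mod RP] by rewrite reprK.
by move=> /eqquotP/asboolP.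
Qed.

Lemma repr_pi_TRP (s : nzvec * 'rV[R]_n.+1) :
  tan_rel s (repr (\pi_TRP s)).
Proof.
have : s = repr (\pi_TRP s) %[mod TRP] by rewrite reprK.
by move=> /eqquotP.
Qed.

Lemma in_chart_point i (y : 'rV[R]_n) : in_chart i (chart_point i y).
Proof.
rewrite /in_chart; have [a a0 ->] := repr_pi_RP (insert1 i y).
by rewrite !mxE unlift_none mulr1.
Qed.

Lemma chart_pointK i : cancel (chart_point i) (coord i).
Proof.
move=> y; apply/rowP => j; rewrite /coord mxE.
have [a a0 ->] := repr_pi_RP (insert1 i y).
by rewrite !mxE unlift_none liftK mulr1 mulrAC divff// mul1r.
Qed.

Lemma coordK i (p : RP) : in_chart i p -> chart_point i (coord i p) = p.
Proof.
rewrite /in_chart => pi0; rewrite /chart_point -[RHS]reprK.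
apply/eqquotP/asboolP; exists (val (repr p) ord0 i) => //.
apply/rowP => j; rewrite !mxE.
case: unliftP => [k ->|->]; last by rewrite mulr1.
by rewrite mxE mulrC divfK.
Qed.

Lemma in_chart_at (p : RP) : in_chart (chart_at p) p.
Proof.
rewrite /chart_at; case: pickP => //= H; exfalso.
move/negP: (valP (repr p)); apply; apply/eqP/rowP => i.
by move/negbFE/eqP: (H i); rewrite ord1 mxE => ->.
Qed.

Lemma base_chart_vec i y w : base (chart_vec i y w) = chart_point i y.
Proof.
have /asboolP[a a0 [e _]] := repr_pi_TRP (insert1 i y, insert i 0 w).
apply/eqquotP/asboolP; exists a^-1; first by rewrite invr_eq0.
by rewrite /chart_vec e scalerA mulVf// scale1r.
Qed.

Lemma chart_vecK i y w : tcoord i (chart_vec i y w) = w.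
Proof.
apply/rowP => j; rewrite /tcoord.
have /asboolP[a a0 /= [-> [b ->]]] := repr_pi_TRP (insert1 i y, insert i 0 w).
rewrite !mxE !unlift_none !liftK.
by field.
Qed.

Lemma tcoordK i (u : TRP) : in_chart i (base u) ->
  chart_vec i (coord i (base u)) (tcoord i u) = u.
Proof.
rewrite /in_chart /coord /tcoord /base.
have [a a0 ->] := repr_pi_RP (repr u).1; rewrite mxE mulf_eq0 negb_or a0 /= => x0.
rewrite /chart_vec -[RHS]reprK; apply/eqquotP/asboolP.
set x := val (repr u).1; set v := (repr u).2.
exists (x ord0 i) => //=; split.
  apply/rowP=> j; rewrite !mxE; case: unliftP => [k ->|->]; last by rewrite mulr1.
  by rewrite !mxE; field; rewrite x0.
exists (v ord0 i); apply/rowP=> j; rewrite !mxE.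
case: unliftP => [k ->|->]; rewrite ?mxE.
  change (v 0 (lift i k) = x 0 i * ((v 0 (lift i k) * x 0 i - x 0 (lift i k) * v 0 i)
    / x 0 i ^+ 2) + v 0 i * (a * x 0 (lift i k) / (a * x 0 i))).
  have {}x0 : x 0 i != 0 by [].
  by field; rewrite x0 a0.
by rewrite mulr0 add0r mulr1.
Qed.

Definition zero_section : set TRP :=
  [set u | exists i y, u = chart_vec i y 0].

(* the points of RP^n that lie in the projectivization of W *)
Definition projectivization (W : {vspace 'rV[R]_n.+1}) : set RP :=
  [set p | val (repr p) \in W].

Definition projective_line (l : set RP) : Prop :=
  exists2 W : {vspace 'rV[R]_n.+1}, \dim W = 2%N & l = projectivization W.

Definition smooth_function (f : RP -> R) : Prop :=
  forall i y, smooth_at (f \o chart_point i) y.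

Definition differential (f : RP -> R) (u : TRP) : R :=
  let i := chart_at (base u) in
  'd (f \o chart_point i) (coord i (base u)) (tcoord i u).

(* smoothness of a map into RP^n; the first conjunct is continuity at s *)
Definition smooth_map_at {U : normedModType R} (g : U -> RP) (s : U) : Prop :=
  forall i, in_chart i (g s) ->
    (\forall s' \near s, in_chart i (g s')) /\ smooth_at (coord i \o g) s.

Definition velocity (c : R -> RP) (t : R) : TRP :=
  let i := chart_at (c t) in chart_vec i (coord i (c t)) ('D_1 (coord i \o c) t).

Record Finsler (L : TRP -> R) : Prop := {
  Finsler_smooth : forall i y w, w != 0 ->
    smooth_at (fun z : 'rV[R]_n * 'rV[R]_n => L (chart_vec i z.1 z.2)) (y, w);
  Finsler_pos : forall u, ~ zero_section u -> 0 < L u;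
  Finsler_homog : forall i y w (a : R), 0 <= a ->
    L (chart_vec i y (a *: w)) = a * L (chart_vec i y w);
  Finsler_convex : forall i y w v, w != 0 -> v != 0 ->
    0 < 'D_v ('D_v (fun w' => L (chart_vec i y w') ^+ 2)) w }.

Definition reversible (L : TRP -> R) : Prop :=
  forall i y w, L (chart_vec i y (- w)) = L (chart_vec i y w).

Definition flength (L : TRP -> R) (a b : R) (c : R -> RP) : R :=
  \int[@lebesgue_measure R]_(t in `[a, b]) L (velocity c t).

(* G s t is a smooth variation, with fixed end points, of the restriction of c
   to [a, b]; smoothness is required near {0} x [a, b]. *)
Definition variation (a b : R) (c : R -> RP) (G : R -> R -> RP) : Prop :=
  [/\ forall t, t \in `[a, b] ->
        smooth_map_at (fun z : R * R => G z.1 z.2) (0, t),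
      forall t, t \in `[a, b] -> G 0 t = c t &
      \forall s \near (0 : R), G s a = c a /\ G s b = c b].

(* regular curves on [a, b] at which the first variation of length vanishes *)
Definition geodesic (L : TRP -> R) (a b : R) (c : R -> RP) : Prop :=
  [/\ forall t, t \in `[a, b] -> smooth_map_at c t,
      forall t, t \in `[a, b] -> ~ zero_section (velocity c t) &
      forall G, variation a b c G ->
        is_derive (0 : R) (1 : R) (fun s => flength L a b (G s)) 0].

Definition projective (L : TRP -> R) : Prop :=
  forall (a b : R) (c : R -> RP), a < b -> geodesic L a b c ->
    exists2 l, projective_line l & forall t, t \in `[a, b] -> l (c t).

End ProjectiveSpace.

(* Main.v *)
(** Lift [L] to homogeneous coordinates as a function [Lh x v] with
    [Lh (a x) (a v + b x) = Lh x v].  Solutions of the Euler-Lagrange equation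
    exist in every direction and lie on lines; this turns the equation into
    Hamel's condition: the derivative of [D_w (Lh x)] at [v], taken with
    respect to [x] along [v], is the derivative of [Lh] with respect to [x]
    along [w].  Hamel's condition is linear in [L] and stable under [v -> - v],
    so it holds for the even part [F] and for the odd part [A] of [Lh].

    Odd part.  Parametrise the pairs (point, direction) over a 3-space by Euler
    angles (phi, theta, alpha) and average [A] over alpha.  The moments
    [c k phi = \int abar * cos theta ^ k] with odd k satisfy
    [(k + 1) (sin phi c_k' + k cos phi c_k)
       = (k - 1) (sin phi c_(k-2)' + (k + 1) cos phi c_(k-2))],
    so inductively [sin phi ^ k * c k] is constant, hence zero.  Thus abar plus
    its second derivative in theta vanishes on the equator, where it is a
    multiple of the second derivative of [A x] at [v], which Hamel's condition
    makes constant along great circles.  So [A] is linear in [v], and Hamel's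
    condition says that this 1-form is closed.  Its primitive by integration
    along segments from [o] is invariant under [x -> - x] because the
    complement of the line [R o] is connected, and it descends to RP^n.

    Even part.  The second derivative of [L x] is positive transversally to
    [v], hence so is that of [F]; a closed form does not affect Hamel's
    condition.  For an extremal [[X]] of [F], variations in a constant
    direction and Hamel's condition make the vertical Hessian of [F] at
    [(X, X')] annihilate [X'']; so [X''] lies in the span of [X] and [X'],
    this plane is constant, and the extremal stays on a line. *)
Require Import Defs.
From HB Require Import structures.
From mathcomp Require Import all_boot all_order all_algebra.
From mathcomp Require Import all_classical all_reals all_analysis.
From mathcomp Require Import ring lra.

Set Implicit Arguments.
Unset Strict Implicit.
Unset Printing Implicit Defensive.

Import Order.TTheory GRing.Theory Num.Theory.
Import numFieldNormedType.Exports.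

Local Open Scope classical_set_scope.
Local Open Scope ring_scope.

(** Length is invariant under reparametrisation, so the Euler-Lagrange equation of [L] does not
    determine the acceleration. Extremals are therefore obtained from [L ^ 2], whose vertical
    Hessian is invertible by convexity; they have constant speed, hence are extremals of [L] too.

    The average over alpha removes the derivative in alpha from Hamel's condition and leaves an
    equation in phi and theta. Nothing is lost at phi = pi/2, theta = 0, where the quantity sought
    does not depend on alpha.

    The moment identity is the averaged equation times [cos theta ^ (k - 1)], integrated by parts
    over [-pi/2, pi/2]. Boundary terms could survive only for k = 1, and there they cancel, because
    theta = pi/2 and theta = -pi/2 are opposite directions and [A] is odd. This starts the recursion
    at k = 1 and keeps it on odd k. Odd powers suffice to reach theta = 0, because [cos theta ^ k]
    concentrates there as k grows.

    The assumption 2 <= n provides a vector outside the plane of [o] and x, through which x is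
    joined to -x around the line R o. *)

Local Notation iterD := Defs.iterD.

(** * Smooth functions between finite-dimensional spaces *)

Section Calc.
Context {R : realType}.

(** A version of [smooth_at] with bounded order on a fixed set: closure properties are proved by
    induction on [n], for which the quantifier over all lists of directions gives no handle. *)
Definition smooth_upto {U W : normedModType R} n (O : set U) (f : U -> W) :=
  forall y, O y -> forall vs : seq U, (size vs <= n)%N ->
    differentiable (iterD vs f) y.

Lemma iterD_rcons {U W : normedModType R} (vs : seq U) v (f : U -> W) :
  iterD (rcons vs v) f = iterD vs ('D_v f).
Proof. by elim: vs => //= w vs ->. Qed.

Section Upto.
Context {U W : normedModType R}.
Implicit Types (O : set U) (f g : U -> W).

(** The innermost direction is peeled off, so that an induction passes from [f] to ['D_v f] and not
    to a derivative of a derivative already taken. *)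
Lemma smooth_uptoS n O f : smooth_upto n.+1 O f <->
  (forall y, O y -> differentiable f y) /\ forall v, smooth_upto n O ('D_v f).
Proof.
split=> [h|[h1 h2] y Oy vs].
  split=> [y Oy|v y Oy vs sz]; first exact: (h y Oy [::]).
  by rewrite -iterD_rcons; apply: h; rewrite ?size_rcons.
case/lastP: vs => [|vs v] sz; first exact: h1.
by rewrite iterD_rcons; apply: h2; move: sz; rewrite size_rcons.
Qed.

Lemma smooth_upto_diff n O f y : smooth_upto n O f -> O y -> differentiable f y.
Proof. by move=> h /h/(_ [::]); apply. Qed.

Lemma smooth_uptoW n O f : smooth_upto n.+1 O f -> smooth_upto n O f.
Proof. by move=> h y Oy vs /leqW; exact: h. Qed.

Lemma smooth_upto_sub n O P f : O `<=` P -> smooth_upto n P f -> smooth_upto n O f.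
Proof. by move=> OP h y /OP; exact: h. Qed.

Lemma smooth_upto0 O f : smooth_upto 0 O f <-> forall y, O y -> differentiable f y.
Proof.
split=> [h y Oy|h y Oy [|//] _]; first exact: (h y Oy [::]).
exact: h.
Qed.

End Upto.

Lemma near_eq_differentiable {U W : normedModType R} (f g : U -> W) x :
  (\near x, f x = g x) -> differentiable f x -> differentiable g x.
Proof.
move=> fg df.
have fgx : f x = g x by exact: (nbhs_singleton fg).
have cdf : continuous ('d f x) by exact: diff_continuous.
suff d : g \o shift x = cst (g x) + 'd f x +o_ (0 : U) id.
  have h := diff_unique cdf d.
  apply/diff_locallyP; rewrite h; split=> //.
have H := diff_locally df.
rewrite -fgx; apply/eqaddoP => e e0.
move/eqaddoP: H => /(_ e e0).
rewrite -!nbhs_nearE.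
have : \forall y \near (0:U), f (y + x) = g (y + x).
  by move: fg; rewrite (near_shift 0) subr0.
apply: filter_app2; near=> y.
by rewrite /= !fctE /= => ->.
Unshelve. all: by end_near. Qed.

Lemma derive_comp {U W Z : normedModType R} (f : U -> W) (g : W -> Z) x v :
  differentiable f x -> differentiable g (f x) ->
  'D_v (g \o f) x = 'd g (f x) ('D_v f x).
Proof.
move=> df dg; rewrite deriveE; last exact: differentiable_comp.
by rewrite diff_comp//= deriveE.
Qed.

Lemma near_open {U : normedModType R} (O : set U) (P : U -> Prop) y :
  open O -> O y -> (forall y, O y -> P y) -> \near y, P y.
Proof. by move=> oO Oy OP; apply: filterS OP _; exact: open_nbhs_nbhs. Qed.

Lemma is_diff_linear {U W : normedModType R} (f : U -> W) :
  linear f -> continuous f -> forall x, is_diff x f f.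
Proof.
move=> lf cf x.
pose fM := GRing.isLinear.Build _ _ _ _ f lf.
pose fL : {linear U -> W} := HB.pack f fM.
apply: DiffDef; first exact: (@linear_differentiable _ _ _ fL).
exact: (@diff_lin _ _ _ fL).
Qed.

Section UptoOpen.
Context {U : normedModType R} (O : set U).
Hypothesis oO : open O.

Lemma smooth_upto_eq {W : normedModType R} n (f g : U -> W) :
  (forall y, O y -> f y = g y) -> smooth_upto n O f -> smooth_upto n O g.
Proof.
elim: n f g => [|n IH] f g fg.
  rewrite !smooth_upto0 => h y Oy.
  by apply: near_eq_differentiable (h y Oy); exact: near_open fg.
rewrite !smooth_uptoS => -[h1 h2]; split.
  move=> y Oy; apply: near_eq_differentiable (h1 y Oy); exact: near_open fg.
move=> v; apply: IH (h2 v) => y Oy.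
by apply: near_eq_derive; exact: near_open fg.
Qed.

Lemma smooth_upto_cst {W : normedModType R} n (c : W) : smooth_upto n O (cst c).
Proof.
elim: n c => [|n IH] c; first by rewrite smooth_upto0 => *; exact: differentiable_cst.
rewrite smooth_uptoS; split=> [*|v]; first exact: differentiable_cst.
by apply: smooth_upto_eq (IH 0) => y _; rewrite derive_cst.
Qed.

Lemma smooth_upto_lin {W : normedModType R} n (l : U -> W) :
  (forall x, is_diff x l l) -> smooth_upto n O l.
Proof.
move=> dl; case: n => [|n]; first by rewrite smooth_upto0 => y _; exact: ex_diff.
rewrite smooth_uptoS; split=> [y _|v]; first exact: ex_diff.
apply: smooth_upto_eq (smooth_upto_cst (l v)) => y _.
by rewrite deriveE//= diff_val.
Qed.

Lemma smooth_uptoD {W : normedModType R} n (f g : U -> W) :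
  smooth_upto n O f -> smooth_upto n O g -> smooth_upto n O (f + g).
Proof.
elim: n f g => [|n IH] f g.
  by rewrite !smooth_upto0 => hf hg y Oy; apply: differentiableD; auto.
rewrite !smooth_uptoS => -[f1 f2] [g1 g2]; split=> [y Oy|v].
  by apply: differentiableD; auto.
apply: smooth_upto_eq (IH _ _ (f2 v) (g2 v)) => y Oy.
by rewrite deriveD//; apply: diff_derivable; auto.
Qed.

Lemma smooth_upto_sum {W : normedModType R} n m (f : 'I_m -> U -> W) :
  (forall i, smooth_upto n O (f i)) -> smooth_upto n O (\sum_i f i).
Proof.
move=> h; elim/big_ind: _ => //; first exact: smooth_upto_cst.
exact: smooth_uptoD.
Qed.

Lemma smooth_uptoM n (f g : U -> R) :
  smooth_upto n O f -> smooth_upto n O g -> smooth_upto n O (f * g).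
Proof.
elim: n f g => [|n IH] f g.
  by rewrite !smooth_upto0 => hf hg y Oy; apply: differentiableM; auto.
move=> Sf Sg; have Wf := smooth_uptoW Sf; have Wg := smooth_uptoW Sg.
move: Sf Sg; rewrite !smooth_uptoS => -[f1 f2] [g1 g2]; split=> [y Oy|v].
  by apply: differentiableM; auto.
apply: smooth_upto_eq (smooth_uptoD (IH _ _ Wf (g2 v)) (IH _ _ Wg (f2 v))) => y Oy.
by rewrite deriveM//; apply: diff_derivable; auto.
Qed.

Lemma smooth_uptoV n (f : U -> R) : (forall y, O y -> f y != 0) ->
  smooth_upto n O f -> smooth_upto n O (fun y => (f y)^-1).
Proof.
move=> f0; elim: n => [|n IH].
  by rewrite !smooth_upto0 => hf y Oy; apply: differentiableV; auto.
move=> Sf; have Wf := smooth_uptoW Sf; have IV := IH Wf.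
move: Sf; rewrite !smooth_uptoS => -[f1 f2]; split=> [y Oy|v].
  by apply: differentiableV; auto.
have S2 := smooth_uptoM (smooth_uptoM IV IV) (f2 v).
apply: smooth_upto_eq (smooth_uptoM (smooth_upto_cst (-1 : R)) S2) => y Oy.
rewrite deriveV//; [|exact: f0|by apply: diff_derivable; auto].
by rewrite !fctE /= -exprVn expr2 /GRing.scale /= mulN1r mulNr.
Qed.

Lemma smooth_uptoZl {W : normedModType R} n (k : U -> R) (c : W) :
  smooth_upto n O k -> smooth_upto n O (fun y => k y *: c).
Proof.
elim: n k => [|n IH] k.
  by rewrite !smooth_upto0 => hf y Oy; apply: differentiableZl; auto.
rewrite !smooth_uptoS => -[k1 k2]; split=> [y Oy|v].
  by apply: differentiableZl; auto.
apply: smooth_upto_eq (IH _ (k2 v)) => y Oy.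
rewrite [RHS]deriveE; last by apply: differentiableZl; auto.
by rewrite diffZl; auto; rewrite deriveE; auto.
Qed.

Lemma smooth_upto_linl {W Z : normedModType R} n (f : U -> W) (l : W -> Z) :
  (forall x, is_diff x l l) -> smooth_upto n O f -> smooth_upto n O (l \o f).
Proof.
move=> dl; elim: n f => [|n IH] f.
  rewrite !smooth_upto0 => hf y Oy; apply: differentiable_comp; auto.
rewrite !smooth_uptoS => -[k1 k2]; split=> [y Oy|v].
  apply: differentiable_comp; auto; exact: ex_diff.
apply: smooth_upto_eq (IH _ (k2 v)) => y Oy.
by rewrite derive_comp ?diff_val; auto; exact: ex_diff.
Qed.

End UptoOpen.

(** Finite dimension is expressed by coordinate forms, which makes it stable under products. It
    serves to reduce higher-order chain rules to products of scalar functions and to make linear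
    maps continuous. *)
Definition fdim (W : normedModType R) := exists m (b : 'I_m -> W) (l : 'I_m -> W -> R),
  (forall i w, is_diff w (l i) (l i)) /\ forall w, w = \sum_i l i w *: b i.

Lemma fdim_R : fdim R.
Proof.
exists 1, (fun=> 1), (fun=> id); split=> [_ w|w]; first exact: is_diff_id.
by rewrite big_ord1 /GRing.scale /= mulr1.
Qed.

Lemma fdim_rV n : fdim 'rV[R]_n.
Proof.
exists n, (fun i => delta_mx 0 i), (fun i (w : 'rV[R]_n) => w ord0 i); split=> [i w|w].
  apply: is_diff_linear => [a u v|]; first by rewrite !mxE.
  exact: coord_continuous.
by rewrite {1}[w]row_sum_delta.
Qed.

Lemma is_diff_fst (V W : normedModType R) (x : V * W) : is_diff x fst fst.
Proof. by apply: is_diff_linear => // y; exact: cvg_fst. Qed.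

Lemma is_diff_snd (V W : normedModType R) (x : V * W) : is_diff x snd snd.
Proof. by apply: is_diff_linear => // y; exact: cvg_snd. Qed.

Lemma fdim_prod (V W : normedModType R) : fdim V -> fdim W -> fdim (V * W)%type.
Proof.
move=> [m [b [l [dl hl]]]] [m' [b' [l' [dl' hl']]]].
exists (m + m')%N, (fun i : 'I_(m + m') =>
    match fintype.split i with inl j => (b j, 0) | inr j => (0, b' j) end),
  (fun (i : 'I_(m + m')) w =>
    match fintype.split i with inl j => l j w.1 | inr j => l' j w.2 end); split.
  move=> i w; case: (fintype.split i) => j.
    by have := @is_diff_comp _ _ _ _ _ _ _ _ _ (is_diff_fst w) (dl j w.1).
  by have := @is_diff_comp _ _ _ _ _ _ _ _ _ (is_diff_snd w) (dl' j w.2).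
have sum1 n (F : 'I_n -> V * W) : (\sum_i F i).1 = \sum_i (F i).1.
  by elim/big_rec2: _ => // i y1 y2 _ <-.
have sum2 n (F : 'I_n -> V * W) : (\sum_i F i).2 = \sum_i (F i).2.
  by elim/big_rec2: _ => // i y1 y2 _ <-.
move=> w; rewrite [LHS]surjective_pairing [RHS]surjective_pairing sum1 sum2.
rewrite !big_split_ord /=.
rewrite [X in (_ + X, _)]big1 => [|i _]; last first.
  by rewrite (unsplitK (inr i)) /= scaler0.
rewrite [X in (_, X + _)]big1 => [|i _]; last first.
  by rewrite (unsplitK (inl i)) /= scaler0.
rewrite addr0 add0r {1}[w.1]hl {1}[w.2]hl'; congr pair; apply: eq_bigr => i _.
  by rewrite (unsplitK (inl i)).
by rewrite (unsplitK (inr i)).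
Qed.

Lemma is_diff_fdim (U W : normedModType R) (f : U -> W) : fdim U -> linear f ->
  forall x, is_diff x f f.
Proof.
move=> [m [b [l [dl hl]]]] lf; apply: is_diff_linear => //.
pose fM := GRing.isLinear.Build _ _ _ _ f lf.
pose fL : {linear U -> W} := HB.pack f fM.
have -> : f = fun w => \sum_i l i w *: f (b i).
  apply/funext => w; rewrite {1}[w]hl.
  have := linear_sum fL; rewrite /= => ->; apply: eq_bigr => i _.
  exact: (linearZ_LR fL).
move=> x; apply: differentiable_continuous.
rewrite (_ : (fun w => _) = \sum_i (fun w => l i w *: f (b i))); last first.
  by apply/funext => w; rewrite fct_sumE.
apply: differentiable_sum => i; apply: differentiableZl.
by have [] := dl i x.
Qed.

Hint Extern 0 (fdim _) =>
  solve [repeat first [assumption | exact: fdim_R | exact: fdim_rV | apply: fdim_prod]] : core.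

Section Comp.
Context {U W : normedModType R} (O : set U) (P : set W).
Hypotheses (oO : open O).

(** The derivative of [g \o f] along [v] is the sum over a basis of the coordinates of ['D_v f]
    times the partial derivatives of [g] composed with [f]. Order [n.+1] thus follows from order [n]
    for compositions and products. *)
Lemma smooth_upto_compR n (f : U -> W) (g : W -> R) : fdim W ->
  (forall y, O y -> P (f y)) ->
  smooth_upto n O f -> smooth_upto n P g -> smooth_upto n O (g \o f).
Proof.
move=> [m [b [l [dl hl]]]] OP; elim: n f OP g => [|n IH] f OP g Sf Sg.
  rewrite smooth_upto0 => y Oy; apply: differentiable_comp.
    exact: smooth_upto_diff Sf Oy.
  exact: smooth_upto_diff Sg (OP _ Oy).
have Wf := smooth_uptoW Sf.
rewrite smooth_uptoS; split=> [y Oy|v].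
  apply: differentiable_comp; first exact: smooth_upto_diff Sf Oy.
  exact: smooth_upto_diff Sg (OP _ Oy).
have [f1 f2] := (smooth_uptoS _ _ _).1 Sf.
have [g1 g2] := (smooth_uptoS _ _ _).1 Sg.
have S : smooth_upto n O (\sum_i ((l i \o 'D_v f) * ('D_(b i) g \o f))).
  apply: smooth_upto_sum => // i; apply: smooth_uptoM => //.
    exact: smooth_upto_linl.
  exact: IH.
apply: smooth_upto_eq S => // y Oy.
rewrite derive_comp; [|exact: f1|exact: g1 (OP _ Oy)].
rewrite [in RHS](hl ('D_v f y)) linear_sum fct_sumE; apply: eq_bigr => i _.
have dg := g1 _ (OP _ Oy); by rewrite linearZ_LR -(deriveE _ dg).
Qed.

End Comp.

Lemma smooth_upto_comp {U W Z : normedModType R} (O : set U) (P : set W) n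
    (f : U -> W) (g : W -> Z) : open O -> open P -> fdim W -> fdim Z ->
  (forall y, O y -> P (f y)) ->
  smooth_upto n O f -> smooth_upto n P g -> smooth_upto n O (g \o f).
Proof.
move=> oO oP fW [m [b [l [dl hl]]]] OP Sf Sg.
have S : smooth_upto n O (\sum_i (fun y => (l i \o g) (f y) *: b i)).
  apply: smooth_upto_sum => // i; apply: smooth_uptoZl => //.
  exact: (smooth_upto_compR oO fW OP Sf (smooth_upto_linl oP (dl i) Sg)).
apply: smooth_upto_eq S => // y _.
by rewrite fct_sumE /= [RHS]hl.
Qed.

Lemma smooth_atP {U W : normedModType R} (f : U -> W) x :
  smooth_at f x <-> exists O : set U, [/\ open O, O x & forall n, smooth_upto n O f].
Proof.
split=> [h| [ O [ oO Ox h]]].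
  exists (interior [set y | forall vs : seq U, differentiable (iterD vs f) y]).
  split; [exact: open_interior|exact: h|].
  by move=> n y /interior_subset hy vs _; exact: hy.
apply: (filterS _ (open_nbhs_nbhs (conj oO Ox))) => y Oy vs.
exact: h Oy vs (leqnn _).
Qed.

Lemma near_smooth_at {U W : normedModType R} (f : U -> W) x :
  smooth_at f x -> \near x, smooth_at f x.
Proof. by move=> h; apply: nbhs_interior. Qed.

Lemma smooth_at_diff {U W : normedModType R} (f : U -> W) x :
  smooth_at f x -> differentiable f x.
Proof. by move=> /nbhs_singleton/(_ [::]). Qed.

Lemma smooth_at_cont {U W : normedModType R} (f : U -> W) x :
  smooth_at f x -> {for x, continuous f}.
Proof. by move=> /smooth_at_diff/differentiable_continuous. Qed.

Lemma smooth_at_derive {U W : normedModType R} (f : U -> W) x v :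
  smooth_at f x -> smooth_at ('D_v f) x.
Proof.
by apply: filterS => y h vs; have := h (rcons vs v); rewrite iterD_rcons.
Qed.

Lemma smooth_at_eq {U W : normedModType R} (f g : U -> W) x :
  (\near x, f x = g x) -> smooth_at f x -> smooth_at g x.
Proof.
rewrite -!nbhs_nearE nbhsE => -[P [ oP Px] PQ] /smooth_atP[ O [ oO Ox h]].
apply/smooth_atP; exists (O `&` P); split=> //; first exact: openI.
move=> n; apply: (@smooth_upto_eq _ _ _ _ _ f); first exact: openI.
  by move=> y [_ Py]; exact: PQ.
by apply: smooth_upto_sub (h n) => y [].
Qed.

Lemma smooth_at_cst {U W : normedModType R} (c : W) (x : U) : smooth_at (cst c) x.
Proof.
by apply/smooth_atP; exists setT; split=> // [|n]; [exact: openT|apply: smooth_upto_cst; exact: openT].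
Qed.

Lemma smooth_at_lin {U W : normedModType R} (l : U -> W) x :
  (forall x, is_diff x l l) -> smooth_at l x.
Proof.
move=> dl.
by apply/smooth_atP; exists setT; split=> // [|n]; [exact: openT|apply: smooth_upto_lin => //; exact: openT].
Qed.

Lemma smooth_at2 {U W W' Z : normedModType R} (f : U -> W) (g : U -> W') (h : U -> Z) x :
  (forall O, open O -> forall n, smooth_upto n O f -> smooth_upto n O g -> smooth_upto n O h) ->
  smooth_at f x -> smooth_at g x -> smooth_at h x.
Proof.
move=> H /smooth_atP[ O [ oO Ox fO]] /smooth_atP[P [ oP Px gP]].
apply/smooth_atP; exists (O `&` P); split=> // [|n]; first exact: openI.
apply: H; first exact: openI.
  by apply: smooth_upto_sub (fO n) => y [].
by apply: smooth_upto_sub (gP n) => y [].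
Qed.

Lemma smooth_atD {U W : normedModType R} (f g : U -> W) x :
  smooth_at f x -> smooth_at g x -> smooth_at (fun y => f y + g y) x.
Proof. by apply: smooth_at2 => O oO n; exact: smooth_uptoD. Qed.

Lemma smooth_atM {U : normedModType R} (f g : U -> R) x :
  smooth_at f x -> smooth_at g x -> smooth_at (fun y => f y * g y) x.
Proof. by apply: smooth_at2 => O oO n; exact: smooth_uptoM. Qed.

Lemma smooth_at_comp {U W Z : normedModType R} (f : U -> W) (g : W -> Z) x :
  fdim W -> fdim Z ->
  smooth_at f x -> smooth_at g (f x) -> smooth_at (g \o f) x.
Proof.
move=> fW fZ /[dup] sf /smooth_atP[ O [ oO Ox fO]] /smooth_atP[P [ oP Px gP]].
have cf y : O y -> {for y, continuous f}.
  by move=> Oy; apply/differentiable_continuous/(smooth_upto_diff (fO 0) Oy).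
have oOP : open (O `&` f @^-1` P).
  rewrite openE => y [Oy Py].
  apply: filterI; first exact: open_nbhs_nbhs.
  by apply: (cf _ Oy); exact: open_nbhs_nbhs.
apply/smooth_atP; exists (O `&` f @^-1` P); split=> // n.
apply: (@smooth_upto_comp _ _ _ _ P) => //; first by move=> y [].
by apply: smooth_upto_sub (fO n) => y [].
Qed.

Lemma smooth_at_sum {U W : normedModType R} m (f : 'I_m -> U -> W) x :
  (forall i, smooth_at (f i) x) -> smooth_at (fun y => \sum_i f i y) x.
Proof.
move=> h; elim: m f h => [|m IH] f h.
  by apply: (@smooth_at_eq _ _ (cst 0)); [near=> y; rewrite big_ord0|exact: smooth_at_cst].
have S := smooth_atD (h ord0) (IH (fun i => f (lift ord0 i)) (fun i => h _)).
by apply: smooth_at_eq S; near=> y; rewrite big_ord_recl.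
Unshelve. all: by end_near. Qed.

Lemma smooth_at_prod {U : normedModType R} m (f : 'I_m -> U -> R) x :
  (forall i, smooth_at (f i) x) -> smooth_at (fun y => \prod_i f i y) x.
Proof.
move=> h; elim: m f h => [|m IH] f h.
  by apply: (@smooth_at_eq _ _ (cst (1 : R))); [near=> y; rewrite big_ord0|exact: smooth_at_cst].
have S := smooth_atM (h ord0) (IH (fun i => f (lift ord0 i)) (fun i => h _)).
by apply: smooth_at_eq S; near=> y; rewrite big_ord_recl.
Unshelve. all: by end_near. Qed.

Lemma smooth_atV {U : normedModType R} (f : U -> R) x :
  f x != 0 -> smooth_at f x -> smooth_at (fun y => (f y)^-1) x.
Proof.
move=> f0 /[dup] sf /smooth_atP[ O [ oO Ox fO]].
have : \near x, O x /\ f x != 0.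
  apply: filterI; first exact: open_nbhs_nbhs.
  by apply: (cvgr_neq0 (f x)) => //; exact: (smooth_at_cont sf).
rewrite -nbhs_nearE nbhsE => -[P [ oP Px] PQ].
apply/smooth_atP; exists P; split=> // n.
apply: smooth_uptoV => //; first by move=> y /PQ[].
by apply: smooth_upto_sub (fO n) => y /PQ[].
Qed.

Lemma smooth_atZ {U W : normedModType R} (k : U -> R) (f : U -> W) x : fdim W ->
  smooth_at k x -> smooth_at f x -> smooth_at (fun y => k y *: f y) x.
Proof.
move=> [m [b [l [dl hl]]]] sk sf.
have S : smooth_at (fun y => \sum_i (k y * l i (f y)) *: b i) x.
  apply: smooth_at_sum => i; apply: (@smooth_at2 _ _ _ _ k f) => // O oO n kO gO.
  apply: smooth_uptoZl => //; apply: smooth_uptoM => //.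
  exact: smooth_upto_linl.
apply: smooth_at_eq S; near=> y.
by rewrite [in RHS](hl (f y)) scaler_sumr; apply: eq_bigr => i _; rewrite scalerA.
Unshelve. all: by end_near. Qed.

Lemma smooth_at_linl {U W Z : normedModType R} (f : U -> W) (l : W -> Z) x :
  (forall x, is_diff x l l) -> smooth_at f x -> smooth_at (l \o f) x.
Proof.
by move=> dl sf; apply: (smooth_at2 _ sf sf) => O oO n ? _; exact: smooth_upto_linl. Qed.

Lemma smooth_at_pair {U V W : normedModType R} (f : U -> V) (g : U -> W) x :
  smooth_at f x -> smooth_at g x -> smooth_at (fun y => (f y, g y)) x.
Proof.
move=> sf sg.
have l1 (z : V) : is_diff z (fun v : V => (v, 0 : W)) (fun v : V => (v, 0 : W)).
  exact: is_diff_pair (is_diff_id z) (is_diff_cst 0 z).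
have l2 (z : W) : is_diff z (fun v : W => (0 : V, v)) (fun v : W => (0 : V, v)).
  exact: is_diff_pair (is_diff_cst 0 z) (is_diff_id z).
have := smooth_atD (smooth_at_linl l1 sf) (smooth_at_linl l2 sg).
apply: smooth_at_eq; near=> y.
by rewrite /= ; congr pair; rewrite /= ?addr0 ?add0r.
Unshelve. all: by end_near. Qed.

Lemma smooth_at_rV {U : normedModType R} n (f : U -> 'rV[R]_n) x :
  smooth_at f x <-> forall j, smooth_at (fun y => f y ord0 j) x.
Proof.
split=> [sf j|h].
  apply: (@smooth_at_linl _ _ _ f (fun w : 'rV[R]_n => w ord0 j)) => // z.
  by apply: is_diff_fdim => // a u v; rewrite !mxE.
have S : smooth_at (fun y => \sum_j f y ord0 j *: ('e_j : 'rV[R]_n)) x.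
  apply: smooth_at_sum => i; apply: smooth_atZ => //; exact: smooth_at_cst.
by apply: smooth_at_eq S; near=> y; rewrite -row_sum_delta.
Unshelve. all: by end_near. Qed.

End Calc.

#[global] Hint Extern 0 (fdim _) =>
  solve [repeat first [assumption | exact: fdim_R | exact: fdim_rV | apply: fdim_prod]] : core.

Section Calc2.
Context {R : realType}.

Lemma deriveDr {U W : normedModType R} (f : U -> W) x u v : differentiable f x ->
  'D_(u + v) f x = 'D_u f x + 'D_v f x.
Proof. by move=> df; rewrite !deriveE// linearD. Qed.

Lemma deriveZr {U W : normedModType R} (f : U -> W) x a v : differentiable f x ->
  'D_(a *: v) f x = a *: 'D_v f x.
Proof. by move=> df; rewrite !deriveE// linearZ. Qed.

Lemma deriveNr {U W : normedModType R} (f : U -> W) x v : differentiable f x ->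
  'D_(- v) f x = - 'D_v f x.
Proof. by move=> df; rewrite !deriveE// linearN. Qed.

Lemma is_derive_curve {U W : normedModType R} (c : R -> U) (f : U -> W) (t : R) c' :
  is_derive t 1 c c' -> differentiable f (c t) ->
  is_derive t 1 (f \o c) ('D_c' f (c t)).
Proof.
move=> [dc <-] df; have dc1 : differentiable c t by apply/derivable1_diffP.
apply: DeriveDef; last by rewrite derive_comp// [RHS]deriveE.
by apply: diff_derivable; exact: differentiable_comp.
Qed.

Lemma is_derive_line {U : normedModType R} (x v : U) (t : R) :
  is_derive t 1 (fun s : R => x + s *: v) v.
Proof.
have h1 : is_derive t (1 : R) (fun s : R => s *: v) v.
  have d : is_diff t (fun s : R => s *: v) (fun s : R => s *: v).
    exact: is_diff_scalel.
  apply: DeriveDef; first by apply: diff_derivable; exact: ex_diff.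
  by rewrite deriveE ?diff_val ?scale1r//; exact: ex_diff.
have := is_deriveD (is_derive_cst x t 1) h1.
by rewrite add0r.
Qed.

Lemma is_derive_along {U W : normedModType R} (f : U -> W) (x v : U) (t : R) :
  differentiable f (x + t *: v) ->
  is_derive t 1 (fun s : R => f (x + s *: v)) ('D_v f (x + t *: v)).
Proof. exact: (is_derive_curve (is_derive_line x v t)). Qed.

Lemma MVT_cc (f df : R -> R) (a b : R) : a < b ->
  (forall x : R, x \in `[a, b] -> is_derive x 1 f (df x)) ->
  exists2 c : R, c \in `[a, b] & f b - f a = df c * (b - a).
Proof.
move=> ab d.
have d1 (x : R) : x \in `]a, b[ -> is_derive x 1 f (df x).
  by move=> xab; apply: d; exact: subset_itv_oo_cc.
have [|c cab e] := MVT ab d1.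
  by apply: derivable_within_continuous => s /d[].
by exists c => //; exact: subset_itv_oo_cc.
Qed.

Lemma MVT_along {U : normedModType R} (f : U -> R) (x v : U) (h : R) : 0 < h ->
  (forall s : R, s \in `[0, h] -> differentiable f (x + s *: v)) ->
  exists2 s : R, s \in `[0, h] & f (x + h *: v) - f x = 'D_v f (x + s *: v) * h.
Proof.
move=> h0 df.
have d (s : R) : s \in `[0, h] -> is_derive s 1 (fun s : R => f (x + s *: v)) ('D_v f (x + s *: v)).
  by move=> /df; exact: is_derive_along.
pose g (s : R) := f (x + s *: v); pose dg (s : R) := 'D_v f (x + s *: v).
have [s sh] : exists2 s : R, s \in `[0, h] & g h - g 0 = dg s * (h - 0).
  exact: (@MVT_cc g dg).
by rewrite /g /dg scale0r addr0 subr0 => e; exists s.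
Qed.

Lemma dist_half_le (a b c e : R) : `|a - c| <= e / 2 -> `|b - c| <= e / 2 -> `|a - b| <= e.
Proof.
move=> h1 h2; rewrite -(subrKA c) (le_trans (ler_normD _ _))// [leRHS]splitr.
by rewrite lerD// distrC.
Qed.

Lemma eq_of_dist_le (a b : R) : (forall e : R, 0 < e -> `|a - b| <= e) -> a = b.
Proof.
move=> h; apply/eqP; rewrite -subr_eq0 -normr_le0; apply/ler_addgt0Pr => e e0.
by rewrite add0r h.
Qed.

(** The second difference is the increment along [v] of [g y = f (y + h w) - f y]. One mean value
    theorem along [v] and a second one along [w] turn it into a mixed derivative at some point of
    the square. *)
Lemma second_difference {U : normedModType R} (f : U -> R) (x v w : U) (h : R) : 0 < h ->
  (forall s t : R, s \in `[0, h] -> t \in `[0, h] -> smooth_at f (x + s *: v + t *: w)) ->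
  exists s t : R, [/\ s \in `[0, h], t \in `[0, h] &
    f (x + h *: v + h *: w) - f (x + h *: v) - f (x + h *: w) + f x
      = 'D_w ('D_v f) (x + s *: v + t *: w) * h * h].
Proof.
move=> h0 sf.
have m0 : (0 : R) \in `[(0 : R), h] by rewrite in_itv /= lexx ltW.
have mh : h \in `[0, h] by rewrite in_itv /= lexx ltW.
have sf0 (s : R) : s \in `[0, h] -> smooth_at f (x + s *: v).
  by move=> sh; have := sf s 0 sh m0; rewrite scale0r addr0.
pose g y := f (y + h *: w) - f y.
have dsh (s : R) : s \in `[0, h] -> differentiable (fun y => f (y + h *: w)) (x + s *: v) /\
   'D_v (fun y => f (y + h *: w)) (x + s *: v) = 'D_v f (x + s *: v + h *: w).
  move=> sh.
  have ds : is_diff (x + s *: v) (fun y => y + h *: w) id.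
    have := is_diffD (is_diff_id (x + s *: v)) (is_diff_cst (h *: w) (x + s *: v)).
    by rewrite addr0.
  have df : differentiable f (x + s *: v + h *: w) by apply/smooth_at_diff/sf.
  split; first exact: (@differentiable_comp _ _ _ _ (fun y => y + h *: w) f).
  by rewrite (derive_comp (f:=(fun y => y + h *: w)))// !deriveE// diff_val.
have dg (s : R) : s \in `[0, h] -> differentiable g (x + s *: v) /\
    'D_v g (x + s *: v) = 'D_v f (x + s *: v + h *: w) - 'D_v f (x + s *: v).
  move=> sh; have [d1 <-] := dsh s sh; have d2 := smooth_at_diff (sf0 _ sh).
  split; first exact: differentiableB.
  by rewrite deriveB//; exact: diff_derivable.
have [|s sh es] := @MVT_along _ g x v h h0; first by move=> s /dg[].
have [|t th et] := @MVT_along _ ('D_v f) (x + s *: v) w h h0.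
  by move=> t th; apply/smooth_at_diff/smooth_at_derive/sf.
exists s, t; split=> //; rewrite -et -(dg s sh).2 -es /g; ring.
Qed.

Lemma near_square {U : normedModType R} (x v w : U) (P : U -> Prop) :
  (\near x, P x) -> exists2 h : R, 0 < h &
    forall s t : R, s \in `[0, h] -> t \in `[0, h] -> P (x + s *: v + t *: w).
Proof.
move=> Px.
have c : {for (0, 0), continuous (fun z : R * R => x + z.1 *: v + z.2 *: w)}.
  apply: differentiable_continuous.
  apply: differentiableD; last first.
    by apply: differentiableZl; have [] := is_diff_snd ((0, 0) : R * R).
  apply: differentiableD => //.
  by apply: differentiableZl; have [] := is_diff_fst ((0, 0) : R * R).
have : nbhs ((0, 0) : R * R) (fun z => P (x + z.1 *: v + z.2 *: w)).
  by apply: c; rewrite /= !scale0r !addr0.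
move=> /nbhs_ballP[e /= e0 he]; exists (e / 2); first by rewrite divr_gt0.
move=> s t; rewrite !in_itv /= => /andP[s0 s1] /andP[t0 t1].
have hl (r : R) : 0 <= r -> r <= e / 2 -> `|0 - r| < e.
  by move=> r0 r1; rewrite sub0r normrN ger0_norm// (le_lt_trans r1)// gtr_pMr// invf_lt1// ltr1n.
by apply: (he (s, t)); split; rewrite -ball_normE /=; exact: hl.
Qed.

(** The second difference is symmetric in [v] and [w], so in every small square the two mixed
    derivatives agree at two points, possibly different ones. Continuity moves both points to
    [x]. *)
Lemma schwarz {U : normedModType R} (f : U -> R) (x v w : U) :
  smooth_at f x -> 'D_v ('D_w f) x = 'D_w ('D_v f) x.
Proof.
move=> sf; apply: eq_of_dist_le => e e0.
have e2 : 0 < e / 2 by rewrite divr_gt0.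
have c1 := smooth_at_cont (smooth_at_derive v (smooth_at_derive w sf)).
have c2 := smooth_at_cont (smooth_at_derive w (smooth_at_derive v sf)).
move/cvgrPdist_le: c1 => /(_ _ e2) c1.
move/cvgrPdist_le: c2 => /(_ _ e2) c2.
have nf := near_smooth_at sf.
have [h h0 H] := near_square v w (filterI nf (filterI c1 c2)).
have [s [t [sh th e1]]] := second_difference h0 (fun s t sh th => (H s t sh th).1).
have [|s' [t' [sh' th' e1']]] := @second_difference _ f x w v h h0.
  by move=> a b ah bh; have [] := H b a bh ah; rewrite addrAC.
have {e1 e1'} E : 'D_w ('D_v f) (x + s *: v + t *: w) = 'D_v ('D_w f) (x + s' *: w + t' *: v).
  have hn : h != 0 by rewrite gt_eqF.
  apply: (mulIf hn); apply: (mulIf hn).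
  have ex : x + h *: w + h *: v = x + h *: v + h *: w by exact: addrAC.
  move: e1'; rewrite ex; move: e1.
  move: ('D_w ('D_v f) _) ('D_v ('D_w f) _) => D1 D2 e1 e2'.
  apply: etrans (esym e1) _; apply: etrans _ e2'.
  by congr (_ + _); exact: addrAC.
have [_ [_ /= b2]] := H _ _ sh th; have [_ [/= b1 _]] := H _ _ th' sh'.
move: b1; rewrite addrAC -E => b1.
set a1 := 'D_v _ x in b1 *; set a2 := 'D_w _ x in b2 *.
exact: dist_half_le b1 b2.
Qed.

Lemma smooth_at_sin (x : R) : smooth_at (@sin R) x /\ smooth_at (@cos R) x.
Proof.
(* The two functions are treated together, because each is up to sign the derivative of the
   other. *)
suff H n : smooth_upto n setT (@sin R) /\ smooth_upto n setT (@cos R).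
  by split; apply/smooth_atP; exists setT; split=> //; try exact: openT; move=> n; have [] := H n.
have d1 (y : R) : differentiable (@sin R) y by apply/derivable1_diffP; case: (is_derive_sin y).
have d2 (y : R) : differentiable (@cos R) y by apply/derivable1_diffP; case: (is_derive_cos y).
elim: n => [|n [IH1 IH2]].
  by rewrite !smooth_upto0; split=> y _.
have v1 (f : R -> R) v y : differentiable f y -> 'D_v f y = 'D_1 f y * v.
  by move=> df; rewrite -{1}[v]mulr1 -/(v *: (1 : R)) deriveZr// mulrC.
rewrite !smooth_uptoS; split; split=> [y _|v] //.
  apply: (@smooth_upto_eq _ _ _ openT _ _ (@cos R * cst v)); last first.
    by apply: smooth_uptoM => //; [exact: openT|apply: smooth_upto_cst; exact: openT].
  by move=> y _; rewrite v1//= (@derive_val _ _ _ _ _ _ _ (is_derive_sin y)).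
apply: (@smooth_upto_eq _ _ _ openT _ _ (@sin R * cst (- v))); last first.
  by apply: smooth_uptoM => //; [exact: openT|apply: smooth_upto_cst; exact: openT].
move=> y _; rewrite v1//= (@derive_val _ _ _ _ _ _ _ (is_derive_cos y)).
by rewrite !fctE mulrN mulNr.
Qed.

End Calc2.

(** * Integrals depending on a parameter *)

Section Integrals.
Context {R : realType}.
Implicit Types (a b : R) (f g : R -> R).
Local Notation mu := (@lebesgue_measure R).

Definition integ a b f : R := \int[mu]_(t in `[a, b]) f t.

Definition cont_on a b f := forall t : R, t \in `[a, b] -> {for t, continuous f}.

Lemma cont_on_within a b f : cont_on a b f -> {within `[a, b], continuous f}.
Proof.
move=> cf; apply: continuous_in_subspaceT => t; rewrite inE => tab.
exact: cf.
Qed.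

Lemma cont_on_integrable a b f : cont_on a b f -> mu.-integrable `[a, b] (EFin \o f).
Proof.
move=> /cont_on_within cf; apply: continuous_compact_integrable => //.
exact: segment_compact.
Qed.

Lemma eq_integ a b f g : (forall t : R, t \in `[a, b] -> f t = g t) -> integ a b f = integ a b g.
Proof. by move=> fg; apply: eq_Rintegral => t; rewrite inE /= => /fg. Qed.

Lemma integD a b f g : cont_on a b f -> cont_on a b g ->
  integ a b (fun t => f t + g t) = integ a b f + integ a b g.
Proof. by move=> cf cg; apply: RintegralD => //; exact: cont_on_integrable. Qed.

Lemma integZ a b (k : R) f : cont_on a b f ->
  integ a b (fun t => k * f t) = k * integ a b f.
Proof. by move=> cf; apply: RintegralZl => //; exact: cont_on_integrable. Qed.

Lemma integ_cst a b (k : R) : a <= b -> integ a b (fun=> k) = k * (b - a).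
Proof.
move=> ab; rewrite /integ Rintegral_cst//; congr (_ * _).
suff E : mu `[a, b] = (b - a)%:E by exact: (congr1 fine E).
have := @lebesgue_measure_itv R `[a, b]; rewrite /= lte_fin => ->.
by case: ltgtP ab => // -> _; rewrite subrr.
Qed.

Lemma le_integ a b f g : cont_on a b f -> cont_on a b g ->
  (forall t : R, t \in `[a, b] -> f t <= g t) -> integ a b f <= integ a b g.
Proof.
by move=> cf cg fg; apply: le_Rintegral => //; exact: cont_on_integrable.
Qed.

Lemma cont_on_cst a b (k : R) : cont_on a b (fun=> k).
Proof. by move=> t _; exact: cvg_cst. Qed.

Lemma cont_onD a b f g : cont_on a b f -> cont_on a b g -> cont_on a b (fun t => f t + g t).
Proof. by move=> cf cg t tab; apply: continuousD; auto. Qed.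

Lemma cont_onM a b f g : cont_on a b f -> cont_on a b g -> cont_on a b (fun t => f t * g t).
Proof. by move=> cf cg t tab; apply: continuousM; auto. Qed.

Lemma cont_onZ a b (k : R) f : cont_on a b f -> cont_on a b (fun t => k * f t).
Proof. by move=> cf; apply: cont_onM => //; exact: cont_on_cst. Qed.

Lemma cont_onB a b f g : cont_on a b f -> cont_on a b g -> cont_on a b (fun t => f t - g t).
Proof. by move=> cf cg t tab; apply: continuousB; auto. Qed.

Lemma integB a b f g : cont_on a b f -> cont_on a b g ->
  integ a b (fun t => f t - g t) = integ a b f - integ a b g.
Proof. by move=> cf cg; apply: RintegralB => //; exact: cont_on_integrable. Qed.

Lemma integ_bound a b f (M : R) : a <= b -> cont_on a b f ->
  (forall t : R, t \in `[a, b] -> `|f t| <= M) -> `|integ a b f| <= M * (b - a).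
Proof.
move=> ab cf fM; rewrite ler_norml -mulNr -!integ_cst//.
by apply/andP; split; apply: le_integ => //; try exact: cont_on_cst;
  move=> t /fM; rewrite ler_norml => /andP[].
Qed.

Lemma integ_FTC a b (F f : R -> R) : a <= b -> cont_on a b f ->
  (forall t : R, t \in `[a, b] -> is_derive t 1 F (f t)) -> integ a b f = F b - F a.
Proof.
rewrite le_eqVlt => /predU1P[<- _ _|ab cf dF].
  by rewrite subrr /integ set_itv1 Rintegral_set1.
have cF (t : R) : t \in `[a, b] -> {for t, continuous F}.
  by move=> /dF[/derivable1_diffP/differentiable_continuous].
have aab : a \in `[a, b] by rewrite in_itv /= lexx ltW.
have bab : b \in `[a, b] by rewrite in_itv /= lexx ltW.
rewrite /integ /Rintegral (@continuous_FTC2 _ f F a b ab)//.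
- exact: cont_on_within.
- split.
  + by move=> t tab; have [] := dF t (subset_itv_oo_cc tab).
  + exact/cvg_at_right_filter/cF.
  + exact/cvg_at_left_filter/cF.
- by move=> t tab; rewrite derive1E; have [] := dF t (subset_itv_oo_cc tab).
Qed.

(** The tube lemma: compactness of the segment yields one neighbourhood of [x] that serves all
    [t]. *)
Lemma tube {X : topologicalType} a b (x : X) (P : X * R -> Prop) :
  (forall t : R, t \in `[a, b] -> nbhs (x, t) P) ->
  \forall y \near x, forall t : R, t \in `[a, b] -> P (y, t).
Proof.
move=> h; have := (@compact_near_coveringP R `[a, b]).1 (segment_compact (a:=a) (b:=b)).
move=> /(_ X (nbhs x) (fun x t => P (x, t)) _); apply => t tab.
have [[A B] [/= Ax Bt] AB] := h t tab.
by exists (B, A) => // -[s y] [/= Bs Ay]; exact: (AB (y, s)).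
Qed.

Lemma is_diff_intro {U W : normedModType R} (F : U -> W) (l : U -> W) x :
  linear l -> continuous l ->
  (forall e : R, 0 < e -> \forall u \near (0 : U), `|F (u + x) - F x - l u| <= e * `|u|) ->
  is_diff x F l.
Proof.
move=> ll lc H.
pose fM := GRing.isLinear.Build _ _ _ _ l ll.
pose fL : {linear U -> W} := HB.pack l fM.
have D : F \o shift x = cst (F x) + fL +o_ (0 : U) id.
  apply/eqaddoP => e e0; apply: filterS (H e e0) => u /=.
  by rewrite !fctE /= opprD addrA.
have E := @diff_unique _ _ _ F fL x lc D.
apply: DiffDef => //; apply/diff_locallyP; rewrite E; split=> //.
Qed.

Lemma is_diff_is_linear {U W : normedModType R} (l : U -> W) x : is_diff x l l ->
  linear l /\ exists2 k : R, 0 < k & forall u, `|l u| <= k * `|u|.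
Proof.
move=> dl; split=> [a u v|].
  by rewrite -(@diff_val _ _ _ _ _ _ _ dl) linearP.
have [|k k0 h] := @linear_lipschitz _ _ _ ('d l x).
  by apply: diff_continuous; exact: ex_diff.
by exists k => // u; have := h u; rewrite diff_val.
Qed.

Lemma fdim_norm {U : normedModType R} m (l : 'I_m -> U -> R) :
  (forall i w, is_diff w (l i) (l i)) ->
  exists2 K : R, 0 < K & forall u, \sum_i `|l i u| <= K * `|u|.
Proof.
move=> dl.
have /choice[k hk] i : exists k : R, 0 < k /\ forall u, `|l i u| <= k * `|u|.
  by have [_ [k k0 h]] := is_diff_is_linear (dl i 0); exists k.
exists (1 + \sum_i k i).
  by rewrite ltr_wpDr// sumr_ge0// => i _; apply/ltW; have [] := hk i.
move=> u; rewrite mulrDl mul1r ler_wpDl// mulr_suml.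
by apply: ler_sum => i _; have [_] := hk i.
Qed.

Lemma derive_pair_linl {U V : normedModType R} (h : U * V -> R) z k u v :
  differentiable h z -> 'D_(k *: u + v, 0) h z = k * 'D_(u, 0) h z + 'D_(v, 0) h z.
Proof.
move=> dh.
have -> : (k *: u + v, 0 : V) = k *: (u, 0) + (v, 0).
  by congr pair; rewrite /= ?scaler0 ?addr0.
by rewrite deriveDr// deriveZr.
Qed.

Lemma scaled_bound_le (e M K u c : R) : 0 <= e -> 0 < M -> 0 <= u -> K * c <= M ->
  e / M * (K * u) * c <= e * u.
Proof.
move=> e0 M0 u0 KcM.
have -> : e / M * (K * u) * c = e * u * (K * c / M) by ring.
by rewrite ler_piMr ?mulr_ge0// ler_pdivrMr// mul1r.
Qed.

Section Param.
Context {U : normedModType R} (fU : fdim U) (a b : R).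
Hypothesis ab : a <= b.

Let sm (h : U * R -> R) x := forall t : R, t \in `[a, b] -> smooth_at h (x, t).

Lemma cont_on_slice (h : U * R -> R) x : sm h x -> cont_on a b (fun t => h (x, t)).
Proof.
move=> sf t tab; have := smooth_at_cont (sf t tab).
move=> c; apply: (@continuous_comp R (U * R)%type R (fun s : R => (x, s)) h) => //.
by apply/differentiable_continuous/differentiable_pair => //; exact: differentiable_cst.
Qed.

(** Differentiation under the integral. The mean value theorem replaces the increment by a
    derivative at an intermediate point; finitely many partial derivatives control it, and [tube]
    makes their oscillation small uniformly in [t]. *)
Lemma is_diff_integ (h : U * R -> R) x : sm h x ->
  is_diff x (fun y => integ a b (fun t => h (y, t)))
    (fun u => integ a b (fun t => 'D_(u, 0) h (x, t))).
Proof.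
move=> sf.
have smd u : sm ('D_(u, 0) h) x by move=> t tab; exact: smooth_at_derive (sf t tab).
have cd u : cont_on a b (fun t => 'D_(u, 0) h (x, t)) by exact: cont_on_slice (smd u).
have lin : linear (fun u => integ a b (fun t => 'D_(u, 0) h (x, t))).
  move=> k u v; rewrite [X in _ = X + _](_ : _ = k * integ a b (fun t => 'D_(u, 0) h (x, t)))//.
  rewrite -integZ// -integD//; last first.
    by apply: cont_onM => //; exact: cont_on_cst.
  by apply: eq_integ => t tab; apply: derive_pair_linl; exact: smooth_at_diff (sf t tab).
have clin : continuous (fun u => integ a b (fun t => 'D_(u, 0) h (x, t))).
  move=> u; apply: differentiable_continuous.
  by have [] := is_diff_fdim fU lin u.
apply: is_diff_intro => // e e0.
have [m [B [l [dl hl]]]] := fU.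
have [K K0 hK] := fdim_norm dl.
(* The tolerance [e / M] is multiplied by [K] when the coordinates of [u] are summed and by [b - a]
   when integrating; the summand 1 keeps [M] positive when [a = b]. *)
pose M := K * (b - a) + 1.
have ba0 : 0 <= b - a by rewrite subr_ge0.
have M0 : 0 < M by rewrite ltr_wpDl// mulr_ge0// ltW.
have eM : 0 < e / M by rewrite divr_gt0.
have H : \forall y \near x, forall t : R, t \in `[a, b] ->
    smooth_at h (y, t) /\
    forall j, `|'D_(B j, 0) h (x, t) - 'D_(B j, 0) h (y, t)| <= e / M.
  apply: (@tube _ a b x (fun z => smooth_at h z /\
    forall j, `|'D_(B j, 0) h (x, z.2) - 'D_(B j, 0) h z| <= e / M)) => t tab.
  apply: filterI; first exact: near_smooth_at (sf t tab).
  apply: (@filter_forall _ _ (fun j z => `|'D_(B j, 0) h (x, z.2) - 'D_(B j, 0) h z| <= e / M) (nbhs (x, t)) _) => j.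
  have e2 : 0 < e / M / 2 by rewrite divr_gt0.
  have c1 := smooth_at_cont (smd (B j) t tab).
  have c2 : {for (x, t), continuous (fun z : U * R => 'D_(B j, 0) h (x, z.2))}.
    apply: (@continuous_comp (U * R)%type (U * R)%type R (fun z : U * R => (x, z.2)) ('D_(B j, 0) h)) => //.
    apply/differentiable_continuous/differentiable_pair; first exact: differentiable_cst.
    by have [] := is_diff_snd (x, t).
  move/cvgrPdist_le: c1 => /(_ _ e2) c1.
  move/cvgrPdist_le: c2 => /(_ _ e2) c2.
  apply: filterS2 c1 c2 => z /= c1 c2.
  by rewrite distrC in c1; rewrite distrC in c2; exact: dist_half_le c2 c1.
move/nbhs_ballP: H => [d /= d0 hd].
apply/nbhs_ballP; exists d => //= u; rewrite -ball_normE /= sub0r normrN => ud.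
have hs (s : R) : s \in `[0, 1] -> ball x d (x + s *: u).
  rewrite in_itv /= => /andP[s0 s1]; rewrite -ball_normE /= opprD addNKr normrN normrZ.
  by rewrite ger0_norm// (le_lt_trans _ ud)// ler_piMl.
have hx : ball x d x by exact: ballxx.
have hu : ball x d (x + u) by have := hs 1; rewrite scale1r; apply; rewrite in_itv /= lexx ler01.
have csl y : ball x d y -> cont_on a b (fun t => h (y, t)).
  by move=> Hy; apply: cont_on_slice => t tab; have [] := hd y Hy t tab.
rewrite [u + x]addrC.
have -> : integ a b (fun t => h (x + u, t)) - integ a b (fun t => h (x, t)) -
  integ a b (fun t => 'D_(u, 0) h (x, t)) =
  integ a b (fun t => h (x + u, t) - h (x, t) - 'D_(u, 0) h (x, t)).
  rewrite integB; [|by apply: cont_onB; exact: csl|exact: cd].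
  by rewrite integB//; exact: csl.
have Dsum (z : U * R) : differentiable h z ->
    'D_(u, 0) h z = \sum_j l j u * 'D_(B j, 0) h z.
  move=> dz; rewrite {1}[u]hl.
  have -> : (\sum_j l j u *: B j, 0) = \sum_j l j u *: (B j, 0 : R).
    elim/big_rec2: _ => // j y1 y2 _ <-.
    by congr pair; rewrite /= ?scaler0 ?addr0.
  by rewrite deriveE// linear_sum; apply: eq_bigr => j _; rewrite linearZ_LR -deriveE.
have eK : e / M * (K * `|u|) * (b - a) <= e * `|u|.
  by apply: scaled_bound_le => //; [exact: ltW|rewrite /M lerDl].
apply: le_trans eK; apply: integ_bound => //.
  by apply: cont_onB => //; apply: cont_onB; exact: csl.
move=> t tab.
have zE (s : R) : (x, t) + s *: (u, 0) = (x + s *: u, t).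
  by congr pair; rewrite /= ?scaler0 ?addr0.
have [|s s01] := @MVT_along R _ h (x, t) (u, 0) 1 ltr01.
  by move=> s s01; rewrite zE; apply: smooth_at_diff; have [] := hd _ (hs s s01) t tab.
rewrite !zE scale1r mulr1 => es.
rewrite es.
have [sxs dxs] := hd _ (hs s s01) t tab.
rewrite !Dsum; [|exact: smooth_at_diff (sf t tab)|exact: smooth_at_diff].
rewrite -sumrB (le_trans (ler_norm_sum _ _ _))//.
apply: (@le_trans _ _ (\sum_i e / M * `|l i u|)).
  apply: ler_sum => j _; rewrite -mulrBr normrM mulrC ler_wpM2r// distrC.
  exact: dxs.
by rewrite -mulr_sumr ler_pM2l.
Qed.

Lemma integ_diff (h : U * R -> R) x : sm h x ->
  differentiable (fun y => integ a b (fun t => h (y, t))) x.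
Proof. by move=> /is_diff_integ[]. Qed.

Lemma derive_integ (h : U * R -> R) x u : sm h x ->
  'D_u (fun y => integ a b (fun t => h (y, t))) x = integ a b (fun t => 'D_(u, 0) h (x, t)).
Proof. by move=> /is_diff_integ d; rewrite deriveE ?diff_val//; exact: ex_diff. Qed.

Lemma smooth_at_integ (h : U * R -> R) x : sm h x ->
  smooth_at (fun y => integ a b (fun t => h (y, t))) x.
Proof.
move=> sf.
have : \forall y \near x, sm h y.
  by apply: (@tube _ a b x (smooth_at h)) => t tab; exact: near_smooth_at (sf t tab).
rewrite -nbhs_nearE nbhsE => -[P [oP Px] PQ]; apply/smooth_atP; exists P; split=> // n.
elim: n h PQ {sf} => [|n IH] h PQ.
  by rewrite smooth_upto0 => y /PQ; exact: integ_diff.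
rewrite smooth_uptoS; split=> [y /PQ|u]; first exact: integ_diff.
apply: (smooth_upto_eq oP (f := fun y => integ a b (fun t => 'D_(u, 0) h (y, t)))).
  by move=> y /PQ sy; rewrite derive_integ.
by apply: (IH ('D_(u, 0) h)) => y /PQ sy t tab; exact: smooth_at_derive (sy t tab).
Qed.

End Param.
End Integrals.

(** * Ordinary differential equations *)

Section Picard.
Context {R : realType}.

(** With radius [e k = 2 * r / 2 ^+ k] the intervals around [u k] are nested, since [e k] exceeds
    [e k.+1] by exactly the allowed jump. The supremum of their left ends is the limit, with an
    explicit rate. *)
Lemma dyadic_cauchy (u : nat -> R) (r : R) :
  (forall k, `|u k.+1 - u k| <= r / 2 ^+ k) ->
  exists l : R, forall k, `|u k - l| <= 2 * r / 2 ^+ k.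
Proof.
move=> hu.
have h2 k : (0 : R) < 2 ^+ k by rewrite exprn_gt0.
have r0 : 0 <= r by have := le_trans (normr_ge0 _) (hu 0%N); rewrite expr0 divr1.
pose e k := 2 * r / 2 ^+ k.
have ee k : e k = r / 2 ^+ k + e k.+1.
  by rewrite /e exprS invfM; field; rewrite gt_eqF.
have e0 k : 0 <= e k by rewrite /e divr_ge0 ?mulr_ge0// ltW.
have down k m : u k - e k <= u (k + m)%N - e (k + m)%N.
  elim: m => [|m IH]; first by rewrite addn0.
  apply: (le_trans IH); rewrite addnS; have := hu (k + m)%N.
  rewrite ler_norml => /andP[h _]; rewrite [e (k + m)%N]ee; move: h; lra.
have up k m : u (k + m)%N + e (k + m)%N <= u k + e k.
  elim: m => [|m IH]; first by rewrite addn0.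
  apply: (le_trans _ IH); rewrite addnS; have := hu (k + m)%N.
  rewrite ler_norml => /andP[_ h]; rewrite [e (k + m)%N]ee; move: h; lra.
have sep k m : u k - e k <= u m + e m.
  apply: (le_trans (down k m)); apply: (le_trans _ (up m k)); rewrite addnC.
  have := e0 (k + m)%N; rewrite addnC; lra.
pose A := [set x | exists k, x = u k - e k].
have A0 : A !=set0 by exists (u 0%N - e 0%N), 0%N.
exists (sup A) => k; rewrite ler_distlC.
apply/andP; split.
  apply: sup_ubound; last by exists k.
  by exists (u 0%N + e 0%N) => _ [j ->]; exact: sep.
by apply: ge_sup => // _ [j ->]; exact: sep.
Qed.

Lemma le_half_pow (x C : R) : (forall k, x <= C / 2 ^+ k) -> x <= 0.
Proof.
move=> h; apply/ler_addgt0Pr => e e0; rewrite add0r.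
have [C0|C0] := leP C 0.
  by rewrite (le_trans (h 0%N))// expr0 divr1 (le_trans C0)// ltW.
have : (fun k => C * (2^-1) ^+ k : R) @ \oo --> (0 : R).
  by apply: cvg_geometric; rewrite ger0_norm// invf_lt1// ltr1n.
move/cvgrPdist_le => /(_ _ e0)[k _ /(_ k (leqnn k))] /=.
rewrite sub0r normrN => H; apply: le_trans (h k) _; apply: le_trans H.
by rewrite -exprVn ler_norm.
Qed.

Lemma rV_norm_le N (x : 'rV[R]_N) (c : R) : 0 <= c ->
  (`|x| <= c) <-> (forall j, `|x ord0 j| <= c).
Proof.
move=> c0; rewrite (_ : `|x| = mx_norm x)// mx_normrE; split=> [h j|h].
  by apply: le_trans h; exact: (le_bigmax _ (fun ij : 'I_1 * 'I_N => `|x ij.1 ij.2|) (ord0, j)).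
by apply: bigmax_le => // -[i j] _ /=; rewrite (ord1 i).
Qed.

Lemma rV_coord_le N (x : 'rV[R]_N) j : `|x ord0 j| <= `|x|.
Proof. exact: ((rV_norm_le x (normr_ge0 x)).1 (lexx _)). Qed.

Lemma is_derive_primitive (c : R) (g : R -> R) (t : R) : continuous g -> c < t ->
  is_derive t 1 (fun x => integ c x g) (g t).
Proof.
move=> cg ct.
have [||d e] := @continuous_FTC1_closed R g c t (t + 1) _ _ ct (cg t).
- by rewrite ltrDl.
- by apply: cont_on_integrable => s _; exact: cg.
change (derivable (fun x => integ c x g) t 1) in d.
change (derive1 (fun x => integ c x g) t = g t) in e.
by apply: DeriveDef; [exact: d|rewrite -derive1E; exact: e].
Qed.

(** The lower limit [c] lies strictly to the left of the interval, because a primitive is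
    differentiable only strictly to the right of its lower limit. Subtracting the value at 0 then
    gives the integral from 0 to [t], for either sign of [t]. *)
Lemma primitive_bound (c h M : R) (g : R -> R) (t : R) : continuous g -> c < - h ->
  (forall s : R, s \in `[-h, h] -> `|g s| <= M) -> t \in `[-h, h] ->
  `|integ c t g - integ c 0 g| <= M * h.
Proof.
move=> cg ch gM; rewrite in_itv /= => /andP[t1 t2].
have h0 : 0 <= h by lra.
have M0 : 0 <= M by apply: le_trans (gM 0 _); rewrite ?normr_ge0// in_itv /=; lra.
have cmp (a b : R) : -h <= a -> a < b -> b <= h ->
    `|integ c b g - integ c a g| <= M * (b - a).
  move=> ha ab bh.
  have [s|s sab ->] := @MVT_cc R (fun x => integ c x g) g a b ab.
    rewrite in_itv /= => /andP[sa _]; apply: is_derive_primitive => //.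
    exact: lt_le_trans (lt_le_trans ch ha) sa.
  have ba : 0 <= b - a by lra.
  rewrite normrM (ger0_norm ba) ler_wpM2r//; apply: gM.
  by move: sab; rewrite !in_itv /=; lra.
have [t0|t0|->] := ltgtP t 0.
- rewrite distrC (le_trans (cmp _ _ t1 t0 h0))// ler_wpM2l//; lra.
- rewrite (le_trans (cmp _ _ _ t0 t2))//; first lra.
  rewrite ler_wpM2l//; lra.
- by rewrite subrr normr0 mulr_ge0.
Qed.

Lemma is_derive_rV {U : normedModType R} n (f : U -> 'rV[R]_n) x v (d : 'rV[R]_n) :
  (forall j, is_derive x v (fun y => f y ord0 j) (d ord0 j)) -> is_derive x v f d.
Proof.
move=> h; have df : derivable f x v.
  by apply/derivable_mxP => i j; rewrite (ord1 i); have [] := h j.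
apply: DeriveDef => //; apply/rowP => j; rewrite derive_mx// mxE.
by have [] := h j.
Qed.

Section Iterate.
Variables (N : nat) (Psi : 'rV[R]_N -> 'rV[R]_N) (z0 : 'rV[R]_N) (r K h : R).
Hypotheses (r0 : 0 < r) (K0 : 0 <= K) (h0 : 0 < h).
Hypothesis lipK : forall y y', `|y - z0| <= r -> `|y' - z0| <= r ->
  `|Psi y - Psi y'| <= K * `|y - y'|.
Hypothesis hK : K * h <= 1 / 2.
Hypothesis hM : (`|Psi z0| + K * r) * h <= r.

(* Clamping the time makes every iterate continuous on the whole line. *)
Let clamp (t : R) : R := Num.max (- h) (Num.min h t).

Let clamp_in t : clamp t \in `[-h, h].
Proof.
rewrite in_itv /= /clamp le_max lexx /= ge_max ge_min lexx /= andbT.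
by rewrite lerNl (le_trans _ (ltW h0))// oppr_le0 ltW.
Qed.

Let clampK (t : R) : t \in `[-h, h] -> clamp t = t.
Proof. by rewrite in_itv /= /clamp => /andP[t1 t2]; rewrite min_r// max_r. Qed.

Let clamp_cont : continuous clamp.
Proof.
have c0 (k : R) : continuous (fun _ : R => k) by move=> t; exact: cvg_cst.
have c1 : continuous (fun t : R => Num.min h t).
  by move=> t; apply: (@continuous_min R R (fun=> h) id t); [exact: c0|exact: cvg_id].
by move=> t; apply: (@continuous_max R R (fun=> - h) (fun t : R => Num.min h t) t); [exact: c0|exact: c1].
Qed.

Let good (u : R -> 'rV[R]_N) := continuous (u \o clamp) /\
  forall t : R, t \in `[-h, h] -> `|u t - z0| <= r.

(** The Picard operator: the integral from 0 to [t], written as a difference of integrals that both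
    start to the left of [-h]. *)
Let step (u : R -> 'rV[R]_N) (t : R) : 'rV[R]_N := z0 +
  \row_j (integ (- h - 1) t (fun s => Psi (u (clamp s)) ord0 j)
          - integ (- h - 1) 0 (fun s => Psi (u (clamp s)) ord0 j)).

Let ch : - h - 1 < - h. Proof. by rewrite ltrBlDr ltrDl. Qed.

Let good_Psi u : good u -> continuous (Psi \o u \o clamp).
Proof.
move=> [cu bu] t; apply/cvgrPdist_le => e e0.
have e1 : 0 < e / (K + 1) by rewrite divr_gt0// ltr_wpDl.
move/cvgrPdist_le: (cu t) => /(_ _ e1); apply: filterS => s /= hs.
apply: (le_trans (lipK _ _)); [exact: bu (clamp_in _)|exact: bu (clamp_in _)|].
apply: (le_trans (ler_wpM2l K0 hs)).
have K1 : 0 < K + 1 by rewrite ltr_wpDl.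
by rewrite mulrCA -[leRHS]mulr1 ler_pM2l// ler_pdivrMr// mul1r lerDl.
Qed.

Let good_coord u j : good u -> continuous (fun s => Psi (u (clamp s)) ord0 j).
Proof.
move=> gu t; apply: (@continuous_comp _ _ _ (Psi \o u \o clamp) (fun x : 'rV[R]_N => x ord0 j)).
  exact: good_Psi.
exact: coord_continuous.
Qed.

Let Psi_bound u t : good u -> t \in `[-h, h] -> `|Psi (u t)| <= `|Psi z0| + K * r.
Proof.
move=> [_ bu] th; rewrite -[Psi (u t)](subrK (Psi z0)) addrC.
rewrite (le_trans (ler_normD _ _))// lerD2l (le_trans (lipK (bu t th) _))//.
  by rewrite subrr normr0 ltW.
by rewrite ler_wpM2l// bu.
Qed.

Let step_derive u (t : R) : good u -> - h - 1 < t ->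
  is_derive t 1 (step u) (Psi (u (clamp t))).
Proof.
move=> gu th; apply: is_derive_rV => j.
pose g s := Psi (u (clamp s)) ord0 j.
have dg : is_derive t 1 (fun x => integ (- h - 1) x g) (g t).
  by apply: is_derive_primitive => //; exact: good_coord.
have := is_deriveD (is_derive_cst (z0 ord0 j - integ (- h - 1) 0 g) t 1) dg.
rewrite add0r; congr is_derive; apply/funext => s.
rewrite /step !mxE -[LHS]/(z0 ord0 j - integ (- h - 1) 0 g + integ (- h - 1) s g).
by rewrite addrAC -addrA.
Qed.

Let step_good u : good u -> good (step u).
Proof.
move=> gu; split; last first.
  move=> t th; rewrite /step addrC addKr; apply/rV_norm_le => [|j]; first exact: ltW.
  rewrite mxE; apply: le_trans hM.
  apply: primitive_bound => //; first exact: good_coord.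
  move=> s sh; rewrite clampK// (le_trans (rV_coord_le _ _))//.
  exact: Psi_bound.
move=> t; apply: (@continuous_comp R R _ clamp (step u)); first exact: clamp_cont.
apply: differentiable_continuous; apply/derivable1_diffP.
have [] // := step_derive gu (t := clamp t) _.
by apply: lt_le_trans ch _; have := clamp_in t; rewrite in_itv /= => /andP[].
Qed.

Let step_contract u u' (d : R) : good u -> good u' ->
  (forall t : R, t \in `[-h, h] -> `|u t - u' t| <= d) ->
  forall t : R, t \in `[-h, h] -> `|step u t - step u' t| <= d / 2.
Proof.
move=> gu gu' dd t th.
have d0 : 0 <= d.
  by apply: le_trans (normr_ge0 _) (dd 0 _); rewrite in_itv /= oppr_le0 ltW//= ltW.
have -> : step u t - step u' t = \row_j (
    integ (- h - 1) t (fun s => Psi (u (clamp s)) ord0 j - Psi (u' (clamp s)) ord0 j)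
  - integ (- h - 1) 0 (fun s => Psi (u (clamp s)) ord0 j - Psi (u' (clamp s)) ord0 j)).
  apply/rowP => j; rewrite !mxE.
  rewrite !integB; try by move=> s _; exact: good_coord.
  ring.
apply/rV_norm_le => [|j]; first by rewrite divr_ge0.
rewrite mxE; apply: (@le_trans _ _ (K * d * h)).
  apply: primitive_bound => //.
    by move=> s; apply: continuousB; exact: good_coord.
  move=> s sh; rewrite clampK//.
  have -> : Psi (u s) ord0 j - Psi (u' s) ord0 j = (Psi (u s) - Psi (u' s)) ord0 j.
    by rewrite !mxE.
  rewrite (le_trans (rV_coord_le _ _))//.
  apply: (le_trans (lipK (gu.2 s sh) (gu'.2 s sh))).
  by rewrite ler_wpM2l// dd.
by rewrite mulrAC mulrC ler_wpM2l// -[leRHS]mul1r.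
Qed.

(** [hM] keeps the iterates in the ball of radius [r], and [hK] makes [step] contract by the factor
    1/2. The iterates then converge at the rate of [dyadic_cauchy], and the limit is a fixed point
    on the interval. *)
Lemma picard_solution : exists z : R -> 'rV[R]_N, z 0 = z0 /\
  forall t : R, t \in `]-h, h[ -> `|z t - z0| <= r /\ is_derive t 1 z (Psi (z t)).
Proof.
pose zz k := iter k step (fun=> z0).
have z0r : `|z0 - z0| <= r by rewrite subrr normr0 ltW.
have gz k : good (zz k).
  elim: k => [|k IH]; last exact: step_good.
  by split=> [t|t _] //; exact: cvg_cst.
have h2 k : (0 : R) < 2 ^+ k by rewrite exprn_gt0.
have dz k t : t \in `[-h, h] -> `|zz k.+1 t - zz k t| <= r / 2 ^+ k.
  elim: k t => [|k IH] t th; first by rewrite expr0 divr1; have [_] := gz 1; apply.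
  have := step_contract (gz k.+1) (gz k) IH th.
  by rewrite -mulrA -invfM -exprSr.
have lim (tj : R * 'I_N) : exists l : R, tj.1 \in `[-h, h] ->
    forall k, `|zz k tj.1 ord0 tj.2 - l| <= 2 * r / 2 ^+ k.
  have [th|th] := boolP (tj.1 \in `[-h, h]); last by exists 0.
  have [k|l hl] := @dyadic_cauchy (fun k => zz k tj.1 ord0 tj.2) r; last by exists l.
  have := rV_coord_le (zz k.+1 tj.1 - zz k tj.1) tj.2; rewrite !mxE => H.
  exact: le_trans H (dz _ _ th).
have [l hl] := choice lim; pose w t : 'rV[R]_N := \row_j l (t, j).
have wz k t : t \in `[-h, h] -> `|zz k t - w t| <= 2 * r / 2 ^+ k.
  move=> th; apply/rV_norm_le => [|j].
    by rewrite divr_ge0 ?mulr_ge0// ltW.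
  by rewrite !mxE; exact: hl (t, j) th k.
have gw : good w.
  split=> [t|t th].
    apply/cvgrPdist_le => e e0.
    have [k hk] : exists k, 2 * (2 * r / 2 ^+ k) <= e / 2.
      apply: contrapT => /forallNP H.
      have : e / 2 <= 0.
        apply: (@le_half_pow _ (4 * r)) => k; apply/ltW.
        by move/negP: (H k); rewrite -ltNge => /lt_le_trans; apply; lra.
      by apply/negP; rewrite -ltNge divr_gt0.
    have e2 : 0 < e / 2 by rewrite divr_gt0.
    have [ck _] := gz k; move/cvgrPdist_le: (ck t) => /(_ _ e2).
    apply: filterS => s /= hs.
    have h1 := wz k _ (clamp_in t); have h3 := wz k _ (clamp_in s).
    rewrite distrC in h1; rewrite /=.
    have := ler_normD (w (clamp t) - zz k (clamp t)) (zz k (clamp t) - w (clamp s)).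
    have := ler_normD (zz k (clamp t) - zz k (clamp s)) (zz k (clamp s) - w (clamp s)).
    by rewrite !subrKA; move: h1 h3 hs hk; lra.
  rewrite -subr_le0; apply: (@le_half_pow _ (2 * r)) => k.
  have := ler_normD (w t - zz k t) (zz k t - z0); rewrite subrKA.
  have [_ /(_ t th)] := gz k; have := wz k t th; rewrite distrC; lra.
have fix_w t : t \in `[-h, h] -> step w t = w t.
  move=> th; apply/eqP; rewrite -subr_eq0 -normr_le0.
  apply: (@le_half_pow _ (2 * r)) => k.
  have := ler_normD (step w t - zz k.+1 t) (zz k.+1 t - w t); rewrite subrKA.
  have h1 := wz k.+1 t th.
  have := @step_contract _ _ (2 * r / 2 ^+ k) gw (gz k) _ t th.
  rewrite -iterS -/(zz k.+1) => H.
  have {}H : `|step w t - zz k.+1 t| <= 2 * r / 2 ^+ k / 2.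
    by apply: H => s sh; rewrite distrC; exact: wz.
  have e2 : 2 * r / 2 ^+ k / 2 = 2 * r / 2 ^+ k.+1 by rewrite -mulrA -invfM -exprSr.
  move: h1 H; rewrite -e2; move: (2 * r / 2 ^+ k) => X; lra.
have in0 : (0 : R) \in `[-h, h] by rewrite in_itv /= oppr_le0 !ltW.
(* The function [w] is controlled only on the closed interval; [step w] agrees with it there and is
   a primitive, hence differentiable. *)
exists (step w); split.
  rewrite /step (_ : \row_j _ = 0) ?addr0//.
  by apply/rowP => j; rewrite !mxE subrr.
move=> t th; have th' : t \in `[-h, h] by exact: subset_itv_oo_cc.
split; first by rewrite fix_w//; exact: gw.2.
rewrite fix_w// -{2}(clampK th'); apply: step_derive => //.
by apply: lt_trans ch _; move: th; rewrite in_itv /= => /andP[].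
Qed.

End Iterate.
End Picard.

Section Ode.
Context {R : realType}.

Lemma derive_scale1 {W : normedModType R} (f : R -> W) (x v : R) : differentiable f x ->
  'D_v f x = v *: 'D_1 f x.
Proof. by move=> df; rewrite -deriveZr//; congr ('D__ f x); rewrite /GRing.scale /= mulr1. Qed.

Lemma derive_rV_sum N (f : 'rV[R]_N -> R) (x v : 'rV[R]_N) : differentiable f x ->
  'D_v f x = \sum_j v ord0 j * 'D_('e_j) f x.
Proof.
move=> df; rewrite deriveE// [in LHS](row_sum_delta v) linear_sum.
by apply: eq_bigr => j _; rewrite linearZ_LR deriveE.
Qed.

(** Near [z0] each partial derivative is at most its size at [z0] plus 1. The ball is convex, so the
    mean value theorem along a segment applies; [K] sums the bounds of all rows, and coordinate [i]
    uses only row [i]. *)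
Lemma smooth_lipschitz N (Psi : 'rV[R]_N -> 'rV[R]_N) (z0 : 'rV[R]_N) (P : set 'rV[R]_N) :
  smooth_at Psi z0 -> nbhs z0 P ->
  exists r K : R, [/\ 0 < r, 0 <= K,
    (forall y, `|y - z0| <= r -> P y) &
    forall y y', `|y - z0| <= r -> `|y' - z0| <= r ->
      `|Psi y - Psi y'| <= K * `|y - y'|].
Proof.
move=> sP nP.
pose p i (y : 'rV[R]_N) : R := Psi y ord0 i.
have sp i : smooth_at (p i) z0 by exact: ((smooth_at_rV _ _).1 sP i).
pose C (i j : 'I_N) : R := `|'D_('e_j) (p i) z0| + 1.
have nC : \forall y \near z0, P y /\ (forall ij : 'I_N * 'I_N,
    smooth_at (p ij.1) y /\ `|'D_('e_ij.2) (p ij.1) y| <= C ij.1 ij.2).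
  apply: filterI => //.
  apply: (@filter_forall _ _ (fun ij y =>
    smooth_at (p ij.1) y /\ `|'D_('e_ij.2) (p ij.1) y| <= C ij.1 ij.2) (nbhs z0) _) => -[i j] /=.
  apply: filterI; first exact: near_smooth_at (sp i).
  have := smooth_at_cont (smooth_at_derive 'e_j (sp i)).
  move/cvgrPdist_le => /(_ _ ltr01); apply: filterS => y /=.
  rewrite /C; move: ('D_ _ _ z0) ('D_ _ _ y) => a b h.
  have := ler_normB a (a - b); rewrite opprB addrC subrK => H.
  by rewrite (le_trans H)// lerD2l.
move/nbhs_ballP: nC => [d /= d0 hd].
have hd' y : `|y - z0| <= d / 2 -> ball z0 d y.
  move=> h; rewrite -ball_normE /= distrC; apply: le_lt_trans h _.
  by rewrite gtr_pMr// invf_lt1// ltr1n.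
have C0 i j : 0 <= C i j by rewrite /C addr_ge0.
exists (d / 2), (\sum_i \sum_j C i j); split.
- by rewrite divr_gt0.
- by apply: sumr_ge0 => i _; apply: sumr_ge0.
- by move=> y /hd'/hd[].
move=> y y' hy hy'.
apply/rV_norm_le => [|i]; first by rewrite mulr_ge0//; apply: sumr_ge0 => i _; apply: sumr_ge0.
pose v := y - y'.
have seg (s : R) : s \in `[0, 1] -> `|y' + s *: v - z0| <= d / 2.
  rewrite in_itv /= => /andP[s0 s1].
  have -> : y' + s *: v - z0 = (1 - s) *: (y' - z0) + s *: (y - z0).
    rewrite /v !scalerBr !scalerBl !scale1r; apply/rowP => k; rewrite !mxE; ring.
  rewrite (le_trans (ler_normD _ _))// !normrZ !ger0_norm ?subr_ge0//.
  have := ler_wpM2l s0 hy; have s1' : 0 <= 1 - s by lra.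
  have := ler_wpM2l s1' hy'; lra.
have [|s s01] := @MVT_along R _ (p i) y' v 1 ltr01.
  by move=> s /seg/hd'/hd[_ /(_ (i, i))[/smooth_at_diff]].
have yv : y' + v = y by rewrite /v addrC subrK.
rewrite scale1r mulr1 yv => e.
rewrite !mxE -/(p i y) -/(p i y') e.
have [_ hs] := hd _ (hd' _ (seg _ s01)).
have dp : differentiable (p i) (y' + s *: v) by apply: smooth_at_diff; have [] := hs (i, i).
rewrite derive_rV_sum//; apply: (le_trans (ler_norm_sum _ _ _)).
rewrite [X in _ <= X * _](bigD1 i)//= mulrDl mulr_suml ler_wpDr//.
  by rewrite mulr_ge0//; apply: sumr_ge0 => k _; apply: sumr_ge0.
apply: ler_sum => j _; rewrite normrM mulrC.
apply: ler_pM => //; first by have [_] := hs (i, j).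
exact: rV_coord_le.
Qed.

Lemma ode_rV N (Psi : 'rV[R]_N -> 'rV[R]_N) (z0 : 'rV[R]_N) (P : set 'rV[R]_N) :
  smooth_at Psi z0 -> nbhs z0 P ->
  exists (h : R) (z : R -> 'rV[R]_N), [/\ 0 < h, z 0 = z0 &
    forall t : R, t \in `]-h, h[ -> P (z t) /\ is_derive t 1 z (Psi (z t))].
Proof.
move=> sP nP; have [r [K [r0 K0 rP lip]]] := smooth_lipschitz sP nP.
(* [B] bounds [Psi] on the ball of radius [r]. The two terms of the minimum [h] meet the two
   smallness conditions of [picard_solution]; the added ones keep the denominators positive. *)
pose B := `|Psi z0| + K * r + 1.
have B0 : 0 < B by rewrite ltr_wpDl// addr_ge0// mulr_ge0// ltW.
have K1 : 0 < 2 * (K + 1) by rewrite mulr_gt0// ltr_wpDl.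
pose h := Num.min (r / B) (2 * (K + 1))^-1.
have h0 : 0 < h by rewrite lt_min divr_gt0//= invr_gt0.
have [||z [z00 hz]] := @picard_solution R N Psi z0 r K h r0 K0 h0 lip.
- apply: (@le_trans _ _ ((K + 1) * (2 * (K + 1))^-1)).
    apply: ler_pM => //; [exact: ltW|by rewrite lerDl|by rewrite ge_min lexx orbT].
  by rewrite invfM mulrCA mulfV ?mulr1 ?mul1r// gt_eqF// ltr_wpDl.
- apply: (@le_trans _ _ (B * (r / B))).
    apply: ler_pM => //; [by rewrite addr_ge0// mulr_ge0// ltW|exact: ltW|by rewrite lerDl|].
    by rewrite ge_min lexx.
  by rewrite mulrCA mulfV ?mulr1// gt_eqF.
by exists h, z; split=> // t /hz[/rP].
Qed.

Lemma ode_exists {U : normedModType R} (Phi : U -> U) u0 (P : set U) : fdim U ->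
  smooth_at Phi u0 -> nbhs u0 P ->
  exists (h : R) (c : R -> U), [/\ 0 < h, c 0 = u0 &
    forall t : R, t \in `]-h, h[ ->
      [/\ P (c t), smooth_at c t & is_derive t 1 c (Phi (c t))]].
Proof.
move=> fU sP nP; have [N [b [l [dl hl]]]] := fU.
pose E (z : 'rV[R]_N) := \sum_i z ord0 i *: b i.
pose L (u : U) : 'rV[R]_N := \row_i l i u.
have LK u : E (L u) = u by rewrite [RHS]hl; apply: eq_bigr => i _; rewrite mxE.
have dE (z : 'rV[R]_N) : is_diff z E E.
  apply: is_diff_fdim => // a x y; rewrite /E scaler_sumr -big_split /=.
  by apply: eq_bigr => i _; rewrite !mxE scalerDl scalerA.
have dL (u : U) : is_diff u L L.
  apply: is_diff_fdim => // a x y; apply/rowP => i; rewrite !mxE.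
  by have [lin _] := is_diff_is_linear (dl i 0); rewrite lin.
have sE z : smooth_at E z by exact: smooth_at_lin.
have sL u : smooth_at L u by exact: smooth_at_lin.
have sPsi : smooth_at (L \o Phi \o E) (L u0).
  apply: smooth_at_comp => //=; rewrite LK.
  by apply: smooth_at_comp.
have /smooth_atP[Q [oQ Qu0 sQ]] := sP.
have nPQ : nbhs (L u0) (E @^-1` (P `&` Q)).
  apply: (smooth_at_cont (sE _)); rewrite LK; apply: filterI => //.
  exact: open_nbhs_nbhs.
have [h [z [h0 z00 hz]]] := ode_rV sPsi nPQ.
exists h, (E \o z); rewrite /= z00 LK; split=> // t th.
have dc (s : R) : s \in `]-h, h[ -> is_derive s 1 (E \o z) (Phi (E (z s))).
  move=> /hz[_ dz].
  have dEz : differentiable E (z s) by have [] := dE (z s).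
  by have := is_derive_curve dz dEz; rewrite deriveE// diff_val /= LK.
split; [by have [[]] := hz t th| |exact: dc].
apply/smooth_atP; exists [set` `]-h, h[]; split=> //.
have oI : open [set` (`]-h, h[ : interval R)] by [].
have dfc (y : R) : y \in `]-h, h[ -> differentiable (E \o z) y.
  by move=> /dc[/derivable1_diffP].
(* Bootstrap: the derivative of the curve is [Phi] of the curve, hence as smooth as the curve
   itself, which gains one order at each turn. *)
elim=> [|n IH]; first by rewrite smooth_upto0 => y; exact: dfc.
rewrite smooth_uptoS; split=> [y|v]; first exact: dfc.
have S : smooth_upto n [set` `]-h, h[] (Phi \o (E \o z)).
  by apply: (@smooth_upto_comp _ _ _ _ _ Q) => // y /= /hz[[]].
apply: (smooth_upto_eq oI (f := fun s => v *: Phi (E (z s)))).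
  by move=> y yh; rewrite derive_scale1; [have [_ ->] := dc y yh|exact: dfc].
have [m [b' [l' [dl' hl']]]] := fU.
have dv (w : U) : is_diff w ( *:%R v) ( *:%R v).
  by apply: is_diff_fdim => // a x y; rewrite scalerDr !scalerA mulrC.
exact: (smooth_upto_linl oI dv S).
Qed.
End Ode.

(** * Homogeneous and affine coordinates *)

Section Charts.
Context {R : realType} {n : nat}.
Local Notation E := 'rV[R]_n.+1.
Implicit Types (x v : E) (y w : 'rV[R]_n) (i : 'I_n.+1).

(** The zero vector is sent to an arbitrary nonzero one, so that [ph], [th] and [hat] are total on
    vector spaces and can be differentiated there. *)
Definition nzv x : nzvec R n := insubd (insert1 ord0 (0 : 'rV[R]_n)) x.

Lemma nzvK x : x != 0 -> val (nzv x) = x.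
Proof. by move=> x0; rewrite /nzv val_insubd x0. Qed.

Definition ph x : RP R n := \pi_(RP R n)%qT (nzv x).
Definition th x v : TRP R n := \pi_(TRP R n)%qT (nzv x, v).

Lemma ph_eq (a : R) x : a != 0 -> x != 0 -> ph (a *: x) = ph x.
Proof.
move=> a0 x0; apply/esym/eqquotP/asboolP; exists a => //.
by rewrite !nzvK// scaler_eq0 negb_or a0.
Qed.

Lemma th_eq (a b : R) x v : a != 0 -> x != 0 -> th (a *: x) (a *: v + b *: x) = th x v.
Proof.
move=> a0 x0; apply/esym/eqquotP/asboolP; exists a => //=.
by rewrite !nzvK ?scaler_eq0 ?negb_or ?a0//; split=> //; exists b.
Qed.

Lemma th_inv x v x' v' : x != 0 -> x' != 0 -> th x v = th x' v' ->
  exists2 a : R, a != 0 & x' = a *: x /\ exists b : R, v' = a *: v + b *: x.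
Proof.
by move=> x0 x0' /eqquotP/asboolP[a a0 /= []]; rewrite !nzvK// => -> [b ->];
  exists a => //; split=> //; exists b.
Qed.

Lemma TRP_th (u : TRP R n) : exists x v, x != 0 /\ u = th x v.
Proof.
exists (val (repr u).1), (repr u).2; split; first exact: (valP (repr u).1).
by rewrite -[LHS]reprK /th /nzv valKd; case: (repr u).
Qed.

Lemma chart_pointE i y : chart_point i y = ph (insert i 1 y).
Proof. by rewrite /chart_point /ph /nzv -[insert i 1 y]/(val (insert1 i y)) valKd. Qed.

Lemma chart_vecE i y w : chart_vec i y w = th (insert i 1 y) (insert i 0 w).
Proof. by rewrite /chart_vec /th /nzv -[insert i 1 y]/(val (insert1 i y)) valKd. Qed.

Lemma insertE i (c : R) y : insert i c y ord0 i = c.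
Proof. by rewrite mxE unlift_none. Qed.

Lemma insert_lift i (c : R) y j : insert i c y ord0 (lift i j) = y ord0 j.
Proof. by rewrite mxE liftK. Qed.

Lemma insert_lin i (c : R) y (d : R) w (k : R) :
  insert i (k * c + d) (k *: y + w) = k *: insert i c y + insert i d w.
Proof. by apply/rowP => j; rewrite !mxE; case: unliftP => [l _|_]; rewrite ?mxE. Qed.

Definition dehom i x : 'rV[R]_n := \row_j (x ord0 (lift i j) / x ord0 i).
Definition dehomv i x v : 'rV[R]_n :=
  \row_j ((v ord0 (lift i j) * x ord0 i - x ord0 (lift i j) * v ord0 i) / x ord0 i ^+ 2).

Lemma insert_dehom i x : x ord0 i != 0 -> insert i 1 (dehom i x) = (x ord0 i)^-1 *: x.
Proof.
move=> x0; apply/rowP => j; rewrite !mxE; case: unliftP => [k ->|->].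
  by rewrite mxE mulrC.
by rewrite mulVf.
Qed.

Lemma coord_neq0 x i : x ord0 i != 0 -> x != 0.
Proof. by apply: contraNneq => ->; rewrite mxE. Qed.

Lemma th_chart i x v : x ord0 i != 0 -> th x v = chart_vec i (dehom i x) (dehomv i x v).
Proof.
move=> xi; have x0 := coord_neq0 xi.
rewrite chart_vecE insert_dehom//.
rewrite -(@th_eq (x ord0 i)^-1 (- (v ord0 i / x ord0 i ^+ 2)) x v) ?invr_eq0//.
congr th; apply/rowP => j; rewrite !mxE; case: unliftP => [k ->|->].
  by rewrite !mxE; field.
by field.
Qed.

Lemma ph_chart i x : x ord0 i != 0 -> ph x = chart_point i (dehom i x).
Proof.
by move=> xi; rewrite chart_pointE insert_dehom// ph_eq ?invr_eq0//; exact: coord_neq0 xi.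
Qed.

Lemma in_chart_ph i x : x != 0 -> in_chart i (ph x) = (x ord0 i != 0).
Proof.
move=> x0; rewrite /in_chart /ph; have [a a0 ->] := repr_pi_RP (nzv x).
by rewrite nzvK// mxE mulf_eq0 negb_or a0.
Qed.

Lemma coord_ph i x : x ord0 i != 0 -> Defs.coord i (ph x) = dehom i x.
Proof. by move=> xi; rewrite (ph_chart xi) chart_pointK. Qed.

Lemma dehomv_eq0 i x v : x ord0 i != 0 ->
  (dehomv i x v == 0) = `[< exists b : R, v = b *: x >].
Proof.
move=> xi; apply/eqP/asboolP => [e|[b ->]].
  exists (v ord0 i / x ord0 i); apply/rowP => j; rewrite mxE.
  have [k ->|->] := unliftP i j; last by rewrite divfK.
  move/rowP/(_ k): e; rewrite !mxE => /eqP.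
  rewrite mulf_eq0 invr_eq0 expf_eq0 /= (negPf xi) orbF subr_eq0 => /eqP e.
  by apply: (mulIf xi); rewrite e mulrAC divfK// mulrC.
by apply/rowP => j; rewrite !mxE mulrAC [X in X - _]mulrC mulrA [_ * b]mulrC subrr mul0r.
Qed.

Lemma ex_coord_neq0 x : x != 0 -> exists i, x ord0 i != 0.
Proof.
move=> x0; apply: contrapT => /forallNP H; move/eqP: x0; apply; apply/rowP => i.
by rewrite mxE; apply/eqP/negPn/negP/H.
Qed.

Lemma zero_section_th x v : x != 0 ->
  zero_section (th x v) <-> exists b : R, v = b *: x.
Proof.
move=> x0; split=> [[i [y]]|[b ->]].
  rewrite chart_vecE => e; have i0 : insert i 1 y != 0 by exact: insert1_neq0.
  have [a a0 [_ [b e2]]] := th_inv x0 i0 e.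
  exists (- (a^-1 * b)); apply: (@scalerI _ _ a) => //.
  have e3 : insert i 0 (0 : 'rV[R]_n) = 0.
    by apply/rowP => j; rewrite !mxE; case: unliftP => *; rewrite ?mxE.
  move: e2; rewrite e3 => /esym/eqP; rewrite addr_eq0 => /eqP ->.
  by rewrite -scaleNr scalerA mulrN mulrA mulfV// mul1r.
have [i xi] := ex_coord_neq0 x0.
exists i, (dehom i x); rewrite (th_chart _ xi); congr chart_vec; apply/eqP.
by rewrite dehomv_eq0//; apply/asboolP; exists b.
Qed.

End Charts.

Section MoreCalc.
Context {R : realType}.

(** A directional derivative depends only on values along a line. Derivatives can therefore be
    compared between different spaces (charts, homogeneous coordinates, slices) without any
    differentiability. *)
Lemma derive_line_near {U V W : normedModType R} (f : U -> W) (g : V -> W) x u x' u' :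
  (\forall h \near (0 : R), f (h *: u + x) = g (h *: u' + x')) ->
  'D_u f x = 'D_u' g x'.
Proof.
move=> fg; have fg0 : f x = g x'.
  by have := nbhs_singleton fg; rewrite !scale0r !add0r.
rewrite /derive; congr (lim _); rewrite eqEsubset.
by split; apply/near_eq_cvg/cvg_within; apply: filterS fg => h /= ->; rewrite fg0.
Qed.

Lemma derive_line_eq {U V W : normedModType R} (f : U -> W) (g : V -> W) x u x' u' :
  (forall h : R, f (h *: u + x) = g (h *: u' + x')) -> 'D_u f x = 'D_u' g x'.
Proof. by move=> fg; apply: derive_line_near; near=> h. Unshelve. all: by end_near. Qed.

Lemma smooth_atN {U : normedModType R} (f : U -> R) s :
  smooth_at f s -> smooth_at (fun u => - f u) s.
Proof.
move=> sf; apply: (@smooth_at_eq _ _ _ (fun u => -1 * f u)).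
  by near=> u; rewrite mulN1r.
by apply: smooth_atM => //; exact: smooth_at_cst.
Unshelve. all: by end_near. Qed.

Lemma smooth_atB {U : normedModType R} (f g : U -> R) s :
  smooth_at f s -> smooth_at g s -> smooth_at (fun u => f u - g u) s.
Proof. by move=> sf sg; apply: smooth_atD => //; exact: smooth_atN. Qed.

Lemma smooth_at_fst {V W : normedModType R} (z : V * W) : smooth_at fst z.
Proof. by apply: smooth_at_lin => z'; exact: is_diff_fst. Qed.

Lemma smooth_at_snd {V W : normedModType R} (z : V * W) : smooth_at snd z.
Proof. by apply: smooth_at_lin => z'; exact: is_diff_snd. Qed.

Lemma near_neq0 {U : normedModType R} (f : U -> R) s :
  {for s, continuous f} -> f s != 0 -> \forall u \near s, f u != 0.
Proof. by move=> cf f0; exact: (cvgr_neq0 (f s)). Qed.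

Lemma is_derive_div (f g : R -> R) (t f' g' : R) : g t != 0 ->
  is_derive t 1 f f' -> is_derive t 1 g g' ->
  is_derive t 1 (fun s => f s / g s) ((f' * g t - f t * g') / g t ^+ 2).
Proof.
move=> g0 df dg.
have dV : is_derive t 1 (fun s => (g s)^-1) (- (g t) ^- 2 * g').
  have [dg1 <-] := dg; apply: DeriveDef; first exact: derivableV.
  by rewrite deriveV.
have dM : is_derive t 1 (f * (fun s => (g s)^-1)) (f t * (- (g t) ^- 2 * g') + (g t)^-1 * f').
  exact: is_deriveM.
by apply: is_derive_eq dM _; field.
Qed.

End MoreCalc.

Section Hat.
Context {R : realType} {n : nat}.
Local Notation E := 'rV[R]_n.+1.
Implicit Types (x v : E) (y w : 'rV[R]_n) (i : 'I_n.+1) (L : TRP R n -> R).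

Definition hat L (z : E * E) : R := L (th z.1 z.2).

(** The scalar [b = 0] excludes [v = 0], so this is linear independence of [x] and [v]. *)
Definition indep x v := x != 0 /\ forall b : R, v != b *: x.

Lemma indep_zero x v : x != 0 -> ~ zero_section (th x v) <-> indep x v.
Proof.
move=> x0; split=> [H|[_ H]].
  split=> // b; apply/negP => /eqP e; apply: H; apply/zero_section_th => //.
  by exists b.
by move=> /(zero_section_th _ x0)[b e]; move: (H b); rewrite e eqxx.
Qed.

Lemma indep_dehomv i x v : x ord0 i != 0 -> indep x v -> dehomv i x v != 0.
Proof.
move=> xi [_ H]; rewrite dehomv_eq0//; apply/asboolP => -[b e].
by move: (H b); rewrite e eqxx.
Qed.

Lemma indep_affine (a b : R) x v : a != 0 -> indep x v -> indep (a *: x) (a *: v + b *: x).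
Proof.
move=> a0 [x0 H]; split=> [|c]; first by rewrite scaler_eq0 negb_or a0.
apply/negP => /eqP e; have /negP := H (c - a^-1 * b); apply; apply/eqP.
apply: (@scalerI _ _ a) => //; rewrite scalerA mulrBr mulrA mulfV// mul1r scalerBl.
by rewrite mulrC -scalerA -e addrK.
Qed.

Lemma indep_insert i y w : w != 0 -> indep (insert i 1 y) (insert i 0 w).
Proof.
move=> w0; split=> [|b]; first exact: insert1_neq0.
apply/negP => /eqP e; move/eqP: w0; apply; apply/rowP => j.
have b0 : b = 0 by move/rowP/(_ i): e; rewrite insertE mxE insertE mulr1.
by move/rowP/(_ (lift i j)): e; rewrite b0 scale0r insert_lift => ->; rewrite !mxE.
Qed.

Lemma hat_inv L (a b : R) x v : a != 0 -> x != 0 ->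
  hat L (a *: x, a *: v + b *: x) = hat L (x, v).
Proof. by move=> a0 x0; rewrite /hat /= th_eq. Qed.

Lemma dehomv_lin i x (a : R) v v' :
  dehomv i x (a *: v + v') = a *: dehomv i x v + dehomv i x v'.
Proof. by apply/rowP => j; rewrite !mxE; ring. Qed.

Lemma hat_chart L i x v : x ord0 i != 0 ->
  hat L (x, v) = L (chart_vec i (dehom i x) (dehomv i x v)).
Proof. by move=> xi; rewrite /hat /= (th_chart _ xi). Qed.

Lemma hat_insert L i y w : hat L (insert i 1 y, insert i 0 w) = L (chart_vec i y w).
Proof. by rewrite /hat chart_vecE. Qed.

Lemma hat_homog L (a : R) x v : Finsler L -> 0 <= a -> x != 0 ->
  hat L (x, a *: v) = a * hat L (x, v).
Proof.
move=> FL a0 x0; have [i xi] := ex_coord_neq0 x0; rewrite !(hat_chart _ _ xi).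
rewrite -(Finsler_homog FL)//; congr (L (chart_vec i _ _)).
have := dehomv_lin i x a v 0; rewrite addr0 => ->.
suff -> : dehomv i x 0 = 0 by rewrite addr0.
by apply/rowP => j; rewrite !mxE mulr0 mul0r subrr mul0r.
Qed.

Lemma hat_pos L x v : Finsler L -> indep x v -> 0 < hat L (x, v).
Proof. by move=> FL ixv; apply: (Finsler_pos FL); apply/indep_zero => //; case: ixv. Qed.

Lemma smooth_at_insert {U : normedModType R} i (c : R) (f : U -> 'rV[R]_n) s :
  smooth_at f s -> smooth_at (fun u => insert i c (f u)) s.
Proof.
move=> /smooth_at_rV sf; apply/smooth_at_rV => j.
have [k ->|->] := unliftP i j.
  by apply: smooth_at_eq (sf k); near=> u; rewrite insert_lift.
apply: (@smooth_at_eq _ _ _ (cst c)); last exact: smooth_at_cst.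
by near=> u; rewrite insertE.
Unshelve. all: by end_near. Qed.

Lemma smooth_at_dehom {U : normedModType R} i (f : U -> E) s :
  f s ord0 i != 0 -> smooth_at f s -> smooth_at (fun u => dehom i (f u)) s.
Proof.
move=> fi /smooth_at_rV sf; apply/smooth_at_rV => j.
apply: (@smooth_at_eq _ _ _ (fun u => f u ord0 (lift i j) * (f u ord0 i)^-1)).
  by near=> u; rewrite mxE.
by apply: smooth_atM => //; exact: smooth_atV.
Unshelve. all: by end_near. Qed.

Lemma smooth_at_dehomv {U : normedModType R} i (f g : U -> E) s :
  f s ord0 i != 0 -> smooth_at f s -> smooth_at g s ->
  smooth_at (fun u => dehomv i (f u) (g u)) s.
Proof.
move=> fi /smooth_at_rV sf /smooth_at_rV sg; apply/smooth_at_rV => j.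
apply: (@smooth_at_eq _ _ _ (fun u => (g u ord0 (lift i j) * f u ord0 i
   - f u ord0 (lift i j) * g u ord0 i) * (f u ord0 i * f u ord0 i)^-1)).
  by near=> u; rewrite mxE expr2.
apply: smooth_atM; first by apply: smooth_atB; exact: smooth_atM.
by apply: smooth_atV; [rewrite mulf_neq0|exact: smooth_atM].
Unshelve. all: by end_near. Qed.

Lemma hat_smooth L x v : Finsler L -> indep x v -> smooth_at (hat L) (x, v).
Proof.
move=> FL [x0 H]; have [i xi] := ex_coord_neq0 x0.
pose psi (z : E * E) := (dehom i z.1, dehomv i z.1 z.2).
have s1 := @smooth_at_fst R E E (x, v); have s2 := @smooth_at_snd R E E (x, v).
have sp : smooth_at psi (x, v).
  by apply: smooth_at_pair; [exact: smooth_at_dehom|exact: smooth_at_dehomv].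
have s3 : smooth_at (fun z : E * E => z.1 ord0 i) (x, v) by exact: ((smooth_at_rV _ _).1 s1 i).
apply: (@smooth_at_eq _ _ _ ((fun z => L (chart_vec i z.1 z.2)) \o psi)).
  have := near_neq0 (smooth_at_cont s3) xi.
  by apply: filterS => -[z1 z2] zi; rewrite /= (hat_chart _ _ zi).
apply: smooth_at_comp => //.
by apply: (Finsler_smooth FL); apply: indep_dehomv.
Qed.

Lemma hat_convex L x v u : Finsler L -> indep x v -> indep x u ->
  0 < 'D_(0, u) ('D_(0, u) (fun z => hat L z ^+ 2)) (x, v).
Proof.
move=> FL ixv ixu; have [i xi] := ex_coord_neq0 ixv.1.
have H := Finsler_convex FL i (dehom i x) (indep_dehomv xi ixv) (indep_dehomv xi ixu).
have line (h : R) v' : h *: (0 : E, u) + (x, v') = (x, h *: u + v').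
  by congr pair; rewrite /= ?scaler0 ?add0r.
have D1 v' : 'D_(0, u) (fun z => hat L z ^+ 2) (x, v') =
    'D_(dehomv i x u) (fun w' => L (chart_vec i (dehom i x) w') ^+ 2) (dehomv i x v').
  by apply: derive_line_eq => h; rewrite line (hat_chart _ _ xi) dehomv_lin.
suff -> : 'D_(0, u) ('D_(0, u) (fun z => hat L z ^+ 2)) (x, v) =
   'D_(dehomv i x u) ('D_(dehomv i x u) (fun w' => L (chart_vec i (dehom i x) w') ^+ 2))
    (dehomv i x v) by [].
by apply: derive_line_eq => h; rewrite line D1 dehomv_lin.
Qed.

Lemma smooth_map_lift {U : normedModType R} (g : U -> RP R n) (X : U -> E) s :
  smooth_at X s -> X s != 0 -> (\forall u \near s, g u = ph (X u)) -> smooth_map_at g s.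
Proof.
move=> sX X0 gX i; rewrite (nbhs_singleton gX) in_chart_ph// => Xi.
have sXi : smooth_at (fun u => X u ord0 i) s by exact: ((smooth_at_rV _ _).1 sX i).
have nX := near_neq0 (smooth_at_cont sXi) Xi.
split.
  by apply: filterS2 gX nX => u -> Xui; rewrite in_chart_ph//; exact: coord_neq0 Xui.
apply: (@smooth_at_eq _ _ _ (fun u => dehom i (X u))); last exact: smooth_at_dehom.
by apply: filterS2 gX nX => u /= -> Xui; rewrite coord_ph.
Qed.

Lemma lift_smooth_map {U : normedModType R} (g : U -> RP R n) i s :
  smooth_map_at g s -> in_chart i (g s) ->
  smooth_at (Defs.coord i \o g) s /\
  \forall u \near s, g u = ph (insert i 1 (Defs.coord i (g u))).
Proof.
move=> sg gi; have [h1 h2] := sg i gi; split=> //.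
by apply: filterS h1 => u gui; rewrite -chart_pointE Defs.coordK.
Qed.

Lemma velocity_lift (c : R -> RP R n) (X : R -> E) (t : R) (dX : E) :
  X t != 0 -> is_derive t 1 X dX -> (\forall s \near t, c s = ph (X s)) ->
  velocity c t = th (X t) dX.
Proof.
move=> X0 [derX <-] cX; rewrite /velocity.
set i := chart_at (c t); have := in_chart_at (c t); rewrite -/i.
have ct := nbhs_singleton cX.
rewrite ct in_chart_ph// => Xi; rewrite coord_ph// (th_chart _ Xi); congr chart_vec.
have dX' j : derivable (fun s => X s ord0 j) t 1 by exact: (derivable_mxP _ _ _).1 derX _ _.
have cXi : {for t, continuous (fun s => X s ord0 i)}.
  by apply: differentiable_continuous; apply/derivable1_diffP; exact: dX'.
have nX := near_neq0 cXi Xi.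
have -> : 'D_1 (Defs.coord i \o c) t = 'D_1 (fun s => dehom i (X s)) t.
  by apply: near_eq_derive; apply: filterS2 cX nX => s /= -> Xsi; rewrite coord_ph.
have E1 j : 'D_1 X t ord0 j = 'D_1 (fun s => X s ord0 j) t by rewrite derive_mx// mxE.
suff [_ ->] : is_derive t 1 (fun s => dehom i (X s)) (dehomv i (X t) ('D_1 X t)) by [].
apply: is_derive_rV => j; rewrite mxE !E1.
have D k : is_derive t 1 (fun s => X s ord0 k) ('D_1 (fun s => X s ord0 k) t).
  by apply: DeriveDef => //; exact: dX'.
have := is_derive_div Xi (D (lift i j)) (D i).
by congr is_derive; apply/funext => s; rewrite mxE.
Qed.

End Hat.

(** * First variation *)

Section OneSided.
Context {R : realType}.

(** Small increments that point into [[a, b]] make the difference quotient of [f - g] vanish, which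
    forces [d = d'] even at an end point. This is needed because a variation at parameter 0 agrees
    with the curve on [[a, b]] only. *)
Lemma is_derive_agree {W : normedModType R} (f g : R -> W) (a b t : R) d d' :
  a < b -> t \in `[a, b] -> (forall s : R, s \in `[a, b] -> f s = g s) ->
  is_derive t 1 f d -> is_derive t 1 g d' -> d = d'.
Proof.
move=> ab tab fg df dg; apply/eqP; rewrite -subr_eq0 -normr_eq0; apply/negPn/negP => n0.
have e0 : 0 < `|d - d'| by rewrite lt_def n0 normr_ge0.
have [dh eh] := is_deriveB df dg.
have : (fun h : R => h^-1 *: (((f - g) \o shift t) (h *: (1 : R)) - (f - g) t)) @ 0^' --> d - d'.
  by rewrite -eh; exact: dh.
move/cvgrPdist_lt => /(_ _ e0) [r /= r0 hr].
have [k [k0 kr kab]] : exists k : R, [/\ k != 0, `|k| < r & k + t \in `[a, b]].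
  move: tab; rewrite in_itv /= => /andP[at_ tb].
  have [tb'|tb'] := ltP t b.
    exists (Num.min (r / 2) (b - t)); have m0 : 0 < Num.min (r / 2) (b - t).
      by rewrite lt_min divr_gt0//= subr_gt0.
    split; first by rewrite gt_eqF.
      rewrite ger0_norm ?ltW// (le_lt_trans (y := r / 2)) ?ge_min ?lexx//.
      by rewrite gtr_pMr// invf_lt1// ltr1n.
    rewrite in_itv /= -lerBrDr ge_min lexx orbT andbT.
    by rewrite (le_trans at_)// lerDr ltW.
  exists (- Num.min (r / 2) (t - a)).
  have m0 : 0 < Num.min (r / 2) (t - a).
    by rewrite lt_min divr_gt0//= subr_gt0 (lt_le_trans ab).
  split; first by rewrite oppr_eq0 gt_eqF.
    rewrite normrN ger0_norm ?ltW// (le_lt_trans (y := r / 2)) ?ge_min ?lexx//.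
    by rewrite gtr_pMr// invf_lt1// ltr1n.
  rewrite in_itv /= addrC lerBrDl -lerBrDr ge_min lexx orbT /=.
  by rewrite (le_trans _ tb)// gerDl oppr_le0 ltW.
have := hr k; rewrite /ball /= sub0r normrN => /(_ kr k0).
have fg0 (s : R) : s \in `[a, b] -> (f - g) s = 0.
  by move=> /fg e; rewrite -[LHS]/(f s - g s) e subrr.
have -> : (k%:A : R) = k by rewrite /GRing.scale /= mulr1.
by rewrite !fg0// subrr scaler0 subr0 ltxx.
Qed.

Lemma derive_pair {U V W : normedModType R} (f : U -> V) (g : U -> W) x v :
  differentiable f x -> differentiable g x ->
  'D_v (fun y => (f y, g y)) x = ('D_v f x, 'D_v g x).
Proof.
move=> df dg; rewrite !deriveE//; last exact: differentiable_pair.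
by rewrite diff_pair.
Qed.

Lemma derive_comp2 {U V W Z : normedModType R} (f : U -> V) (g : U -> W) (h : V * W -> Z) x v :
  differentiable f x -> differentiable g x -> differentiable h (f x, g x) ->
  'D_v (fun y => h (f y, g y)) x = 'D_('D_v f x, 'D_v g x) h (f x, g x).
Proof.
move=> df dg dh; have dp : differentiable (fun y => (f y, g y)) x by exact: differentiable_pair.
rewrite -[LHS]/('D_v (h \o (fun y => (f y, g y))) x).
have -> := derive_comp v dp dh.
by rewrite derive_pair// -deriveE.
Qed.

Lemma near_slice {V W : topologicalType} (s : V) (t : W) (P : V * W -> Prop) :
  (\forall z \near (s, t), P z) -> \forall t' \near t, P (s, t').
Proof.
move=> [[A B] [/= As Bt] AB].
by apply: filterS Bt => t' Bt'; apply: (AB (s, t')); split => //=; exact: nbhs_singleton.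
Qed.

Lemma is_derive_slice {W : normedModType R} (X : R * R -> W) (s t : R) :
  differentiable X (s, t) -> is_derive t 1 (fun t' => X (s, t')) ('D_(0, 1) X (s, t)).
Proof.
move=> dX.
have line (h : R) : (s, h) = (s, 0) + h *: ((0, 1) : R * R).
  by congr pair; rewrite /= ?scaler0 ?addr0// /GRing.scale /= mulr1 add0r.
have -> : (fun t' => X (s, t')) = (fun h : R => X ((s, 0) + h *: (0, 1))).
  by apply/funext => h; rewrite -line.
by have := @is_derive_along R _ _ X (s, 0) (0, 1) t; rewrite -line => /(_ dX).
Qed.

Lemma derive_coord {U : normedModType R} m (f : U -> 'rV[R]_m) x v j : derivable f x v ->
  ('D_v f x) ord0 j = 'D_v (fun y => f y ord0 j) x.
Proof. by move=> df; rewrite derive_mx// mxE. Qed.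

Lemma schwarz_rV {U : normedModType R} m (f : U -> 'rV[R]_m) x v w : smooth_at f x ->
  'D_v ('D_w f) x = 'D_w ('D_v f) x.
Proof.
move=> sf; apply/rowP => j.
have H u : \forall y \near x, 'D_u (fun y => f y ord0 j) y = ('D_u f y) ord0 j.
  apply: filterS (near_smooth_at sf) => y /smooth_at_diff dy.
  by rewrite derive_coord//; exact: diff_derivable.
have D u u' : ('D_u ('D_u' f) x) ord0 j = 'D_u ('D_u' (fun y => f y ord0 j)) x.
  have d : derivable ('D_u' f) x u.
    by apply: diff_derivable; apply: smooth_at_diff; exact: smooth_at_derive.
  exact: etrans (derive_coord j d) (esym (near_eq_derive _ (H u'))).
apply: etrans (D v w) _; apply: etrans _ (esym (D w v)).
by apply: schwarz; exact: ((smooth_at_rV _ _).1 sf j).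
Qed.

End OneSided.

Section Variation.
Context {R : realType} {n : nat}.
Local Notation E := 'rV[R]_n.+1.
Variables (L : TRP R n -> R) (a b : R) (c : R -> RP R n) (G : R -> R -> RP R n).
Hypotheses (FL : Finsler L) (ab : a < b).
Hypothesis c_smooth : forall t, t \in `[a, b] -> smooth_map_at c t.
Hypothesis c_reg : forall t, t \in `[a, b] -> ~ zero_section (velocity c t).
Hypothesis G_var : Defs.variation a b c G.

Definition speed (z : R * R) : R := L (velocity (G z.1) z.2).

Lemma speed_lift (X : R * R -> E) (z0 : R * R) :
  smooth_at X z0 -> X z0 != 0 -> (\forall z \near z0, G z.1 z.2 = ph (X z)) ->
  \forall z \near z0, speed z = hat L (X z, 'D_(0, 1) X z).
Proof.
move=> sX X0 GX.
have nX : \forall z \near z0, X z != 0.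
  have [i Xi] := ex_coord_neq0 X0.
  have sXi : smooth_at (fun z => X z ord0 i) z0 by exact: ((smooth_at_rV _ _).1 sX i).
  by apply: filterS (near_neq0 (smooth_at_cont sXi) Xi) => z; exact: coord_neq0.
have GX2 := nbhs_interior GX.
apply: filterS3 (near_smooth_at sX) nX GX2 => -[s t] sXz Xz0 GXz.
rewrite /speed /hat /=; congr L.
have dX := is_derive_slice (smooth_at_diff sXz).
exact: velocity_lift Xz0 dX (near_slice GXz).
Qed.

Definition vlift i (z : R * R) : E := insert i 1 (Defs.coord i (G z.1 z.2)).

Lemma variation_lift (t0 : R) i : t0 \in `[a, b] -> in_chart i (c t0) ->
  [/\ smooth_at (vlift i) (0, t0),
     (\forall z \near (0, t0), G z.1 z.2 = ph (vlift i z)) &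
     indep (vlift i (0, t0)) ('D_(0, 1) (vlift i) (0, t0))].
Proof.
move=> tab ci; have [G1 G2 G3] := G_var.
have Gi : in_chart i (G 0 t0) by rewrite G2.
have [sY nY] := lift_smooth_map (g := fun z : R * R => G z.1 z.2) (G1 t0 tab) Gi.
have sX : smooth_at (vlift i) (0, t0) by exact: (smooth_at_insert i 1 sY).
split=> //.
have X0 : vlift i (0, t0) != 0 by exact: insert1_neq0.
apply/indep_zero => // H; apply: (c_reg tab); move: H.
suff -> : th (vlift i (0, t0)) ('D_(0, 1) (vlift i) (0, t0)) = velocity c t0 by [].
have [syc nyc] := lift_smooth_map (c_smooth tab) ci.
pose Xc (t : R) := insert i 1 (Defs.coord i (c t)).
have sXc : smooth_at Xc t0 by exact: (smooth_at_insert i 1 syc).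
have dXc : is_derive t0 1 Xc ('D_1 Xc t0).
  by apply: DeriveDef => //; apply: diff_derivable; exact: smooth_at_diff.
have agree (s : R) : s \in `[a, b] -> vlift i (0, s) = Xc s by move=> sab; rewrite /vlift /= G2.
have e := is_derive_agree ab tab agree (is_derive_slice (smooth_at_diff sX)) dXc.
have Xc0 : Xc t0 != 0 by exact: insert1_neq0.
rewrite (agree _ tab) e; exact: esym (velocity_lift Xc0 dXc nyc).
Qed.

Lemma speed_smooth (t0 : R) : t0 \in `[a, b] -> smooth_at speed (0, t0).
Proof.
move=> tab; have [sX nX ix] := variation_lift tab (in_chart_at (c t0)).
have H := speed_lift sX ix.1 nX.
apply: (@smooth_at_eq _ _ _ (fun z => hat L (vlift (chart_at (c t0)) z,
  'D_(0, 1) (vlift (chart_at (c t0))) z))).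
  by apply: filterS H => z ->.
apply: (@smooth_at_comp _ _ _ _ (fun z => (vlift (chart_at (c t0)) z,
  'D_(0, 1) (vlift (chart_at (c t0))) z)) (hat L)) => //.
  by apply: smooth_at_pair => //; exact: smooth_at_derive.
exact: hat_smooth.
Qed.

Lemma first_variation :
  is_derive (0 : R) (1 : R) (fun s => flength L a b (G s))
    (integ a b (fun t => 'D_(1, 0) speed (0, t))).
Proof.
have [d e] := @is_diff_integ R R (@fdim_R R) a b (ltW ab) speed 0 speed_smooth.
apply: DeriveDef; first exact: diff_derivable d.
by rewrite [LHS]deriveE// e.
Qed.

(** Symmetry of mixed derivatives turns the variation of the velocity into the time derivative of
    the variation field ['D_(1, 0) X], the form that can be integrated by parts. *)
Lemma speed_derive (t0 : R) (X : R * R -> E) : 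
  smooth_at X (0, t0) -> indep (X (0, t0)) ('D_(0, 1) X (0, t0)) ->
  (\forall z \near (0, t0), G z.1 z.2 = ph (X z)) ->
  'D_(1, 0) speed (0, t0) =
  'D_('D_(1, 0) X (0, t0), 'D_(0, 1) ('D_(1, 0) X) (0, t0)) (hat L)
     (X (0, t0), 'D_(0, 1) X (0, t0)).
Proof.
move=> sX ix nX; have H := speed_lift sX ix.1 nX.
rewrite (near_eq_derive _ H).
have s2 : smooth_at ('D_(0, 1) X) (0, t0) by exact: smooth_at_derive.
have sp : smooth_at (fun z => (X z, 'D_(0, 1) X z)) (0, t0) by exact: smooth_at_pair.
have sh : differentiable (hat L) (X (0, t0), 'D_(0, 1) X (0, t0)).
  by apply: smooth_at_diff; exact: hat_smooth.
have sw : 'D_(1, 0) ('D_(0, 1) X) (0, t0) = 'D_(0, 1) ('D_(1, 0) X) (0, t0).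
  exact: schwarz_rV.
have d1 := smooth_at_diff sX.
have d2 := smooth_at_diff s2.
have A := derive_comp2 ((1, 0) : R * R) d1 d2 sh.
rewrite -sw.
exact: A.
Qed.

End Variation.

Section MoreCalc2.
Context {R : realType}.

Lemma is_derive_mulR (f g : R -> R) (t f' g' : R) :
  is_derive t 1 f f' -> is_derive t 1 g g' ->
  is_derive t 1 (fun s => f s * g s) (f t * g' + f' * g t).
Proof.
move=> df dg; have dM : is_derive t 1 (f * g) (f t * g' + g t * f') by exact: is_deriveM.
by apply: is_derive_eq dM _; rewrite [f' * _]mulrC.
Qed.

Lemma is_derive_coord {U : normedModType R} m (f : U -> 'rV[R]_m) x v (d : 'rV[R]_m) j :
  is_derive x v f d -> is_derive x v (fun y => f y ord0 j) (d ord0 j).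
Proof.
move=> [df <-]; apply: DeriveDef; last by rewrite derive_coord.
by have := (derivable_mxP _ _ _).1 df ord0 j.
Qed.

End MoreCalc2.

(** * The Euler-Lagrange equation in a chart *)

Section Extremal.
Context {R : realType} {n : nat}.
Local Notation V := 'rV[R]_n.
Implicit Types (i : 'I_n.+1) (L : TRP R n -> R).

Definition chartfun L i (z : V * V) : R := L (chart_vec i z.1 z.2).

Lemma derive_insert {U : normedModType R} i (k : R) (Y : U -> V) x v : differentiable Y x ->
  'D_v (fun u => insert i k (Y u)) x = insert i 0 ('D_v Y x) /\
  differentiable (fun u => insert i k (Y u)) x.
Proof.
move=> dY.
have lin : linear (insert i (0 : R) : V -> _).
  by move=> a u w; rewrite -insert_lin mulr0 addr0.
have dl z : is_diff z (insert i (0 : R) : V -> _) (insert i (0 : R)) by exact: is_diff_fdim.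
have E : (fun u => insert i k (Y u)) = (cst (insert i k 0) + (insert i (0 : R) \o Y)).
  apply/funext => u; apply/rowP => j; rewrite !mxE.
  by case: unliftP => [l _|_]; rewrite ?mxE ?add0r ?addr0.
have d1 : differentiable (insert i (0 : R) \o Y) x.
  by apply: differentiable_comp => //; have [] := dl (Y x).
have d2 : differentiable (cst (insert i k 0) : U -> 'rV[R]_n.+1) x by exact: differentiable_cst.
rewrite E; split; last exact: differentiableD.
rewrite deriveD; [|exact: diff_derivable|exact: diff_derivable].
by rewrite derive_cst add0r (derive_comp v dY) ?diff_val.
Qed.

Lemma derive_hat_insert L i (y w eta zeta : V) :
  'D_(insert i 0 eta, insert i 0 zeta) (hat L) (insert i 1 y, insert i 0 w) =
  'D_(eta, zeta) (chartfun L i) (y, w).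
Proof.
apply: derive_line_eq => h; rewrite /chartfun /= -hat_insert.
congr (hat L (_, _)); rewrite -insert_lin; first by rewrite mulr0 add0r.
by rewrite mulr0 addr0.
Qed.

Lemma chartfun_smooth L i y w : Finsler L -> w != 0 -> smooth_at (chartfun L i) (y, w).
Proof. by move=> FL w0; exact: Finsler_smooth. Qed.

Lemma derive_pair_sum (f : V * V -> R) z eta zeta : differentiable f z ->
  'D_(eta, zeta) f z = \sum_j (eta ord0 j * 'D_('e_j, 0) f z + zeta ord0 j * 'D_(0, 'e_j) f z).
Proof.
move=> df.
have lin1 (a : V) : (a, 0 : V) = \sum_j a ord0 j *: ('e_j, 0 : V).
  transitivity (\sum_j (a ord0 j *: 'e_j : V), 0 : V); first by rewrite -row_sum_delta.
  by elim/big_rec2: _ => // j y1 y2 _ <-; congr pair; rewrite /= ?scaler0 ?addr0.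
have lin2 (a : V) : (0 : V, a) = \sum_j a ord0 j *: (0 : V, 'e_j).
  transitivity (0 : V, \sum_j (a ord0 j *: 'e_j : V)); first by rewrite -row_sum_delta.
  by elim/big_rec2: _ => // j y1 y2 _ <-; congr pair; rewrite /= ?scaler0 ?addr0.
have -> : (eta, zeta) = (eta, 0) + (0, zeta) by congr pair; rewrite /= ?addr0 ?add0r.
rewrite deriveDr// big_split /= deriveE// [in X in X + _](lin1 eta) linear_sum.
rewrite [X in _ + X]deriveE// [in X in _ + X](lin2 zeta) linear_sum.
by congr (_ + _); apply: eq_bigr => j _; rewrite linearZ_LR deriveE.
Qed.

(** By the Euler-Lagrange equation the integrand of the first variation is the time derivative of
    the variation field paired with the vertical derivative of [L]. The field vanishes at both ends,
    so the integral is zero. *)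
Lemma el_geodesic L i (a b : R) (y : R -> V) : Finsler L -> a < b ->
  (forall t : R, t \in `[a, b] -> smooth_at y t) ->
  (forall t : R, t \in `[a, b] -> 'D_1 y t != 0) ->
  (forall (t : R) (j : 'I_n), t \in `[a, b] ->
     is_derive t 1 (fun s => 'D_(0, 'e_j) (chartfun L i) (y s, 'D_1 y s))
       ('D_('e_j, 0) (chartfun L i) (y t, 'D_1 y t))) ->
  geodesic L a b (fun t => chart_point i (y t)).
Proof.
move=> FL ab sy ry EL.
set c := fun t => chart_point i (y t).
have cE t : c t = ph (insert i 1 (y t)) by rewrite /c chart_pointE.
have sX t : t \in `[a, b] -> smooth_at (fun t => insert i 1 (y t)) t.
  by move=> /sy; exact: smooth_at_insert.
have c_smooth t : t \in `[a, b] -> smooth_map_at c t.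
  move=> tab; apply: (smooth_map_lift (sX t tab)); first exact: insert1_neq0.
  by near=> s; rewrite cE.
have dX t : t \in `[a, b] -> is_derive t 1 (fun t => insert i 1 (y t)) (insert i 0 ('D_1 y t)).
  move=> tab; have [<- d] := derive_insert i 1 (1 : R) (smooth_at_diff (sy t tab)).
  by apply: DeriveDef => //; exact: diff_derivable.
have vel t : t \in `[a, b] -> velocity c t = th (insert i 1 (y t)) (insert i 0 ('D_1 y t)).
  move=> tab; apply: (velocity_lift (X := fun t => insert i 1 (y t))); first exact: insert1_neq0.
    exact: dX.
  by near=> s; rewrite cE.
have c_reg t : t \in `[a, b] -> ~ zero_section (velocity c t).
  move=> tab; rewrite vel//; apply/indep_zero; first exact: insert1_neq0.
  by apply: indep_insert; exact: ry.
split=> // G Gvar; have fv := first_variation FL ab c_smooth c_reg Gvar.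
suff I0 : integ a b (fun t => 'D_(1, 0) (speed L G) (0, t)) = 0 by move: fv; rewrite I0.
have [G1 G2 G3] := Gvar.
have ci t : in_chart i (c t) by exact: in_chart_point.
pose Y (z : R * R) := Defs.coord i (G z.1 z.2).
have Y0 t : t \in `[a, b] -> Y (0, t) = y t.
  by move=> tab; rewrite /Y /= G2// /c chart_pointK.
have sY t : t \in `[a, b] -> smooth_at Y (0, t).
  move=> tab; have gi : in_chart i (G 0 t) by rewrite G2.
  by have [] := lift_smooth_map (g := fun z : R * R => G z.1 z.2) (G1 t tab) gi.
have Yt t : t \in `[a, b] -> 'D_(0, 1) Y (0, t) = 'D_1 y t.
  move=> tab; apply: (is_derive_agree ab tab Y0).
    exact: (is_derive_slice (smooth_at_diff (sY t tab))).
  by apply: DeriveDef => //; apply: diff_derivable; exact/smooth_at_diff/sy.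
pose eta (t : R) : V := 'D_(1, 0) Y (0, t).
pose eta' (t : R) : V := 'D_(0, 1) ('D_(1, 0) Y) (0, t).
have deta t : t \in `[a, b] -> is_derive t 1 eta (eta' t).
  move=> tab; apply: (is_derive_slice (X := 'D_(1, 0) Y)).
  by apply: smooth_at_diff; exact: smooth_at_derive (sY t tab).
have spE t : t \in `[a, b] -> 'D_(1, 0) (speed L G) (0, t) =
   'D_(eta t, eta' t) (chartfun L i) (y t, 'D_1 y t).
  move=> tab; have [s1 s2 s3] := variation_lift ab c_smooth c_reg Gvar tab (ci t).
  rewrite (speed_derive FL s1 s3 s2).
  have D1 (u z : R * R) : smooth_at Y z -> 'D_u (vlift G i) z = insert i 0 ('D_u Y z).
    by move=> /smooth_at_diff dY; have [] := derive_insert i 1 u dY.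
  have D2 : 'D_(0, 1) ('D_(1, 0) (vlift G i)) (0, t) = insert i 0 (eta' t).
    have sY1 : smooth_at ('D_(1, 0) Y) (0, t) by exact: smooth_at_derive (sY t tab).
    have [<- _] := derive_insert i 0 ((0, 1) : R * R) (smooth_at_diff sY1).
    apply: near_eq_derive; apply: filterS (near_smooth_at (sY t tab)) => z; exact: D1.
  rewrite D2 !D1; [|exact: sY..].
  have e1 : vlift G i (0, t) = insert i 1 (y t) by rewrite -Y0.
  by rewrite e1 Yt//; exact: derive_hat_insert.
(* Fixed end points mean that [G s t] is constant in [s] near 0, so the variation field vanishes
   there. *)
have eta_ends t : (\forall s \near (0 : R), G s t = c t) -> eta t = 0.
  move=> nG; have e0 := nbhs_singleton nG; rewrite /eta -(derive_cst (Y (0, t)) (0 : R) (1 : R)).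
  apply: derive_line_near; apply: filterS nG => h /= e.
  have -> : h *: ((1, 0) : R * R) + (0, t) = (h, t).
    by congr pair; rewrite /= ?scaler0 ?add0r// addr0 /GRing.scale /= mulr1.
  by rewrite /Y /= e e0.
have eta_a : eta a = 0 by apply: eta_ends; apply: filterS G3 => s [].
have eta_b : eta b = 0 by apply: eta_ends; apply: filterS G3 => s [].
pose Phi (t : R) : R := \sum_j eta t ord0 j * 'D_(0, 'e_j) (chartfun L i) (y t, 'D_1 y t).
have ft t : t \in `[a, b] -> differentiable (chartfun L i) (y t, 'D_1 y t).
  by move=> tab; apply: smooth_at_diff; apply: chartfun_smooth => //; exact: ry.
have dPhi (t : R) : t \in `[a, b] -> is_derive t 1 Phi ('D_(1, 0) (speed L G) (0, t)).
  move=> tab; rewrite spE// derive_pair_sum; last exact: ft.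
  have dj (j : 'I_n) : is_derive t 1 (fun t => eta t ord0 j * 'D_(0, 'e_j) (chartfun L i) (y t, 'D_1 y t))
     (eta t ord0 j * 'D_('e_j, 0) (chartfun L i) (y t, 'D_1 y t) +
      eta' t ord0 j * 'D_(0, 'e_j) (chartfun L i) (y t, 'D_1 y t)).
    exact: is_derive_mulR (is_derive_coord j (deta t tab)) (EL t j tab).
  have := is_derive_sum dj.
  by rewrite fct_sumE.
rewrite (integ_FTC (ltW ab) _ dPhi).
  have P0 t : eta t = 0 -> Phi t = 0.
    by move=> e; apply: big1 => j _; rewrite e mxE; exact: mul0r.
  by rewrite (P0 _ eta_a) (P0 _ eta_b) subrr.
have sD t : t \in `[a, b] -> smooth_at ('D_(1, 0) (speed L G)) (0, t).
  by move=> tab; apply: smooth_at_derive; exact: (speed_smooth FL ab c_smooth c_reg Gvar tab).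
exact: cont_on_slice sD.
Unshelve. all: by end_near. Qed.
End Extremal.

Section Homogeneous.
Context {R : realType} {V W : normedModType R}.
Variables (f : V * W -> R) (y : V) (w : W).
Hypothesis hom : forall (a : R) (y' : V) (w' : W), 0 < a -> f (y', a *: w') = a * f (y', w').
Hypothesis df : forall a : R, 0 < a -> differentiable f (y, a *: w).

Let near_pos : \forall h \near (0 : R), 0 < h + 1.
Proof.
by apply: filterS (nbhs0_lt (ltr01 : (0 : R) < 1)) => h; rewrite ltr_norml => /andP[]; lra.
Qed.

Lemma euler : 'D_(0, w) f (y, w) = f (y, w).
Proof.
rewrite -[RHS](_ : 'D_1 (fun s : R => s * f (y, w)) 1 = _); last first.
  have := is_derive_mulR (is_derive_id (1 : R) (1 : R)) (is_derive_cst (f (y, w)) (1 : R) (1 : R)).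
  by move=> [_ ->]; rewrite mulr0 add0r mul1r.
apply: derive_line_near; apply: filterS near_pos => h h0.
have -> : h *: (0 : V, w) + (y, w) = (y, (h + 1) *: w).
  by congr pair; rewrite /= ?scaler0 ?add0r// scalerDl scale1r.
by rewrite hom// /GRing.scale /= mulr1.
Qed.

Lemma derive_homog (a : R) (xi : W) : 0 < a -> 'D_(0, xi) f (y, a *: w) = 'D_(0, xi) f (y, w).
Proof.
move=> a0; have a1 : a != 0 by rewrite gt_eqF.
apply: (mulfI a1).
have dw : differentiable f (y, w) by have := df ltr01; rewrite scale1r.
have -> : a * 'D_(0, xi) f (y, a *: w) = 'D_(0, a *: xi) f (y, a *: w).
  have -> : (0 : V, a *: xi) = a *: (0, xi) by congr pair; rewrite /= scaler0.
  exact: esym (deriveZr a (0, xi) (df a0)).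
have -> : a * 'D_(0, xi) f (y, w) = 'D_(0, xi) (fun z => a * f z) (y, w).
  by have := deriveZ a (diff_derivable (v := (0, xi)) dw); exact: esym.
apply: derive_line_eq => h /=; rewrite -hom//; congr f; congr pair; rewrite /= ?scaler0//.
by rewrite scalerDr !scalerA mulrC.
Qed.

(** A vertical derivative of a function of degree one has degree zero, hence is constant along the
    ray of [w]. This is the degeneracy of the vertical Hessian. *)
Lemma euler0 (xi : W) : 'D_(0, w) ('D_(0, xi) f) (y, w) = 0.
Proof.
rewrite -(derive_cst ('D_(0, xi) f (y, w)) (0 : R) (1 : R)).
apply: derive_line_near; apply: filterS near_pos => h h0.
have -> : h *: (0 : V, w) + (y, w) = (y, (h + 1) *: w).
  by congr pair; rewrite /= ?scaler0 ?add0r// scalerDl scale1r.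
by rewrite derive_homog.
Qed.

End Homogeneous.

Section Squares.
Context {R : realType} {U : normedModType R}.
Variables (f : U -> R).

Lemma derive_sqr x v : differentiable f x ->
  'D_v (fun z => f z ^+ 2) x = 2 * f x * 'D_v f x.
Proof.
move=> df; have dv := diff_derivable (v := v) df.
have -> : (fun z => f z ^+ 2) = f * f by apply/funext => z; rewrite expr2.
by rewrite deriveM// /GRing.scale /= -mulrDl; congr (_ * _); rewrite mulrDl mul1r.
Qed.

Lemma smooth_at_sqr x : smooth_at f x -> smooth_at (fun z => f z ^+ 2) x.
Proof.
move=> sf; apply: (@smooth_at_eq _ _ _ (fun z => f z * f z)); last exact: smooth_atM.
by near=> z; rewrite expr2.
Unshelve. all: by end_near. Qed.

End Squares.

Section Matrices.
Context {R : realType} {U : normedModType R}.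

Lemma smooth_at_sum_seq {T : Type} (r : seq T) (f : T -> U -> R) x :
  (forall i, smooth_at (f i) x) -> smooth_at (fun y => \sum_(i <- r) f i y) x.
Proof.
move=> h; elim: r => [|i r IH].
  by apply: (@smooth_at_eq _ _ _ (cst (0 : R))); [near=> y; rewrite big_nil|exact: smooth_at_cst].
by apply: smooth_at_eq (smooth_atD (h i) IH); near=> y; rewrite big_cons.
Unshelve. all: by end_near. Qed.

Lemma smooth_at_det m (A : U -> 'M[R]_m) x :
  (forall i j, smooth_at (fun y => A y i j) x) -> smooth_at (fun y => \det (A y)) x.
Proof.
move=> h; rewrite /determinant.
apply: smooth_at_sum_seq => s.
apply: smooth_atM; first exact: smooth_at_cst.
by apply: smooth_at_prod => i.
Qed.

Lemma smooth_at_invmx m (A : U -> 'M[R]_m) x i j :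
  (forall i j, smooth_at (fun y => A y i j) x) -> A x \in unitmx ->
  smooth_at (fun y => invmx (A y) i j) x.
Proof.
move=> h; rewrite unitmxE unitfE => d0.
have sd := smooth_at_det h.
have nd := near_neq0 (smooth_at_cont sd) d0.
apply: (@smooth_at_eq _ _ _ (fun y => (\det (A y))^-1 * cofactor (A y) j i)).
  apply: filterS nd => y dy; rewrite /invmx unitmxE unitfE dy !mxE.
  by [].
apply: smooth_atM; first exact: smooth_atV.
rewrite /cofactor; apply: smooth_atM; first exact: smooth_at_cst.
apply: smooth_at_det => k l.
by apply: smooth_at_eq (h (lift j k) (lift i l)); near=> y; rewrite !mxE.
Unshelve. all: by end_near. Qed.

End Matrices.

Section Aux.
Context {R : realType}.

Lemma sum_split_eq n (p q : 'I_n -> R) (x : R) :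
  \sum_j q j = x - \sum_j p j -> \sum_j (p j + q j) = x.
Proof. by move=> e; rewrite big_split /= e addrC subrK. Qed.

Lemma constant_on_oo (g : R -> R) (a b : R) :
  (forall s : R, s \in `]a, b[ -> is_derive s 1 g 0) ->
  forall s t : R, s \in `]a, b[ -> t \in `]a, b[ -> g s = g t.
Proof.
move=> dg.
suff H (s t : R) : s \in `]a, b[ -> t \in `]a, b[ -> s < t -> g s = g t.
  move=> s t sab tab; have [st|st|->//] := ltgtP s t; first exact: H.
  by apply/esym; exact: H.
rewrite !in_itv /= => /andP[as_ sb] /andP[at_ tb] st.
have dg' (x : R) : x \in `[s, t] -> is_derive x 1 g ((cst 0 : R -> R) x).
  by rewrite in_itv /= => /andP[x1 x2]; apply: dg; rewrite in_itv /=; lra.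
have [x _ e] := MVT_cc st dg'.
by apply/eqP; rewrite eq_sym -subr_eq0 e mul0r.
Qed.

Lemma is_derive_lin {U V : normedModType R} (l : U -> V) (c : R -> U) (t : R) d :
  (forall x, is_diff x l l) -> is_derive t 1 c d -> is_derive t 1 (fun s => l (c s)) (l d).
Proof.
move=> dl dc; have dlc : differentiable l (c t) by have [] := dl (c t).
by have := is_derive_curve dc dlc; rewrite deriveE// diff_val.
Qed.

Lemma is_derive_fst {U V : normedModType R} (c : R -> U * V) (t : R) d :
  is_derive t 1 c d -> is_derive t 1 (fun s => (c s).1) d.1.
Proof. by move=> dc; apply: (is_derive_lin (l := fst)) => // x; exact: is_diff_fst. Qed.

Lemma is_derive_snd {U V : normedModType R} (c : R -> U * V) (t : R) d :
  is_derive t 1 c d -> is_derive t 1 (fun s => (c s).2) d.2.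
Proof. by move=> dc; apply: (is_derive_lin (l := snd)) => // x; exact: is_diff_snd. Qed.

Lemma is_derive_cstM (k : R) (g : R -> R) (t d : R) :
  is_derive t 1 g d -> is_derive t 1 (fun s => k * g s) (k * d).
Proof. exact: is_deriveZ. Qed.

Lemma is_derive_unique {W : normedModType R} (g : R -> W) (t : R) d d' :
  is_derive t 1 g d -> is_derive t 1 g d' -> d = d'.
Proof. by move=> [_ <-] [_ <-]. Qed.

Lemma is_derive_sumR m (g : 'I_m -> R -> R) (t : R) (d : 'I_m -> R) :
  (forall j, is_derive t 1 (g j) (d j)) ->
  is_derive t 1 (fun s => \sum_j g j s) (\sum_j d j).
Proof. by move=> dg; have := is_derive_sum dg; rewrite fct_sumE. Qed.

(** The projection onto [W] is linear, so it commutes with the derivative, and it fixes the curve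
    near [t]. *)
Lemma curve_in_subspace {n : nat} (W : {vspace 'rV[R]_n.+1}) (X : R -> 'rV[R]_n.+1) (t : R) d :
  (\forall s \near t, X s \in W) -> is_derive t 1 X d -> d \in W.
Proof.
move=> XW dX.
have lin : linear (fun x : 'rV[R]_n.+1 => projv W x) by move=> a x y; rewrite linearP.
have dl x : is_diff x (fun x : 'rV[R]_n.+1 => projv W x) (fun x => projv W x) by exact: is_diff_fdim.
have d1 := is_derive_lin dl dX.
have d2 : is_derive t 1 (fun s => projv W (X s)) d.
  by apply: near_eq_is_derive dX; apply: filterS XW => s Xs; rewrite projv_id.
by rewrite (is_derive_unique d2 d1) memv_proj.
Qed.

Lemma dim2_span {n : nat} (W : {vspace 'rV[R]_n.+1}) (x v u : 'rV[R]_n.+1) : \dim W = 2 ->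
  indep x v -> x \in W -> v \in W -> u \in W -> exists a b : R, u = a *: x + b *: v.
Proof.
move=> dW [x0 H] xW vW uW.
have fr : free [:: x; v].
  rewrite free_cons seq1_free; apply/andP; split.
    rewrite span_seq1; apply/negP => /vlineP[k e].
    have [k0|k0] := eqVneq k 0; first by move/eqP: x0; apply; rewrite e k0 scale0r.
    by have := H k^-1; rewrite e scalerA mulVf// scale1r eqxx.
  by have := H 0; rewrite scale0r.
have sub : (<<[:: x; v]>> <= W)%VS.
  by apply/span_subvP => z; rewrite !inE => /orP[/eqP->|/eqP->].
have eqW : (<<[:: x; v]>> == W)%VS.
  by rewrite eqEdim sub dW /=; move: fr; rewrite /free => /eqP ->.
move: uW; rewrite -(eqP eqW) span_cons span_seq1 => /memv_addP[_ /vlineP[a ->]].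
by move=> [_ /vlineP[b ->] ->]; exists a, b.
Qed.

End Aux.

(** * Extremals of the energy, and Hamel's condition in a chart *)

Section HamelChart.
Context {R : realType} {n : nat}.
Local Notation V := 'rV[R]_n.
Variables (L : TRP R n -> R) (i : 'I_n.+1).
Hypothesis FL : Finsler L.

Let f := chartfun L i.
(** The energy. By [euler0] the vertical Hessian of [f] annihilates the velocity; that of [f ^+ 2]
    is positive definite. *)
Let e (z : V * V) := f z ^+ 2.

Let sf (z : V * V) : z.2 != 0 -> smooth_at f z.
Proof. by case: z => y w; exact: chartfun_smooth. Qed.

Let se (z : V * V) : z.2 != 0 -> smooth_at e z.
Proof. by move=> /sf; exact: smooth_at_sqr. Qed.

Let hom (a : R) (y w : V) : 0 < a -> f (y, a *: w) = a * f (y, w).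
Proof. by move=> a0; apply: (Finsler_homog FL); exact: ltW. Qed.

Let f_pos (z : V * V) : z.2 != 0 -> 0 < f z.
Proof.
case: z => y w /= w0; apply: (Finsler_pos FL); rewrite /= chart_vecE.
by apply/indep_zero; [exact: insert1_neq0|exact: indep_insert].
Qed.

Let gram (z : V * V) : 'M[R]_n := \matrix_(j, k) 'D_(0, 'e_j) ('D_(0, 'e_k) e) z.

Let convex (z : V * V) (v : V) : z.2 != 0 -> v != 0 -> 0 < 'D_(0, v) ('D_(0, v) e) z.
Proof.
case: z => y w /= w0 v0; have := Finsler_convex FL i y w0 v0.
have line (h : R) w' : h *: (0 : V, v) + (y, w') = (y, h *: v + w').
  by congr pair; rewrite /= ?scaler0 ?add0r.
have D1 w' : 'D_(0, v) e (y, w') = 'D_v (fun w' => L (chart_vec i y w') ^+ 2) w'.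
  by apply: derive_line_eq => h; rewrite line.
suff -> : 'D_(0, v) ('D_(0, v) e) (y, w) =
   'D_v ('D_v (fun w' => L (chart_vec i y w') ^+ 2)) w by [].
by apply: derive_line_eq => h; rewrite line D1.
Qed.

Let derive_snd_sum (g : V * V -> R) z (v : V) : differentiable g z ->
  'D_(0, v) g z = \sum_j v ord0 j * 'D_(0, 'e_j) g z.
Proof.
move=> dg; rewrite derive_pair_sum//; apply: eq_bigr => j _.
rewrite mxE.
by apply: etrans (add0r _); congr (_ + _); exact: mul0r.
Qed.

Let sde (z : V * V) k : z.2 != 0 -> smooth_at ('D_(0, 'e_k) e) z.
Proof. by move=> z0; exact: smooth_at_derive (se z0). Qed.

Let near_z2 (z : V * V) : z.2 != 0 -> \forall z' \near z, z'.2 != 0.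
Proof.
move=> z0; have [j zj] : exists j, z.2 ord0 j != 0.
  apply: contrapT => /forallNP H; move/eqP: z0; apply; apply/rowP => j.
  by rewrite mxE; apply/eqP/negPn/negP/H.
have s3 : smooth_at (fun z : V * V => z.2 ord0 j) z by exact: ((smooth_at_rV _ _).1 (smooth_at_snd z) j).
apply: filterS (near_neq0 (smooth_at_cont s3) zj) => z'.
by apply: contraNneq => ->; rewrite mxE.
Qed.

(** A row vector in the kernel of [gram z] would make the second vertical derivative of [e] along
    itself zero, against convexity. *)
Let gram_unit (z : V * V) : z.2 != 0 -> gram z \in unitmx.
Proof.
move=> z0; rewrite -row_free_unit; apply: inj_row_free => v vg.
apply: contrapT => /eqP v0; have := convex z0 v0.
suff -> : 'D_(0, v) ('D_(0, v) e) z = (v *m gram z *m v^T) ord0 ord0.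
  by rewrite vg mul0mx mxE ltxx.
have nE : \forall z' \near z, 'D_(0, v) e z' = \sum_k v ord0 k * 'D_(0, 'e_k) e z'.
  apply: filterS (near_z2 z0) => z' z0'.
  by apply: derive_snd_sum; exact: smooth_at_diff (se z0').
rewrite (near_eq_derive _ nE).
have d k : derivable (fun z' => v ord0 k * 'D_(0, 'e_k) e z') z (0, v).
  apply: diff_derivable; apply: smooth_at_diff; apply: smooth_atM; first exact: smooth_at_cst.
  exact: sde.
have -> : 'D_(0, v) (fun z' => \sum_k v ord0 k * 'D_(0, 'e_k) e z') z =
  \sum_k v ord0 k * 'D_(0, v) ('D_(0, 'e_k) e) z.
  have := derive_sum d; rewrite fct_sumE => ->; apply: eq_bigr => k _.
  have dk : derivable ('D_(0, 'e_k) e) z (0, v).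
    by apply: diff_derivable; apply: smooth_at_diff; exact: sde.
  exact: (deriveZ (v ord0 k) dk).
rewrite mxE; apply: eq_bigr => k _; rewrite !mxE [RHS]mulrC; congr (_ * _).
rewrite derive_snd_sum; last by apply: smooth_at_diff; exact: sde.
by apply: eq_bigr => j _; rewrite mxE.
Qed.

Let rhs (z : V * V) : V := \row_k ('D_('e_k, 0) e z -
  \sum_j z.2 ord0 j * 'D_('e_j, 0) ('D_(0, 'e_k) e) z).

(** The Euler-Lagrange equation of [e] solved for the acceleration; [acc_eq] below is the equation
    itself. *)
Let acc (z : V * V) : V := rhs z *m invmx (gram z).

Let acc_smooth (z : V * V) : z.2 != 0 -> smooth_at acc z.
Proof.
move=> z0; apply/smooth_at_rV => k.
have srhs l : smooth_at (fun z => rhs z ord0 l) z.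
  apply: (@smooth_at_eq _ _ _ (fun z => 'D_('e_l, 0) e z -
    \sum_j z.2 ord0 j * 'D_('e_j, 0) ('D_(0, 'e_l) e) z)).
    by near=> z'; rewrite mxE.
  apply: smooth_atB; first exact: smooth_at_derive (se z0).
  apply: smooth_at_sum => j; apply: smooth_atM.
    exact: ((smooth_at_rV _ _).1 (smooth_at_snd z) j).
  exact: smooth_at_derive (sde l z0).
apply: (@smooth_at_eq _ _ _ (fun z => \sum_l rhs z ord0 l * invmx (gram z) l k)).
  by near=> z'; rewrite [RHS]mxE.
apply: smooth_at_sum => l; apply: smooth_atM => //.
apply: smooth_at_invmx; last exact: gram_unit.
move=> j1 j2; apply: (@smooth_at_eq _ _ _ ('D_(0, 'e_j1) ('D_(0, 'e_j2) e))).
  by near=> z'; rewrite mxE.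
exact: smooth_at_derive (sde j2 z0).
Unshelve. all: by end_near. Qed.

Let acc_eq (z : V * V) k : z.2 != 0 ->
  'D_(z.2, acc z) ('D_(0, 'e_k) e) z = 'D_('e_k, 0) e z.
Proof.
move=> z0; rewrite derive_pair_sum; last by apply: smooth_at_diff; exact: sde.
have : (acc z *m gram z) ord0 k = rhs z ord0 k by rewrite /acc mulmxKV// gram_unit.
rewrite !mxE => H.
have H' : \sum_j acc z ord0 j * 'D_(0, 'e_j) ('D_(0, 'e_k) e) z =
  'D_('e_k, 0) e z - \sum_j z.2 ord0 j * 'D_('e_j, 0) ('D_(0, 'e_k) e) z.
  by rewrite -H; apply: eq_bigr => j _; rewrite [gram z j k]mxE.
exact: sum_split_eq H'.
Qed.

Section Extremals.
Variables (h : R) (z : R -> V * V).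
Hypothesis sz : forall t : R, t \in `]-h, h[ -> smooth_at z t.
Hypothesis z2 : forall t : R, t \in `]-h, h[ -> (z t).2 != 0.
Hypothesis dz : forall t : R, t \in `]-h, h[ -> is_derive t 1 z ((z t).2, acc (z t)).

Let e_el (t : R) k : t \in `]-h, h[ ->
  is_derive t 1 (fun s => 'D_(0, 'e_k) e (z s)) ('D_('e_k, 0) e (z t)).
Proof.
move=> th; have dk := smooth_at_diff (sde k (z2 th)).
by have := is_derive_curve (dz th) dk; rewrite acc_eq//; exact: z2.
Qed.

(** Conservation of energy. Let [Phi] be the velocity paired with the vertical derivative of [e].
    The Euler-Lagrange equation gives [Phi' = e'], while homogeneity of degree two gives
    [Phi = 2 * e]; hence [e' = 2 * e'], so [e' = 0]. *)
Let e_const (t : R) : t \in `]-h, h[ -> e (z t) = e (z 0).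
Proof.
move=> th; suff de (s : R) : s \in `]-h, h[ -> is_derive s 1 (fun s => e (z s)) 0.
  apply: (constant_on_oo de) => //.
  by move: th; rewrite !in_itv /= => /andP[]; lra.
move=> {}th; have dk := smooth_at_diff (se (z2 th)).
set m : R := 'D_((z s).2, acc (z s)) e (z s).
have d1 : is_derive s 1 (fun s => e (z s)) m by exact: is_derive_curve (dz th) dk.
suff m0 : m = 0 by rewrite -m0.
pose Phi (s : R) : R := \sum_j (z s).2 ord0 j * 'D_(0, 'e_j) e (z s).
have dPhi : is_derive s 1 Phi m.
  rewrite /m derive_pair_sum//; apply: is_derive_sumR => j.
  exact: is_derive_mulR (is_derive_coord j (is_derive_snd (dz th))) (e_el j th).
have PhiE (r : R) : r \in `]-h, h[ -> Phi r = 2 * e (z r).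
  move=> rh; have dr := smooth_at_diff (se (z2 rh)).
  rewrite /Phi -derive_snd_sum//.
  have dfr := smooth_at_diff (sf (z2 rh)).
  apply: etrans (derive_sqr (0, (z r).2) dfr) _.
  have := z2 rh; case: (z r) => y w w0.
  rewrite /e expr2 mulrA; congr (_ * _).
  by apply: euler; exact: hom.
have d2 : is_derive s 1 Phi (2 * m).
  have near_in : \forall r \near s, r \in `]-h, h[ by exact: near_in_itvoo.
  apply: (near_eq_is_derive (f := fun s => 2 * e (z s))).
    by apply: filterS near_in => r /PhiE ->.
have := is_derive_unique dPhi d2; lra.
Qed.

(** Where [f] has the constant value [l], every derivative of [e] is [2 * l] times that of [f], so
    the Euler-Lagrange equation passes from [e] to [f]. *)
Lemma extremal_curve : forall (t : R) (k : 'I_n), t \in `]-h, h[ ->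
  is_derive t 1 (fun s => 'D_(0, 'e_k) f (z s)) ('D_('e_k, 0) f (z t)).
Proof.
move=> t k th.
pose l := f (z t).
have l0 : 0 < l by apply: f_pos; exact: z2.
have fl (s : R) : s \in `]-h, h[ -> f (z s) = l.
  move=> sh; apply/eqP; rewrite -(eqrXn2 (n := 2))//; last 2 first.
  - by apply/ltW/f_pos; exact: z2.
  - exact: ltW.
  by apply/eqP; exact: etrans (e_const sh) (esym (e_const th)).
have De (s : R) (u : V * V) : s \in `]-h, h[ -> 'D_u f (z s) = (2 * l)^-1 * 'D_u e (z s).
  move=> sh; have dfs := smooth_at_diff (sf (z2 sh)).
  have -> : 'D_u e (z s) = 2 * l * 'D_u f (z s).
    by have := derive_sqr u dfs; rewrite fl.
  by rewrite mulrA mulVf ?mul1r// mulf_neq0// gt_eqF.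
rewrite De//.
have near_in : \forall r \near t, r \in `]-h, h[ by exact: near_in_itvoo.
apply: (near_eq_is_derive (f := fun s => (2 * l)^-1 * 'D_(0, 'e_k) e (z s))).
  by apply: filterS near_in => r rh; rewrite De.
exact: is_derive_cstM (e_el k th).
Qed.

End Extremals.

(** The extremal through [(y0, w0)] is a geodesic, so its lift stays in a plane [W] of homogeneous
    coordinates together with its first two derivatives. Hence the acceleration is a multiple of the
    velocity, and by [euler0] it drops out of the Euler-Lagrange equation of [f]. What remains is
    Hamel's condition. *)
Theorem hamel_chart (y0 w0 : V) k : projective L -> w0 != 0 ->
  'D_(w0, 0) ('D_(0, 'e_k) f) (y0, w0) = 'D_('e_k, 0) f (y0, w0).
Proof.
move=> PL w00.
pose Phi (z : V * V) := (z.2, acc z).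
have sPhi : smooth_at Phi (y0, w0).
  by apply: smooth_at_pair; [exact: smooth_at_snd|exact: acc_smooth].
have nP : nbhs (y0, w0) (fun z : V * V => z.2 != 0) by exact: (near_z2 (z := (y0, w0))).
have fV : fdim (V * V)%type by apply: fdim_prod; exact: fdim_rV.
have [h [z [h0 z0 hz]]] := ode_exists fV sPhi nP.
have sz (t : R) : t \in `]-h, h[ -> smooth_at z t by move=> /hz[].
have z2 (t : R) : t \in `]-h, h[ -> (z t).2 != 0 by move=> /hz[].
have dz (t : R) : t \in `]-h, h[ -> is_derive t 1 z ((z t).2, acc (z t)) by move=> /hz[].
have EL := extremal_curve z2 dz.
pose y : R -> V := fun t => (z t).1.
have dy (t : R) : t \in `]-h, h[ -> is_derive t 1 y (z t).2.
  by move=> th; exact: is_derive_fst (dz t th).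
have Dy (t : R) : t \in `]-h, h[ -> 'D_1 y t = (z t).2 by move=> /dy[].
(* Geodesics are tested on closed intervals, so half of the open interval of existence is used. *)
have sub (t : R) : t \in `[- (h / 2), h / 2] -> t \in `]-h, h[.
  by rewrite !in_itv /= => /andP[]; lra.
have ab : - (h / 2) < h / 2 by lra.
have in0 : (0 : R) \in `]-h, h[ by rewrite in_itv /=; lra.
have zE (t : R) : t \in `]-h, h[ -> (y t, 'D_1 y t) = z t.
  by move=> th; rewrite Dy// /y; case: (z t).
have geo : geodesic L (- (h / 2)) (h / 2) (fun t => chart_point i (y t)).
  have SY (t : R) : t \in `[- (h / 2), h / 2] -> smooth_at y t.
    move=> /sub th; apply: (smooth_at_linl (f := z)); last exact: sz.
    by move=> x; exact: is_diff_fst.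
  have RY (t : R) : t \in `[- (h / 2), h / 2] -> 'D_1 y t != 0.
    by move=> /sub th; rewrite Dy// z2.
  have ELY (t : R) j : t \in `[- (h / 2), h / 2] ->
      is_derive t 1 (fun s => 'D_(0, 'e_j) f (y s, 'D_1 y s)) ('D_('e_j, 0) f (y t, 'D_1 y t)).
    move=> /sub th; have zt := zE t th; rewrite zt.
    apply: (near_eq_is_derive (f := fun s => 'D_(0, 'e_j) f (z s))); last exact: EL.
    have near_in : \forall r \near t, r \in `]-h, h[ by exact: near_in_itvoo.
    by apply: filterS near_in => r rh; rewrite zE.
  exact: el_geodesic FL ab SY RY ELY.
have [l [W dW lW] hl] := PL _ _ _ ab geo.
have XW (t : R) : t \in `[- (h / 2), h / 2] -> insert i 1 (y t) \in W.
  move=> /hl; rewrite lW /projectivization /= chart_pointE /ph.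
  have [a a0 ->] := repr_pi_RP (nzv (insert i 1 (y t))).
  by move=> /(memvZ a^-1); rewrite scalerA mulVf// scale1r nzvK// insert1_neq0.
have nW (t : R) : t \in `]- (h / 2), h / 2[ -> \forall s \near t, s \in `]- (h / 2), h / 2[.
  by move=> th; exact: near_in_itvoo.
have dX (t : R) : t \in `]-h, h[ ->
    is_derive t 1 (fun t => insert i 1 (y t)) (insert i 0 (z t).2).
  move=> th; have [dyt <-] := dy t th.
  have dty : differentiable y t by apply/derivable1_diffP.
  have [<- d] := derive_insert i 1 (1 : R) dty.
  by apply: DeriveDef => //; exact: diff_derivable.
have dX2 : is_derive (0 : R) 1 (fun t => insert i 0 (z t).2) (insert i 0 (acc (z 0))).
  have [dyt e1] := is_derive_snd (dz 0 in0).
  have dty : differentiable (fun t => (z t).2) (0 : R) by apply/derivable1_diffP.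
  have [e2 d] := derive_insert i 0 (1 : R) dty.
  apply: DeriveDef; first exact: diff_derivable.
  by apply: etrans e2 _; rewrite e1.
have in0' : (0 : R) \in `]- (h / 2), h / 2[ by rewrite in_itv /=; lra.
have oc (t : R) : t \in `]- (h / 2), h / 2[ -> t \in `[- (h / 2), h / 2] by exact: subset_itv_oo_cc.
have X1W (t : R) : t \in `]- (h / 2), h / 2[ -> insert i 0 (z t).2 \in W.
  move=> th; apply: (curve_in_subspace _ (dX t (sub _ (oc _ th)))).
  by apply: filterS (nW t th) => s sh; exact/XW/oc.
have X2W : insert i 0 (acc (z 0)) \in W.
  by apply: (curve_in_subspace _ dX2); apply: filterS (nW 0 in0') => s; exact: X1W.
have ind : indep (insert i 1 (y 0)) (insert i 0 (z 0).2) by apply: indep_insert; exact: z2.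
have [al [be E]] := dim2_span dW ind (XW 0 (oc _ in0')) (X1W 0 in0') X2W.
(* The [i]-th coordinate of the lift is constantly 1, so both derivatives have [i]-th coordinate
   0. *)
have al0 : al = 0.
  by move/rowP/(_ i): E; rewrite insertE !mxE !unlift_none mulr1 mulr0 addr0.
have accE : acc (y0, w0) = be *: w0.
  apply/rowP => j; move/rowP/(_ (lift i j)): E.
  by rewrite al0 scale0r add0r z0 insert_lift => ->; rewrite !mxE liftK.
have H1 := EL 0 k in0; rewrite z0 in H1.
have dk : differentiable ('D_(0, 'e_k) f) (z 0).
  by rewrite z0; apply: smooth_at_diff; exact: smooth_at_derive (sf (z := (y0, w0)) w00).
have H2 := is_derive_curve (dz 0 in0) dk.
rewrite (is_derive_unique H1 H2) z0 accE /=; rewrite z0 in dk.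
have -> : (w0, be *: w0) = be *: (0, w0) + (w0, 0).
  by congr pair; rewrite /= ?scaler0 ?add0r ?addr0.
apply: etrans (esym (add0r _)) (esym _); apply: etrans (deriveDr _ _ dk) _.
congr (_ + _); apply: etrans (deriveZr _ _ dk) _.
suff -> : 'D_(0, w0) ('D_(0, 'e_k) f) (y0, w0) = 0 by rewrite scaler0.
apply: euler0 => [a y' w' a0|a a0]; first exact: hom.
by apply: smooth_at_diff; apply: sf; rewrite scaler_eq0 negb_or gt_eqF.
Qed.

End HamelChart.

(** * Hamel's condition in homogeneous coordinates *)

Section HatFunctions.
Context {R : realType} {n : nat}.
Local Notation E := 'rV[R]_n.+1.

(* the pull-backs to homogeneous coordinates of positively homogeneous
   functions on the tangent bundle *)
Record hatlike (A : E * E -> R) : Prop := {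
  hatlike_smooth : forall x v, indep x v -> smooth_at A (x, v);
  hatlike_inv : forall (a b : R) x v, a != 0 -> x != 0 ->
    A (a *: x, a *: v + b *: x) = A (x, v);
  hatlike_hom : forall (a : R) x v, 0 < a -> A (x, a *: v) = a * A (x, v) }.

Definition hamel (A : E * E -> R) : Prop := forall x v w, indep x v ->
  'D_(v, 0) ('D_(0, w) A) (x, v) = 'D_(w, 0) A (x, v).

Lemma th_nzv (x v : E) : th x v = th (val (nzv x)) v.
Proof. by rewrite /th /nzv valKd. Qed.

Lemma hat_hatlike (L : TRP R n -> R) : Finsler L -> hatlike (hat L).
Proof.
move=> FL; split=> [x v|a b x v|a x v a0]; [exact: hat_smooth|exact: hat_inv|].
rewrite /hat /= th_nzv [in RHS]th_nzv; apply: (hat_homog (L := L)); rewrite ?ltW//.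
exact: svalP (nzv x).
Qed.

Lemma indepN (x v : E) : indep x v -> indep x (- v).
Proof.
move=> [x0 H]; split=> // b; apply/eqP => e; move/eqP: (H (- b)); apply.
by rewrite scaleNr -e opprK.
Qed.

Lemma indep_scale (a : R) (x v : E) : a != 0 -> indep x v -> indep x (a *: v).
Proof.
move=> a0 [x0 H]; split=> // b; apply/eqP => e; move/eqP: (H (a^-1 * b)); apply.
by rewrite -scalerA -e scalerA mulVf// scale1r.
Qed.

Section Basics.
Variable A : E * E -> R.
Hypothesis hA : hatlike A.

Lemma hatlike_diff x v : indep x v -> differentiable A (x, v).
Proof. by move=> /(hatlike_smooth hA)/smooth_at_diff. Qed.

Lemma hatlike_derive_diff u x v : indep x v -> differentiable ('D_u A) (x, v).
Proof. by move=> I; apply: smooth_at_diff; apply: smooth_at_derive; exact: hatlike_smooth. Qed.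

(** Independence is detected by two nonvanishing numbers that vary continuously: a coordinate of
    [x], and a chart component of [v]. *)
Lemma near_indep (x v : E) : indep x v -> \forall z \near (x, v), indep z.1 z.2.
Proof.
move=> I; have [x0 _] := I; have [i xi] := ex_coord_neq0 x0.
have s1 : smooth_at (fun z : E * E => z.1 ord0 i) (x, v).
  exact: ((smooth_at_rV _ _).1 (smooth_at_fst _) i).
have s2 : smooth_at (fun z : E * E => dehomv i z.1 z.2) (x, v).
  by apply: smooth_at_dehomv; [|exact: smooth_at_fst|exact: smooth_at_snd].
have [j dj] : exists j, dehomv i x v ord0 j != 0.
  apply: contrapT => /forallNP H; move/eqP: (indep_dehomv xi I); apply.
  by apply/rowP => j; rewrite [RHS]mxE; apply/eqP/negPn/negP/H.
have s3 : smooth_at (fun z : E * E => dehomv i z.1 z.2 ord0 j) (x, v).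
  exact: ((smooth_at_rV _ _).1 s2 j).
apply: filterS2 (near_neq0 (smooth_at_cont s1) xi) (near_neq0 (smooth_at_cont s3) dj).
move=> z zi zj; split; first exact: coord_neq0 zi.
move=> b; apply: contraNneq zj => e.
have : dehomv i z.1 z.2 == 0 by rewrite dehomv_eq0//; apply/asboolP; exists b.
by move=> /eqP ->; rewrite mxE.
Qed.

Lemma hatlike_euler x v : indep x v -> 'D_(0, v) A (x, v) = A (x, v).
Proof.
by move=> _; apply: euler => a y w a0; exact: hatlike_hom.
Qed.

Lemma hatlike_euler0 w x v : indep x v -> 'D_(0, v) ('D_(0, w) A) (x, v) = 0.
Proof.
move=> I; apply: euler0 => [a y u a0|a a0]; first exact: hatlike_hom.
by apply: hatlike_diff; apply: indep_scale; rewrite ?gt_eqF.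
Qed.

Lemma hatlike_shift (b : R) x v : x != 0 -> A (x, v + b *: x) = A (x, v).
Proof. by move=> x0; have := hatlike_inv hA b v (oner_neq0 R) x0; rewrite !scale1r. Qed.

(** Scaling the point alone amounts to scaling the direction by the inverse. This degree -1 gives
    the radial derivatives below. *)
Lemma hatlike_scale (a : R) x v : 0 < a -> x != 0 -> A (a *: x, v) = a^-1 * A (x, v).
Proof.
move=> a0 x0; rewrite -(hatlike_hom hA) ?invr_gt0//.
have := hatlike_inv hA 0 (a^-1 *: v) (lt0r_neq0 a0) x0.
by rewrite scale0r addr0 scalerA divff ?scale1r// gt_eqF.
Qed.

Let line_snd (h : R) (u x v : E) : h *: (0, u) + (x, v) = (x, h *: u + v).
Proof. by congr pair; rewrite /= ?scaler0 ?add0r. Qed.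

Let line_fst (h : R) (u x v : E) : h *: (u, 0) + (x, v) = (h *: u + x, v).
Proof. by congr pair; rewrite /= ?scaler0 ?add0r. Qed.

Let derive_zero {U : normedModType R} (f : U -> R) z u :
  (forall h : R, f (h *: u + z) = f z) -> 'D_u f z = 0.
Proof.
move=> H; have <- : 'D_(1 : R) (cst (f z) : R -> R) (0 : R) = 0 by rewrite derive_cst.
by apply: derive_line_eq => h; rewrite H.
Qed.

Lemma hatlike_derive_snd x v : x != 0 -> 'D_(0, x) A (x, v) = 0.
Proof.
move=> x0; apply: derive_zero => h.
by rewrite line_snd addrC hatlike_shift.
Qed.

Lemma hatlike_derive_snd2 w x v : x != 0 -> 'D_(0, x) ('D_(0, w) A) (x, v) = 0.
Proof.
move=> x0; apply: derive_zero => h; rewrite line_snd.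
apply: derive_line_eq => k; rewrite !line_snd addrA [_ + h *: x]addrC.
by rewrite -addrA addrC hatlike_shift.
Qed.

Let derive_inv (c : R) (g : R -> R) :
  (\forall h \near (0 : R), g h = (h + 1)^-1 * c) -> 'D_1 g (0 : R) = - c.
Proof.
move=> H; rewrite (near_eq_derive _ H).
have d1 : is_derive (0 : R) 1 (fun h : R => h + 1) 1.
  by have := is_deriveD (is_derive_id (0 : R) 1) (is_derive_cst (1 : R) (0 : R) 1); rewrite addr0.
have d2 := is_derive_div (f := cst c) (g := fun h : R => h + 1) (t := 0) (lt0r_neq0 _)
  (is_derive_cst c (0 : R) 1) d1.
have -> : (fun h : R => (h + 1)^-1 * c) = (fun h => cst c h / (h + 1)).
  by apply/funext => h; rewrite mulrC.
have [|_ ->] := d2 _; first by rewrite add0r.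
by rewrite /= add0r; field.
Qed.

Let near1 : \forall h \near (0 : R), 0 < h + 1.
Proof.
have : \forall h \near (0 : R), h \in `]-1, 1[.
  by apply: near_in_itvoo; rewrite in_itv /=; lra.
by apply: filterS => h; rewrite in_itv /= => /andP[]; lra.
Qed.

Let derive_fst (f : E * E -> R) x v u :
  'D_(u, 0) f (x, v) = 'D_1 (fun h : R => f (h *: u + x, v)) (0 : R).
Proof.
apply: derive_line_eq => h; rewrite line_fst; congr (f (_ *: _ + _, _)).
by rewrite addr0 /GRing.scale /= mulr1.
Qed.

Lemma hatlike_derive_fst x v : x != 0 -> 'D_(x, 0) A (x, v) = - A (x, v).
Proof.
move=> x0; rewrite derive_fst; apply: derive_inv; apply: filterS near1 => h h1.
by rewrite -[X in _ + X](scale1r x) -scalerDl hatlike_scale.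
Qed.

Lemma hatlike_derive_fst2 w x v : indep x v ->
  'D_(x, 0) ('D_(0, w) A) (x, v) = - 'D_(0, w) A (x, v).
Proof.
move=> I; have [x0 _] := I; rewrite derive_fst; apply: derive_inv; apply: filterS near1 => h h1.
rewrite -[X in _ + X](scale1r x) -scalerDl.
have dA : derivable A (x, v) (0, w) by apply: diff_derivable; exact: hatlike_diff.
apply: etrans (deriveZ (h + 1)^-1 dA).
by apply: derive_line_eq => k; rewrite !line_snd hatlike_scale.
Qed.

(** At [(h *: v + x, v)] the vertical direction [h *: v + x] annihilates [A], so by Euler the
    derivative along [(0, x)] is [- h * A]. Its derivative at [h = 0] is [- A], which is also the
    radial derivative on the right. *)
Lemma hamel_self x v : indep x v ->
  'D_(v, 0) ('D_(0, x) A) (x, v) = 'D_(x, 0) A (x, v).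
Proof.
move=> I; have [x0 _] := I; rewrite hatlike_derive_fst// derive_fst.
have I' (h : R) : indep (h *: v + x) v.
  split=> [|b]; apply/eqP => e.
    have [h0|h0] := eqVneq h 0; first by move/eqP: x0; apply; rewrite -e h0 scale0r add0r.
    have [_ H] := I; move/eqP: (H (- h^-1)); apply; apply: (scalerI h0).
    by rewrite scalerA mulrN divff// scaleN1r; apply/eqP; rewrite -addr_eq0 e.
  have [_ H] := I; have := H (b / (1 - b * h)); apply/negP; rewrite negbK; apply/eqP.
  have bh : (1 - b * h) *: v = b *: x.
    by rewrite scalerBl scale1r {1}e scalerDr scalerA addrAC subrr add0r.
  have b1 : 1 - b * h != 0.
    apply/eqP => b0; move: bh; rewrite b0 scale0r => /esym/eqP.
    rewrite scaler_eq0 (negPf x0) orbF => /eqP b00.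
    by move: b0; rewrite b00 mul0r subr0 => /eqP; rewrite oner_eq0.
  by apply: (scalerI b1); rewrite bh scalerA mulrCA divff// mulr1.
have H (h : R) : 'D_(0, x) A (h *: v + x, v) = - h * A (h *: v + x, v).
  have Ih := I' h; have dA := hatlike_diff Ih; have [xh _] := Ih.
  have := hatlike_derive_snd v xh.
  have -> : (0, h *: v + x) = h *: (0, v) + (0, x) :> E * E.
    by congr pair; rewrite /= ?scaler0 ?add0r.
  move=> H; have := etrans (esym (deriveDr _ _ dA)) H.
  move=> H'; have := etrans (congr1 (+%R^~ _) (esym (deriveZr _ _ dA))) H'.
  by rewrite (hatlike_euler Ih) => /eqP; rewrite addrC addr_eq0 => /eqP ->; rewrite mulNr.
under eq_fun do rewrite H.
have d1 : is_derive (0 : R) 1 (fun h : R => - h) (-1) by exact: is_deriveN.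
have d2 : is_derive (0 : R) 1 (fun h : R => A (h *: v + x, v)) ('D_(v, 0) A (x, v)).
  have e0 : (x, v) + (0 : R) *: (v, 0) = (x, v) :> E * E by rewrite scale0r addr0.
  have dA : differentiable A ((x, v) + (0 : R) *: (v, 0)) by rewrite e0; exact: hatlike_diff.
  have e : (fun s : R => A ((x, v) + s *: (v, 0))) = (fun h : R => A (h *: v + x, v)).
    by apply/funext => s; congr (A (_, _)); rewrite /= ?scaler0 ?addr0// addrC.
  by rewrite -e -{2}e0; exact: is_derive_along dA.
have [_ ->] := is_derive_mulR d1 d2.
by rewrite scale0r add0r oppr0 mul0r add0r mulN1r.
Qed.

End Basics.

End HatFunctions.

Section Lin2.
Context {R : realType}.

Lemma derive_lin {U : normedModType R} (f : U -> R) z (a : R) q r : differentiable f z ->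
  'D_(a *: q + r) f z = a * 'D_q f z + 'D_r f z.
Proof. by move=> df; rewrite deriveDr// deriveZr. Qed.

Lemma derive_derive_lin {U : normedModType R} (f : U -> R) z p (a : R) q r : smooth_at f z ->
  'D_p ('D_(a *: q + r) f) z = a * 'D_p ('D_q f) z + 'D_p ('D_r f) z.
Proof.
move=> sf.
have nE : \forall z' \near z, 'D_(a *: q + r) f z' = a *: 'D_q f z' + 'D_r f z'.
  by apply: filterS (near_smooth_at sf) => z' sz'; apply: derive_lin; exact: smooth_at_diff.
rewrite (near_eq_derive _ nE).
have d u : derivable ('D_u f) z p.
  by apply: diff_derivable; apply: smooth_at_diff; exact: smooth_at_derive.
have dq : derivable (a \*: 'D_q f) z p by exact: derivableZ (d q).
have := deriveD dq (d r); rewrite (deriveZ a (d q)) => <-; congr ('D_p _ _).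
Qed.

Lemma near_line {U : normedModType R} (P : U -> Prop) (z p : U) :
  (\forall z' \near z, P z') -> \forall h \near (0 : R), P (h *: p + z).
Proof.
move=> nP; have [d _] := is_derive_line z p (0 : R).
have c : {for (0 : R), continuous (fun h : R => z + h *: p)}.
  by apply: differentiable_continuous; apply/derivable1_diffP.
have : \forall h \near (0 : R), P (z + h *: p) by apply: c => /=; rewrite scale0r addr0.
by apply: filterS => h; rewrite addrC.
Qed.

End Lin2.

Section HamelOfChart.
Context {R : realType} {n : nat}.
Local Notation E := 'rV[R]_n.+1.
Variable A : E * E -> R.
Hypothesis hA : hatlike A.

Let hamel_at (x v w : E) : Prop := 'D_(v, 0) ('D_(0, w) A) (x, v) = 'D_(w, 0) A (x, v).

Let hamel_at_lin x v (a : R) w1 w2 : indep x v -> hamel_at x v w1 -> hamel_at x v w2 ->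
  hamel_at x v (a *: w1 + w2).
Proof.
rewrite /hamel_at => I H1 H2; have sA := hatlike_smooth hA I.
have e1 : (0, a *: w1 + w2) = a *: (0, w1) + (0, w2) :> E * E.
  by congr pair; rewrite /= ?scaler0 ?add0r.
have e2 : (a *: w1 + w2, 0) = a *: (w1, 0) + (w2, 0) :> E * E.
  by congr pair; rewrite /= ?scaler0 ?add0r.
rewrite e1 e2 (derive_derive_lin _ _ _ _ sA) (derive_lin _ _ _ (smooth_at_diff sA)).
by rewrite H1 H2.
Qed.

Lemma insert_surj i (x : E) : x = insert i (x ord0 i) (\row_j x ord0 (lift i j)).
Proof.
by apply/rowP => j; rewrite mxE; case: unliftP => [k ->|->//]; rewrite mxE.
Qed.

Lemma insert00 i : insert i 0 (0 : 'rV[R]_n) = 0.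
Proof. by apply/rowP => j; rewrite !mxE; case: unliftP => // k _; rewrite mxE. Qed.

Section Normalise.
Variables (a b : R).
Hypothesis a0 : a != 0.

Let T (z : E * E) : E * E := (a *: z.1, a *: z.2 + b *: z.1).

Let T_line (h : R) (p z : E * E) : T (h *: p + z) = h *: T p + T z.
Proof.
congr pair; rewrite /= !scalerDr !scalerA; first by rewrite mulrC.
by rewrite [a * h]mulrC [b * h]mulrC addrACA.
Qed.

Let near_T (z p : E * E) : indep z.1 z.2 -> \forall h \near (0 : R), indep (h *: p + z).1 (h *: p + z).2.
Proof.
move=> I; apply: (near_line (P := fun z : E * E => indep z.1 z.2)).
by case: z I => x v; exact: near_indep.
Qed.

(** [T] is linear and leaves [A] unchanged, so derivatives are transported together with their
    directions. *)
Lemma hatlike_derive_affine (z p : E * E) : indep z.1 z.2 ->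
  'D_(T p) A (T z) = 'D_p A z.
Proof.
move=> I; apply: derive_line_near; apply: filterS (near_T p I) => h [h0 _].
by rewrite -T_line /T hatlike_inv//; case: (_ + z).
Qed.

Lemma hatlike_derive_affine2 (z p q : E * E) : indep z.1 z.2 ->
  'D_(T p) ('D_(T q) A) (T z) = 'D_p ('D_q A) z.
Proof.
move=> I; apply: derive_line_near; apply: filterS (near_T p I) => h Ih.
by rewrite -T_line hatlike_derive_affine.
Qed.

(** Under [T] a derivative in the point picks up a vertical part. By the radial derivative and by
    the two degeneracies of the vertical Hessian, both sides acquire the same extra term
    [- (b / a) * 'D_(0, w') A]. *)
Lemma hamel_affine x v w : indep x v ->
  (forall w, hamel_at x v w) -> hamel_at (a *: x) (a *: v + b *: x) w.
Proof.
rewrite /hamel_at => I H.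
have [x0 _] := I; have dA := hatlike_diff hA I.
have dwA u : differentiable ('D_u A) (x, v) by exact: hatlike_derive_diff.
pose w' := a^-1 *: w.
have ew : w = a *: w' by rewrite scalerA divff// scale1r.
have Tz : (a *: x, a *: v + b *: x) = T (x, v) by [].
have Tw2 : (0, w) = T (0, w') by rewrite /T /= !scaler0 addr0 -ew.
have Tw1 : (w, 0) = T (w', - (b / a) *: w').
  by rewrite /T /= -ew scalerA mulrN mulrCA divff// mulr1 scaleNr addNr.
pose v' := a^-1 *: (a *: v + b *: x).
have ev : v' = v + (b / a) *: x by rewrite /v' scalerDr !scalerA mulVf// scale1r mulrC.
have Tv1 : (a *: v + b *: x, 0) = T (v', - (b / a) *: v').
  rewrite /T /= scalerA divff// scale1r scalerA mulrN mulrCA divff// mulr1.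
  by rewrite scaleNr addNr.
rewrite Tz Tw2 Tw1 Tv1 hatlike_derive_affine2// hatlike_derive_affine//.
have split (u : E) : (u, - (b / a) *: u) = - (b / a) *: (0, u) + (u, 0) :> E * E.
  by congr pair; rewrite /= ?scaler0 ?add0r ?addr0.
have lin1 (u p q : E * E) c : 'D_(c *: p + q) ('D_u A) (x, v) =
   c * 'D_p ('D_u A) (x, v) + 'D_q ('D_u A) (x, v) by exact: derive_lin.
rewrite !split (derive_lin _ _ _ dA) lin1.
have e1 : (0, v') = (b / a) *: (0, x) + (0, v) :> E * E.
  by congr pair; rewrite /= ?scaler0 ?add0r// ev addrC.
have e2 : (v', 0) = (b / a) *: (x, 0) + (v, 0) :> E * E.
  by congr pair; rewrite /= ?scaler0 ?add0r// ev addrC.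
rewrite e1 e2 !lin1 H (hatlike_derive_snd2 hA w' v x0) (hatlike_derive_fst2 hA w' I).
rewrite (hatlike_euler0 hA w' I).
by rewrite mulr0 addr0 mulr0 add0r mulrN mulNr.
Qed.

End Normalise.

(** Each independent pair is the image under some [T] of a pair normalised in a chart, and each
    direction [w] is a chart direction plus a multiple of the point, to which [hamel_self]
    applies. *)
Theorem hamel_of_chart : (forall i (y w xi : 'rV[R]_n), w != 0 ->
   hamel_at (insert i 1 y) (insert i 0 w) (insert i 0 xi)) -> hamel A.
Proof.
move=> H.
have H1 i (y w : 'rV[R]_n) u : w != 0 -> hamel_at (insert i 1 y) (insert i 0 w) u.
  move=> w0; have I := indep_insert i y w0.
  pose c := u ord0 i.
  have eu : u = c *: insert i 1 y + insert i 0 (\row_j u ord0 (lift i j) - c *: y).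
    by rewrite -insert_lin mulr1 addr0 addrC subrK -insert_surj.
  by rewrite eu; apply: hamel_at_lin => //; [exact: hamel_self|exact: H].
move=> x v w I; have [x0 _] := I; have [i xi] := ex_coord_neq0 x0.
pose a := x ord0 i; pose b := v ord0 i / a.
have ex : x = a *: insert i 1 (dehom i x).
  by rewrite insert_dehom// scalerA divff// scale1r.
have ev : v = a *: insert i 0 (dehomv i x v) + b *: x.
  apply/rowP => j; rewrite !mxE; case: unliftP => [k ->|->]; last first.
    by rewrite mulr0 add0r /b divfK.
  by rewrite !mxE /b /a; field.
pose b' := b * a.
have ev' : v = a *: insert i 0 (dehomv i x v) + b' *: insert i 1 (dehom i x).
  by rewrite -scalerA -ex -ev.
rewrite -[in LHS]/(hamel_at x v w) -/(hamel_at x v w).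
have : hamel_at (a *: insert i 1 (dehom i x))
   (a *: insert i 0 (dehomv i x v) + b' *: insert i 1 (dehom i x)) w.
  apply: hamel_affine => //; first by apply: indep_insert; exact: indep_dehomv.
  by move=> u; apply: H1; exact: indep_dehomv.
by rewrite -ev' -ex.
Qed.

End HamelOfChart.

Theorem hat_hamel {R : realType} {n : nat} (L : TRP R n -> R) :
  Finsler L -> projective L -> hamel (hat L).
Proof.
move=> FL PL; apply: hamel_of_chart; first exact: hat_hatlike.
move=> i y w xi w0.
have sf := chartfun_smooth i y FL w0.
have D2 (z : 'rV[R]_n * 'rV[R]_n) eta : 'D_(0, insert i 0 eta) (hat L) (insert i 1 z.1, insert i 0 z.2)
    = 'D_(0, eta) (chartfun L i) z.
  case: z => y' w'; rewrite -(derive_hat_insert L i y' w' 0 eta).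
  by rewrite insert00.
have D1 eta : 'D_(insert i 0 eta, 0) (hat L) (insert i 1 y, insert i 0 w)
    = 'D_(eta, 0) (chartfun L i) (y, w).
  rewrite -(derive_hat_insert L i y w eta 0).
  by rewrite insert00.
rewrite D1.
have -> : 'D_(insert i 0 w, 0) ('D_(0, insert i 0 xi) (hat L)) (insert i 1 y, insert i 0 w) =
  'D_(w, 0) ('D_(0, xi) (chartfun L i)) (y, w).
  have l1 (h : R) : h *: (insert i 0 w, 0) + (insert i 1 y, insert i 0 w) =
      (insert i 1 (h *: w + y), insert i 0 w).
    by rewrite -[X in insert i X (_ + _)](add0r 1) -[X in X + 1](mulr0 h) insert_lin;
      congr pair; rewrite /= ?scaler0 ?add0r.
  have l2 (h : R) : h *: (w, 0) + (y, w) = (h *: w + y, w).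
    by congr pair; rewrite /= ?scaler0 ?add0r.
  by apply: derive_line_eq => h; rewrite l1 l2 -D2.
have df : differentiable (chartfun L i) (y, w) by exact: smooth_at_diff.
have : forall k, 'D_(w, 0) ('D_(0, 'e_k) (chartfun L i)) (y, w) = 'D_('e_k, 0) (chartfun L i) (y, w).
  by move=> k; exact: hamel_chart.
move=> Hk.
have nE : \forall z \near (y, w), 'D_(0, xi) (chartfun L i) z =
    \sum_j xi ord0 j * 'D_(0, 'e_j) (chartfun L i) z.
  apply: filterS (near_smooth_at sf) => z /smooth_at_diff dz.
  rewrite derive_pair_sum//; apply: eq_bigr => j _; rewrite mxE.
  by apply: etrans (add0r _); congr (_ + _); exact: mul0r.
rewrite (near_eq_derive _ nE) [RHS]derive_pair_sum//.
have d j : derivable (fun z => xi ord0 j * 'D_(0, 'e_j) (chartfun L i) z) (y, w) (w, 0).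
  apply: diff_derivable; apply: smooth_at_diff; apply: smooth_atM; first exact: smooth_at_cst.
  exact: smooth_at_derive sf.
have := derive_sum d; rewrite fct_sumE => ->; apply: eq_bigr => j _.
have dj : derivable ('D_(0, 'e_j) (chartfun L i)) (y, w) (w, 0).
  by apply: diff_derivable; apply: smooth_at_diff; exact: smooth_at_derive sf.
apply: etrans (deriveZ (xi ord0 j) dj) _.
by rewrite Hk mxE; apply: etrans (esym (addr0 _)) _; congr (_ + _); exact/esym/mul0r.
Qed.

(** * Odd solutions are linear *)

Section Concentration.
Context {R : realType}.
Local Notation mu := (@lebesgue_measure R).
Implicit Types (a b c d : R) (f g : R -> R).

Lemma integ_sub a b c d f : a <= c -> d <= b -> cont_on a b f ->
  (forall t : R, t \in `[a, b] -> 0 <= f t) -> integ c d f <= integ a b f.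
Proof.
move=> ac db cf f0.
have sub : `[c, d]%classic `<=` `[a, b]%classic.
  by move=> t; rewrite /= !in_itv /= => /andP[]; lra.
have cf' : cont_on c d f by move=> t /sub; exact: cf.
have [i1 i2] := (cont_on_integrable cf, cont_on_integrable cf').
rewrite /integ /Rintegral; apply: fine_le; try exact: integrable_fin_num.
by apply: ge0_subset_integral => //; exact: measurable_int i1.
Qed.

Lemma near_ball_cc (P : R -> Prop) (t0 : R) : (\forall t \near t0, P t) ->
  exists2 e : R, 0 < e & forall t : R, t \in `[t0 - e, t0 + e] -> P t.
Proof.
move=> /nbhs_ballP[e /= e0 H]; exists (e / 2); first by rewrite divr_gt0.
move=> t; rewrite in_itv /= => /andP[h1 h2]; apply: H.
by rewrite /ball /= ltr_norml; lra.
Qed.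

Lemma near_gt f (t0 m : R) : {for t0, continuous f} -> m < f t0 -> \forall t \near t0, m < f t.
Proof. by move=> cf mf; apply: (cvgr_gt (f t0) cf m mf). Qed.

Lemma ex_exp_small (x e : R) : 0 <= x -> x < 1 -> 0 < e -> exists k, x ^+ k < e.
Proof.
move=> x0 x1 e0; have : `|x| < 1 by rewrite ger0_norm.
move=> /cvg_expr/cvgrPdist_lt/(_ e e0)[k _ /(_ k (leqnn k))] /=.
by rewrite sub0r normrN ger0_norm ?exprn_ge0// => ?; exists k.
Qed.

Lemma not_geometric_le (A B q r : R) : 0 < A -> 0 <= B -> 0 <= q -> q < r ->
  ~ (forall k, A * r ^+ k <= B * q ^+ k).
Proof.
move=> A0 B0 q0 qr H; have r0 : 0 < r by lra.
have e0 : 0 < A / (B + 1) by rewrite divr_gt0//; lra.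
have x0 : 0 <= q / r by rewrite divr_ge0 // ltW.
have x1 : q / r < 1 by rewrite ltr_pdivrMr// mul1r.
have [k hk] := ex_exp_small x0 x1 e0.
have := H k; apply/negP; rewrite -ltNge.
have rk : 0 < r ^+ k by rewrite exprn_gt0.
have Hk : q ^+ k < A / (B + 1) * r ^+ k by rewrite -ltr_pdivrMr// -expr_div_n.
have B1 : 0 < B + 1 by lra.
have : (B + 1) * q ^+ k < A * r ^+ k.
  by move: Hk; rewrite mulrAC ltr_pdivlMr// [X in X < _]mulrC.
have : 0 <= q ^+ k by rewrite exprn_ge0.
by nra.
Qed.

(* As k grows, the weight [w * p ^ k] concentrates at the maximum of [p]. *)
Lemma concentration (a b t0 : R) g (w p : R -> R) : t0 \in `]a, b[ ->
  cont_on a b g -> cont_on a b w -> cont_on a b p ->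
  (forall t : R, t \in `[a, b] -> 0 <= w t) -> (forall t : R, t \in `]a, b[ -> 0 < w t) ->
  (forall t : R, t \in `[a, b] -> 0 <= p t) ->
  (forall t : R, t \in `[a, b] -> t != t0 -> p t < p t0) ->
  (forall k, integ a b (fun t => g t * (w t * p t ^+ k)) = 0) -> g t0 = 0.
Proof.
move=> t0ab cg cw cp w0 w1 p0 p1.
have ctX f k : cont_on a b f -> cont_on a b (fun t => f t ^+ k).
  move=> cf; elim: k => [|k IH]; first by under [X in cont_on _ _ X]eq_fun do rewrite expr0; exact: cont_on_cst.
  by under [X in cont_on _ _ X]eq_fun do rewrite exprS; exact: cont_onM.
have cwp k : cont_on a b (fun t => w t * p t ^+ k) by apply: cont_onM => //; exact: ctX.
(* The inequality is applied to [g] and to [- g]. *)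
suff H f : cont_on a b f -> (forall k, integ a b (fun t => f t * (w t * p t ^+ k)) = 0) -> f t0 <= 0.
  move=> Hg; apply/eqP; rewrite eq_le H//= -oppr_le0 -mulN1r.
  apply: (H (fun t => -1 * g t)); first exact: cont_onZ.
  move=> k; under eq_integ do rewrite -mulrA.
  by rewrite integZ ?Hg ?mulr0//; exact: cont_onM.
move=> cf Hf; rewrite leNgt; apply/negP => ft0.
have t0cc : t0 \in `[a, b] by exact: subset_itv_oo_cc.
pose m := f t0 / 2; have m0 : 0 < m by rewrite /m divr_gt0.
have nf : \forall t \near t0, (t \in `]a, b[) /\ m < f t.
  apply: filterS2 (near_in_itvoo t0ab) _ => [t tab h|]; first by split; [exact: tab|exact: h].
  by apply: near_gt; [exact: cf|rewrite /m; lra].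
have [d d0 Hd] := near_ball_cc nf.
have ain : t0 - d \in `[t0 - d, t0 + d] by rewrite in_itv /=; lra.
have bin : t0 + d \in `[t0 - d, t0 + d] by rewrite in_itv /=; lra.
have [aI _] := Hd _ ain; have [bI _] := Hd _ bin.
move: aI bI; rewrite !in_itv /= => /andP[a1 a2] /andP[b1 b2].
have sub c e : a <= c -> e <= b -> forall h, cont_on a b h -> {within `[c, e], continuous h}.
  move=> ac eb h ch; apply: cont_on_within => t; rewrite in_itv /= => /andP[t1 t2].
  by apply: ch; rewrite in_itv /=; lra.
have [s1 s1I max1] := EVT_max (ltW a1) (sub a (t0 - d) (lexx a) (ltW a2) p cp).
have [s2 s2I max2] := EVT_max (ltW b2) (sub (t0 + d) b (ltW b1) (lexx b) p cp).
move: s1I s2I; rewrite !in_itv /= => /andP[s11 s12] /andP[s21 s22].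
have s1I : s1 \in `[a, b] by rewrite in_itv /=; lra.
have s2I : s2 \in `[a, b] by rewrite in_itv /=; lra.
have q1 : p s1 < p t0 by apply: p1 => //; apply/eqP => e; lra.
have q2 : p s2 < p t0 by apply: p1 => //; apply/eqP => e; lra.
have [q [q0 qt qs1 qs2]] : exists q, [/\ 0 <= q, q < p t0, p s1 <= q & p s2 <= q].
  have := p0 _ s1I; have := p0 _ s2I.
  by have [h|h] := leP (p s1) (p s2); [exists (p s2)|exists (p s1)]; split=> //; exact: ltW.
(* [q] bounds [p] outside the window of radius [d] around [t0], and [p] exceeds [r > q] on a smaller
   window. The two estimates that follow compare [r ^+ k] with [q ^+ k]. *)
pose r := (q + p t0) / 2.
have qr : q < r by rewrite /r; lra.
have np : \forall t \near t0, (t \in `]t0 - d, t0 + d[) /\ r < p t.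
  have t0d : t0 \in `]t0 - d, t0 + d[ by rewrite in_itv /=; lra.
  apply: filterS2 (near_in_itvoo t0d) _ => [t tab h|]; first by split; [exact: tab|exact: h].
  by apply: near_gt; [exact: cp|rewrite /r; lra].
have [e e0 He] := near_ball_cc np.
have ein (t : R) : t \in `[t0 - e, t0 + e] -> t \in `]a, b[.
  by move=> /He[]; rewrite !in_itv /= => /andP[]; lra.
have ein1 : a < t0 - e.
  by have := ein (t0 - e); rewrite !in_itv /=; lra.
have ein2 : t0 + e < b.
  by have := ein (t0 + e); rewrite !in_itv /=; lra.
have ee : t0 - e <= t0 + e by lra.
have [u uI minw] := EVT_min ee (sub _ _ (ltW ein1) (ltW ein2) w cw).
have wu : 0 < w u by apply: w1; exact: ein.
have ab : a <= b by lra.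
have cfm : cont_on a b (fun t => (m - f t) * w t).
  by apply: cont_onM => //; apply: cont_onB => //; exact: cont_on_cst.
have [v vI maxv] := EVT_max ab (cont_on_within cfm).
set C := `|(m - f v) * w v|.
apply: (@not_geometric_le (m * (w u * (2 * e))) (C * (b - a)) q r) => //.
- by rewrite !mulr_gt0.
- by rewrite mulr_ge0 ?normr_ge0//; lra.
move=> k.
have lower : w u * r ^+ k * (2 * e) <= integ a b (fun t => w t * p t ^+ k).
  apply: (@le_trans _ _ (integ (t0 - e) (t0 + e) (fun t => w t * p t ^+ k))); last first.
    apply: integ_sub => //; try exact: ltW.
    by move=> t tab; rewrite mulr_ge0 ?exprn_ge0 ?w0 ?p0.
  have <- : integ (t0 - e) (t0 + e) (fun=> w u * r ^+ k) = w u * r ^+ k * (2 * e).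
    by rewrite integ_cst//; congr (_ * _); lra.
  apply: le_integ; first exact: cont_on_cst.
    by move=> t /ein tab; apply: cwp; exact: subset_itv_oo_cc.
  move=> t te; have [_ rp] := He t te.
  have r0 : 0 <= r by exact: le_trans q0 (ltW qr).
  have rk : r ^+ k <= p t ^+ k.
    by apply: lerXn2r; rewrite ?nnegrE//; [exact: le_trans r0 (ltW rp)|exact: ltW].
  by apply: ler_pM => //; [exact: ltW|rewrite exprn_ge0|exact: minw].
(* As the integral of [f * w * p ^+ k] is zero, [m] times the integral of the weight is that of
   [(m - f) * w * p ^+ k]. The integrand is nonpositive inside the window, where [m < f], and at
   most [C * q ^+ k] outside. *)
have upper : m * integ a b (fun t => w t * p t ^+ k) <= C * q ^+ k * (b - a).
  rewrite -subr_le0 -integ_cst// -integZ// -integB; [|exact: cont_onZ|exact: cont_on_cst].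
  rewrite -(Hf k); apply: le_integ.
  - by apply: cont_onB; [exact: cont_onZ|exact: cont_on_cst].
  - exact: cont_onM.
  move=> t tab; have wp0 : 0 <= w t * p t ^+ k by rewrite mulr_ge0 ?exprn_ge0 ?w0 ?p0.
  have C0 : 0 <= C by rewrite normr_ge0.
  have qk : 0 <= q ^+ k by rewrite exprn_ge0.
  have [tin|tout] := boolP (t \in `[t0 - d, t0 + d]).
    have [_ mf] := Hd t tin.
    by rewrite -subr_ge0; nra.
  have pq : p t <= q.
    move: tout; rewrite in_itv /= negb_and -!ltNge => /orP[h|h].
      by apply: le_trans qs1; apply: max1; move: tab; rewrite !in_itv /= => /andP[]; lra.
    by apply: le_trans qs2; apply: max2; move: tab; rewrite !in_itv /= => /andP[]; lra.
  have pk : p t ^+ k <= q ^+ k by apply: lerXn2r; rewrite ?nnegrE ?p0.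
  have pk0 : 0 <= p t ^+ k by rewrite exprn_ge0 ?p0.
  have := le_trans (maxv t tab) (ler_norm _); rewrite -/C /=.
  move: (f t) (w t) (p t ^+ k) (q ^+ k) pk pk0 qk C0 => x y P Q; clear; move=> PQ P0 Q0 C0 h1.
  have : (m - x) * y * P <= C * P by apply: ler_wpM2r.
  have : C * P <= C * Q by apply: ler_wpM2l.
  nra.
have := le_trans (ler_wpM2l (ltW m0) lower) upper.
have -> : m * (w u * r ^+ k * (2 * e)) = m * (w u * (2 * e)) * r ^+ k by ring.
by have -> : C * q ^+ k * (b - a) = C * (b - a) * q ^+ k by ring.
Qed.

End Concentration.

Section Reflection.
Context {R : realType} {n : nat}.
Local Notation E := 'rV[R]_n.+1.
Implicit Types (A B : E * E -> R).

Definition refl A (z : E * E) : R := A (z.1, - z.2).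

Lemma derive_refl A (p z : E * E) : 'D_p (refl A) z = 'D_(p.1, - p.2) A (z.1, - z.2).
Proof. by apply: derive_line_eq => h; rewrite /refl; congr (A (_, _)); rewrite /= opprD scalerN. Qed.

Lemma hatlike_refl A : hatlike A -> hatlike (refl A).
Proof.
move=> hA; split=> [x v I|a b x v a0 x0|a x v a0].
- apply: (smooth_at_comp (f := fun z : E * E => (z.1, - z.2)) (g := A)) => //.
    apply: smooth_at_pair; first exact: smooth_at_fst.
    apply: (smooth_at_linl (f := snd) (l := -%R)); last exact: smooth_at_snd.
    by apply: (hatlike_smooth hA); exact: indepN.
- rewrite /refl /= opprD -scalerN -scaleNr; exact: hatlike_inv.
- by rewrite /refl /= -scalerN; exact: hatlike_hom.
Qed.

Lemma hamel_refl A : hatlike A -> hamel A -> hamel (refl A).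
Proof.
move=> hA HA x v w I; have I' := indepN I.
have -> : 'D_(0, w) (refl A) = refl ('D_(0, - w) A).
  by apply/funext => z; rewrite derive_refl.
rewrite !derive_refl /= oppr0; have := HA _ _ (- w) I'.
have eN (u : E) : (- u, 0) = - (u, 0) :> E * E by congr pair; rewrite /= oppr0.
rewrite !eN (deriveNr _ (hatlike_derive_diff hA _ I')) (deriveNr _ (hatlike_diff hA I')).
exact: oppr_inj.
Qed.

Lemma hatlike_comb (c d : R) A B : hatlike A -> hatlike B ->
  hatlike (fun z => c * A z + d * B z).
Proof.
move=> hA hB; split=> [x v I|a b x v a0 x0|a x v a0].
- by apply: smooth_atD; apply: smooth_atM; (exact: smooth_at_cst || exact: hatlike_smooth).
- by rewrite (hatlike_inv hA)// (hatlike_inv hB).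
- by rewrite (hatlike_hom hA)// (hatlike_hom hB)// mulrDr !mulrA ![a * _]mulrC.
Qed.

Lemma derive_comb {U : normedModType R} (f g : U -> R) z p (c d : R) :
  differentiable f z -> differentiable g z ->
  'D_p (fun z => c * f z + d * g z) z = c * 'D_p f z + d * 'D_p g z.
Proof.
move=> df dg.
have df' : derivable f z p by exact: diff_derivable.
have dg' : derivable g z p by exact: diff_derivable.
have cf : derivable (c \*: f) z p by exact: derivableZ df'.
have cg : derivable (d \*: g) z p by exact: derivableZ dg'.
by have := deriveD cf cg; rewrite (deriveZ c df') (deriveZ d dg').
Qed.

Lemma hamel_comb (c d : R) A B : hatlike A -> hatlike B -> hamel A -> hamel B ->
  hamel (fun z => c * A z + d * B z).
Proof.
move=> hA hB HA HB x v w I.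
rewrite derive_comb; [|exact: hatlike_diff..].
have nE : \forall z \near (x, v), 'D_(0, w) (fun z => c * A z + d * B z) z =
    c * 'D_(0, w) A z + d * 'D_(0, w) B z.
  apply: filterS (near_indep I) => -[y u] I'.
  by apply: derive_comb; exact: hatlike_diff.
rewrite (near_eq_derive _ nE) derive_comb ?HA ?HB//; exact: hatlike_derive_diff.
Qed.

End Reflection.

Section TrigCurves.
Context {R : realType}.

Lemma is_derive_trig {W : normedModType R} (P Q K : W) (t : R) :
  is_derive t 1 (fun s : R => sin s *: P + cos s *: Q + K) (cos t *: P - sin t *: Q).
Proof.
have l (C : W) (f : R -> R) d : is_derive t 1 f d -> is_derive t 1 (fun s => f s *: C) (d *: C).
  have lC : linear (fun a : R => a *: C) by move=> a u v; rewrite scalerDl scalerA.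
  have dl x : is_diff x (fun a : R => a *: C) (fun a : R => a *: C).
    by apply: is_diff_fdim lC _; exact: fdim_R.
  by move=> df; exact: is_derive_lin dl df.
have ds := l P _ _ (is_derive_sin t); have dc := l Q _ _ (is_derive_cos t).
by have := is_deriveD (is_deriveD ds dc) (is_derive_cst K t (1 : R)); rewrite addr0 scaleNr.
Qed.

Lemma is_derive_pair {V W : normedModType R} (f : R -> V) (g : R -> W) (t : R) df dg :
  is_derive t 1 f df -> is_derive t 1 g dg -> is_derive t 1 (fun s => (f s, g s)) (df, dg).
Proof.
move=> [df1 <-] [dg1 <-].
have dF : differentiable f t by apply/derivable1_diffP.
have dG : differentiable g t by apply/derivable1_diffP.
rewrite -derive_pair//; apply: DeriveDef => //.
by apply: diff_derivable; exact: differentiable_pair.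
Qed.

Lemma smooth_at_sin_comp {U : normedModType R} (f : U -> R) x :
  smooth_at f x -> smooth_at (fun y => sin (f y)) x.
Proof. by move=> sf; apply: (smooth_at_comp (g := @sin R)) sf _ => //; have [] := smooth_at_sin (f x). Qed.

Lemma smooth_at_cos_comp {U : normedModType R} (f : U -> R) x :
  smooth_at f x -> smooth_at (fun y => cos (f y)) x.
Proof. by move=> sf; apply: (smooth_at_comp (g := @cos R)) sf _ => //; have [] := smooth_at_sin (f x). Qed.

End TrigCurves.

Section PairDirections.
Context {R : realType} {U V : normedModType R}.
Implicit Types (G : U * V -> R).

Lemma derive_split G z (u : U) (v : V) : differentiable G z ->
  'D_(u, v) G z = 'D_(u, 0) G z + 'D_(0, v) G z.
Proof.
have e : (u, v) = (u, 0) + (0, v) :> U * V by congr pair; rewrite /= ?addr0 ?add0r.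
by rewrite e; exact: deriveDr.
Qed.

Lemma derive_lin_snd (a b : R) (u v : V) G z : differentiable G z ->
  'D_(0, a *: u + b *: v) G z = a * 'D_(0, u) G z + b * 'D_(0, v) G z.
Proof.
have e : (0, a *: u + b *: v) = a *: (0, u) + b *: (0, v) :> U * V.
  by congr pair; rewrite /= ?scaler0 ?addr0.
by move=> dG; rewrite e derive_lin// deriveZr.
Qed.

Lemma derive_lin_fst (a b : R) (u v : U) G z : differentiable G z ->
  'D_(a *: u + b *: v, 0) G z = a * 'D_(u, 0) G z + b * 'D_(v, 0) G z.
Proof.
have e : (a *: u + b *: v, 0) = a *: (u, 0) + b *: (v, 0) :> U * V.
  by congr pair; rewrite /= ?scaler0 ?addr0.
by move=> dG; rewrite e derive_lin// deriveZr.
Qed.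

Lemma derive_snd_scale (a : R) (v : V) G z : differentiable G z ->
  'D_(0, a *: v) G z = a * 'D_(0, v) G z.
Proof. by move=> /(derive_lin_snd a 0 v 0); rewrite scale0r addr0 mul0r addr0. Qed.

Lemma derive_fst_scale (a : R) (u : U) G z : differentiable G z ->
  'D_(a *: u, 0) G z = a * 'D_(u, 0) G z.
Proof. by move=> /(derive_lin_fst a 0 u 0); rewrite scale0r addr0 mul0r addr0. Qed.

End PairDirections.

Section Algebra.
Context {R : realType}.

Lemma frame_alg1 (s c qD qF aD aF : R) :
  - s * qD + - c * aD + (c * qF + - s * aF) = - s * qD + c * qF - (c * aD + s * aF).
Proof. by ring. Qed.

Lemma frame_alg2 (x y s c k aD aN aX : R) : x = s * aD -> y = - c * aN + k * aX ->
  aX = 0 -> x + y = s * aD - c * aN.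
Proof. by move=> -> -> ->; ring. Qed.

(** The left side is [sp] times Hamel's identity in the rotated frame; the factor arises because a
    change of longitude moves the point by [sin p] times the unit vector of the parallel. *)
Lemma frame_alg3 (sp cp s c aD aF aN qD qF qD' qF' hat ha hh hth hpth hp : R) :
  hat = sp * qD - cp * hh -> ha = sp * aD - cp * aN -> hth = aN -> hpth = qF -> hp = aF ->
  qD = qD' -> qF = qF' -> c * qD' + s * qF' = - s * aD + c * aF ->
  c * hat + s * ha + cp * (c * hh + s * hth) + sp * (s * hpth - c * hp) = 0.
Proof.
move=> -> -> -> -> -> <- <- H.
transitivity (sp * ((c * qD + s * qF) - (- s * aD + c * aF))); first by ring.
by rewrite H; ring.
Qed.

Lemma frame_alg4 (a b : R) : a + (b - a) = b.
Proof. by ring. Qed.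

End Algebra.

Section SecondOrder.
Context {R : realType} {n : nat}.
Local Notation E := 'rV[R]_n.+1.

Let shift_inv (C : E * E -> R) (x : E) := forall v (h : R), C (x, v + h *: x) = C (x, v).

Let line_snd (k : R) (w x v : E) : k *: (0, w) + (x, v) = (x, k *: w + v) :> E * E.
Proof. by congr pair; rewrite /= ?scaler0 ?add0r. Qed.

Let shift_derive C x w : shift_inv C x -> shift_inv ('D_(0, w) C) x.
Proof.
move=> H v h; apply: derive_line_eq => k.
by rewrite !line_snd addrA H.
Qed.

Let shift_zero C x v : shift_inv C x -> 'D_(0, x) C (x, v) = 0.
Proof.
move=> H; have <- : 'D_(0 : R) (cst (C (x, v)) : R -> R) (0 : R) = 0 by rewrite derive_cst.
by apply: derive_line_eq => k; rewrite line_snd addrC H.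
Qed.

Lemma hatlike_derive_snd3 (A : E * E -> R) (w x v : E) : hatlike A -> x != 0 ->
  'D_(0, x) ('D_(0, w) ('D_(0, w) A)) (x, v) = 0.
Proof.
move=> hA x0; apply: shift_zero; do 2!apply: shift_derive.
by move=> u h; exact: hatlike_shift.
Qed.

Lemma cancel_add (a b c : R) : a + b = c -> c = b -> a = 0.
Proof. by move=> <- /eqP; rewrite -subr_eq0 addrK => /eqP. Qed.

(** Hamel's condition in direction [w] is differentiated at [s = 0] along the directions [v + s w].
    The two terms with one derivative in the point along [w] and two vertical ones cancel by
    [schwarz], and the remaining one is the claim. *)
Lemma hamel_second (A : E * E -> R) (w x v : E) : hatlike A -> hamel A -> indep x v ->
  'D_(v, 0) ('D_(0, w) ('D_(0, w) A)) (x, v) = 0.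
Proof.
move=> hA HA I; have sA := hatlike_smooth hA I.
pose C := 'D_(0, w) A.
have sC : smooth_at C (x, v) by exact: smooth_at_derive.
rewrite (schwarz (v, 0) (0, w) sC).
have near_s : \forall s \near (0 : R), indep (s *: (0, w) + (x, v)).1 (s *: (0, w) + (x, v)).2.
  by apply: (near_line (P := fun z : E * E => indep z.1 z.2)); exact: near_indep.
have nE : \forall s \near (0 : R), 'D_(v, 0) C (x, s *: w + v) + s * 'D_(w, 0) C (x, s *: w + v) =
    'D_(w, 0) A (x, s *: w + v).
  apply: filterS near_s => s; rewrite line_snd /= => Is.
  have dC : differentiable C (x, s *: w + v) by exact: hatlike_derive_diff.
  rewrite -(HA _ _ w Is) -/C.
  have := derive_lin_fst 1 s v w dC; rewrite scale1r mul1r => <-.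
  by rewrite addrC.
have along (G : E * E -> R) : differentiable G (x, v) ->
    is_derive (0 : R) 1 (fun s : R => G (x, s *: w + v)) ('D_(0, w) G (x, v)).
  have e0 : (x, v) + (0 : R) *: (0, w) = (x, v) :> E * E by rewrite scale0r addr0.
  move=> dG; have dG' : differentiable G ((x, v) + (0 : R) *: (0, w)) by rewrite e0.
  have e : (fun s : R => G ((x, v) + s *: (0, w))) = (fun s : R => G (x, s *: w + v)).
    by apply/funext => s; rewrite addrC line_snd.
  by rewrite -e -{2}e0; exact: is_derive_along dG'.
have dC u : differentiable ('D_u C) (x, v) by apply: smooth_at_diff; exact: smooth_at_derive.
have dA : differentiable ('D_(w, 0) A) (x, v) by apply: smooth_at_diff; exact: smooth_at_derive.
have d1 := along _ (dC (v, 0)).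
have d2 := is_derive_mulR (is_derive_id (0 : R) 1) (along _ (dC (w, 0))).
have d3 := near_eq_is_derive nE (is_deriveD d1 d2).
have := is_derive_unique d3 (along _ dA).
rewrite scale0r add0r mul0r add0r mul1r => H.
by apply: cancel_add H _; exact: schwarz.
Qed.

Lemma derive_derive_opp {U : normedModType R} (f : U -> R) z u : smooth_at f z ->
  'D_(- u) ('D_(- u) f) z = 'D_u ('D_u f) z.
Proof.
move=> sf.
have nE : \forall z \near z, 'D_(- u) f z = - 'D_u f z.
  by apply: filterS (near_smooth_at sf) => y /smooth_at_diff; exact: deriveNr.
have d : differentiable ('D_u f) z by apply: smooth_at_diff; exact: smooth_at_derive.
rewrite (near_eq_derive _ nE).
have dd : derivable ('D_u f) z (- u) by exact: diff_derivable.
apply: etrans (deriveN dd) _; rewrite deriveNr// opprK//.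
Qed.

End SecondOrder.

(** * Euler angles on the unit tangent bundle of a 2-sphere *)

Section Frames.
Context {R : realType} {n : nat}.
Local Notation E := 'rV[R]_n.+1.
Variables (A : E * E -> R) (e1 e2 e3 : E).
Hypotheses (hA : hatlike A) (HA : hamel A).
Hypothesis free3 : forall a b c : R, a *: e1 + b *: e2 + c *: e3 = 0 -> [/\ a = 0, b = 0 & c = 0].

(** For the scalar product that makes [e1], [e2], [e3] orthonormal, [p] is the colatitude from [e3]
    and [al] the longitude of [X]. [D] and [F] are the unit vectors of the parallel and of the
    meridian, [V] is the direction at angle [th] from [D], and [N] is [V] turned by a right
    angle. *)
Let X (p al : R) : E := (sin p * cos al) *: e1 + (sin p * sin al) *: e2 + cos p *: e3.
Let D (al : R) : E := - sin al *: e1 + cos al *: e2.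
Let F (p al : R) : E := (cos p * cos al) *: e1 + (cos p * sin al) *: e2 - sin p *: e3.
Let V (p th al : R) : E := cos th *: D al + sin th *: F p al.
Let N (p th al : R) : E := - sin th *: D al + cos th *: F p al.
Let pt (p th al : R) : E * E := (X p al, V p th al).

Let sc2 (x : R) : sin x * sin x = 1 - cos x * cos x.
Proof. by have := cos2Dsin2 x; rewrite !expr2 => /esym ->; rewrite addrC addKr. Qed.

(** [X] and [V] are orthonormal for the scalar product that makes [e1], [e2], [e3] orthonormal. This
    holds also at the poles, where longitude degenerates. *)
Lemma frame_indep p th al : indep (X p al) (V p th al).
Proof.
split=> [|b]; apply/eqP => e.
  have [h1 h2 h3] := free3 e.
  have : (sin p * cos al) ^+ 2 + (sin p * sin al) ^+ 2 + cos p ^+ 2 = 1.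
    have := sc2 p; have := sc2 al; rewrite !expr2; nra.
  by rewrite h1 h2 h3; lra.
have : (- cos th * sin al + sin th * (cos p * cos al) - b * (sin p * cos al)) *: e1 +
   (cos th * cos al + sin th * (cos p * sin al) - b * (sin p * sin al)) *: e2 +
   (- sin th * sin p - b * cos p) *: e3 = 0.
  move/eqP: e; rewrite -subr_eq0 => /eqP <-.
  by apply/rowP => j; rewrite !mxE; ring.
move=> /free3[h1 h2 h3].
pose v1 := - cos th * sin al + sin th * (cos p * cos al).
pose v2 := cos th * cos al + sin th * (cos p * sin al).
pose v3 := - sin th * sin p.
have vv : v1 * v1 + v2 * v2 + v3 * v3 = 1.
  have -> : v1 * v1 + v2 * v2 + v3 * v3 =
     cos th * cos th * (sin al * sin al + cos al * cos al) +
     sin th * sin th * (cos p * cos p * (sin al * sin al + cos al * cos al) + sin p * sin p).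
    by rewrite /v1 /v2 /v3; ring.
  by rewrite !sc2; ring.
have xv : v1 * (sin p * cos al) + v2 * (sin p * sin al) + v3 * cos p = 0.
  have -> : v1 * (sin p * cos al) + v2 * (sin p * sin al) + v3 * cos p =
     sin th * sin p * cos p * (sin al * sin al + cos al * cos al - 1) by rewrite /v1 /v2 /v3; ring.
  by rewrite sc2; ring.
have w1 : v1 = b * (sin p * cos al) by apply/eqP; rewrite -subr_eq0; apply/eqP.
have w2 : v2 = b * (sin p * sin al) by apply/eqP; rewrite -subr_eq0; apply/eqP.
have w3 : v3 = b * cos p by apply/eqP; rewrite -subr_eq0; apply/eqP.
have : v1 * v1 + v2 * v2 + v3 * v3 =
    b * (v1 * (sin p * cos al) + v2 * (sin p * sin al) + v3 * cos p).
  transitivity (v1 * (b * (sin p * cos al)) + v2 * (b * (sin p * sin al)) + v3 * (b * cos p)).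
    by rewrite -w1 -w2 -w3.
  by ring.
by rewrite vv xv mulr0 => /eqP; rewrite oner_eq0.
Qed.

Let dX (p th al : R) : is_derive p (1 : R) (fun t : R => pt t th al) (F p al, - sin th *: X p al).
Proof.
apply: is_derive_pair.
  have := is_derive_trig (cos al *: e1 + sin al *: e2) e3 0 p.
  congr is_derive; last by apply/rowP => j; rewrite !mxE; ring.
  by apply/funext => s; apply/rowP => j; rewrite !mxE; ring.
have := is_derive_trig (- sin th *: e3) (sin th *: (cos al *: e1 + sin al *: e2)) (cos th *: D al) p.
congr is_derive; last by apply/rowP => j; rewrite !mxE; ring.
by apply/funext => s; apply/rowP => j; rewrite !mxE; ring.
Qed.

Let dV (p th al : R) : is_derive th (1 : R) (fun t : R => pt p t al) (0, N p th al).
Proof.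
have dc : is_derive th (1 : R) (fun _ : R => X p al) 0 by exact: is_derive_cst.
apply: (is_derive_pair dc).
have := is_derive_trig (F p al) (D al) 0 th.
congr is_derive; last by apply/rowP => j; rewrite !mxE; ring.
by apply/funext => s; apply/rowP => j; rewrite !mxE; ring.
Qed.

(** A change of longitude moves the point along the parallel and turns the direction in the tangent
    plane at the rate [- cos p]. The component along [X] is invisible to [A]. *)
Let dal (p th al : R) : is_derive al (1 : R) (fun t : R => pt p th t)
  (sin p *: D al, - cos p *: N p th al + (- cos th * sin p) *: X p al).
Proof.
apply: is_derive_pair.
  have := is_derive_trig (sin p *: e2) (sin p *: e1) (cos p *: e3) al.
  congr is_derive; last by apply/rowP => j; rewrite !mxE; ring.
  by apply/funext => s; apply/rowP => j; rewrite !mxE; ring.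
have := is_derive_trig ((sin th * cos p) *: e2 - cos th *: e1)
  (cos th *: e2 + (sin th * cos p) *: e1) (- (sin th * sin p) *: e3) al.
congr is_derive; last first.
  apply/rowP => j; rewrite !mxE.
  have pp := sc2 p; move: (sin p) (cos p) pp => s c pp.
  apply/eqP; rewrite -subr_eq0; apply/eqP.
  transitivity ((cos th * cos al * e1 ord0 j + cos th * sin al * e2 ord0 j) * (s * s + c * c - 1)).
    by ring.
  by rewrite pp; ring.
by apply/funext => s; apply/rowP => j; rewrite !mxE; ring.
Qed.

Let S := ((R * R) * R)%type.

Definition frame_val (z : S) : R := A (pt z.1.1 z.1.2 z.2).
Let h := frame_val.

Let A_diff p th al : differentiable A (pt p th al).
Proof. by apply: hatlike_diff => //; exact: frame_indep. Qed.

Let DA_diff u p th al : differentiable ('D_u A) (pt p th al).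
Proof. by apply: hatlike_derive_diff => //; exact: frame_indep. Qed.

Let slice_p (f : S -> R) (p th al : R) :
  'D_((1, 0), 0) f ((p, th), al) = 'D_1 (fun t : R => f ((t, th), al)) p.
Proof.
apply: derive_line_eq => k; congr (f ((_, _), _)); rewrite /= ?scaler0 ?add0r//.
Qed.

Let slice_th (f : S -> R) (p th al : R) :
  'D_((0, 1), 0) f ((p, th), al) = 'D_1 (fun t : R => f ((p, t), al)) th.
Proof.
apply: derive_line_eq => k; congr (f ((_, _), _)); rewrite /= ?scaler0 ?add0r//.
Qed.

Let slice_al (f : S -> R) (p th al : R) :
  'D_((0, 0), 1) f ((p, th), al) = 'D_1 (fun t : R => f ((p, th), t)) al.
Proof.
apply: derive_line_eq => k; congr (f ((_, _), _)); rewrite /= ?scaler0 ?add0r//.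
Qed.

Let X0 p al : X p al != 0.
Proof. by have [] := frame_indep p 0 al. Qed.

Let h_p p th al : 'D_((1, 0), 0) h ((p, th), al) = 'D_(F p al, 0) A (pt p th al).
Proof.
rewrite slice_p; have [_ ->] := is_derive_curve (dX p th al) (A_diff p th al).
have dA := A_diff p th al; apply: etrans (derive_split _ _ dA) _.
rewrite (derive_snd_scale _ _ dA) (hatlike_derive_snd hA _ (X0 p al)).
by apply: etrans (addr0 _); congr (_ + _); exact: mulr0.
Qed.

Let h_th p th al : 'D_((0, 1), 0) h ((p, th), al) = 'D_(0, N p th al) A (pt p th al).
Proof. by rewrite slice_th; have [_ ->] := is_derive_curve (dV p th al) (A_diff p th al). Qed.

Let h_al p th al : 'D_((0, 0), 1) h ((p, th), al) =
  sin p * 'D_(D al, 0) A (pt p th al) - cos p * 'D_(0, N p th al) A (pt p th al).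
Proof.
rewrite slice_al; have [_ ->] := is_derive_curve (dal p th al) (A_diff p th al).
have dA := A_diff p th al.
apply: etrans (derive_split _ _ dA) _.
apply: frame_alg2 (derive_fst_scale _ _ dA) (derive_lin_snd _ _ _ _ dA) _.
exact: (hatlike_derive_snd hA (V p th al) (X0 p al)).
Qed.

Let along_th u (p th al : R) : is_derive th (1 : R) (fun t : R => 'D_u A (pt p t al))
  ('D_(0, N p th al) ('D_u A) (pt p th al)).
Proof. exact: is_derive_curve (dV p th al) (DA_diff u p th al). Qed.

Let h_p_th p th al : 'D_((0, 1), 0) ('D_((1, 0), 0) h) ((p, th), al) =
  'D_(0, N p th al) ('D_(F p al, 0) A) (pt p th al).
Proof.
rewrite slice_th; have -> : (fun t : R => 'D_((1, 0), 0) h ((p, t), al)) = (fun t => 'D_(F p al, 0) A (pt p t al)).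
  by apply/funext => t; exact: h_p.
by have [_ ->] := along_th (F p al, 0) p th al.
Qed.

(** As [th] grows, [N] turns towards [- V]; the extra term is the derivative of [A] along [V], which
    is [A] by Euler. *)
Let N_is_derive (p th al : R) : is_derive th (1 : R) (fun t : R => 'D_(0, N p t al) A (pt p t al))
  ('D_(0, N p th al) ('D_(0, N p th al) A) (pt p th al) - A (pt p th al)).
Proof.
have e (t : R) : 'D_(0, N p t al) A (pt p t al) =
    - sin t * 'D_(0, D al) A (pt p t al) + cos t * 'D_(0, F p al) A (pt p t al).
  by rewrite /N derive_lin_snd.
rewrite (funext e).
have ds : is_derive th (1 : R) (fun t => - sin t) (- cos th) by exact: is_deriveN.
have d1 := is_derive_mulR ds (along_th (0, D al) p th al).
have d2 := is_derive_mulR (is_derive_cos th) (along_th (0, F p al) p th al).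
have dA := A_diff p th al.
have eV : A (pt p th al) = cos th * 'D_(0, D al) A (pt p th al) + sin th * 'D_(0, F p al) A (pt p th al).
  exact: etrans (esym (hatlike_euler hA (frame_indep p th al))) (derive_lin_snd _ _ _ _ dA).
have nE : \forall z \near pt p th al, 'D_(0, N p th al) A z =
    - sin th * 'D_(0, D al) A z + cos th * 'D_(0, F p al) A z.
  have sA := hatlike_smooth hA (frame_indep p th al).
  by apply: filterS (near_smooth_at sA) => z /smooth_at_diff dz; exact: derive_lin_snd.
have eN := etrans (near_eq_derive (0, N p th al) nE)
  (derive_comb (0, N p th al) (- sin th) (cos th) (DA_diff (0, D al) p th al) (DA_diff (0, F p al) p th al)).
have := is_deriveD d1 d2; rewrite frame_alg1 -eN -eV; exact.
Qed.

Let h_th_th p th al : 'D_((0, 1), 0) ('D_((0, 1), 0) h) ((p, th), al) =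
  'D_(0, N p th al) ('D_(0, N p th al) A) (pt p th al) - A (pt p th al).
Proof.
rewrite slice_th; have -> : (fun t : R => 'D_((0, 1), 0) h ((p, t), al)) = (fun t => 'D_(0, N p t al) A (pt p t al)).
  by apply/funext => t; exact: h_th.
by have [_ ->] := N_is_derive p th al.
Qed.

Let h_al_th p th al : 'D_((0, 1), 0) ('D_((0, 0), 1) h) ((p, th), al) =
  sin p * 'D_(0, N p th al) ('D_(D al, 0) A) (pt p th al) -
  cos p * 'D_((0, 1), 0) ('D_((0, 1), 0) h) ((p, th), al).
Proof.
have e : (fun t : R => 'D_((0, 0), 1) h ((p, t), al)) =
    (fun t => sin p * 'D_(D al, 0) A (pt p t al) - cos p * 'D_(0, N p t al) A (pt p t al)).
  by apply/funext => t; exact: h_al.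
have d1 := is_derive_cstM (sin p) (along_th (D al, 0) p th al).
have d2 := is_derive_cstM (cos p) (N_is_derive p th al).
have [_ d] := is_deriveB d1 d2.
apply: etrans (slice_th _ _ _ _) _; rewrite e; apply: etrans d _.
by congr (_ - _ * _); exact/esym/h_th_th.
Qed.

(** This is Hamel's condition at [(X, V)] in the direction [N], multiplied by [sin p]. [V] and [N]
    are expanded in [D] and [F]; the derivatives along [F] are derivatives in [p], and those along
    [D] come from [h_al]. *)
Lemma frame_pde p th al :
  cos th * 'D_((0, 1), 0) ('D_((0, 0), 1) h) ((p, th), al) +
    sin th * 'D_((0, 0), 1) h ((p, th), al) +
  cos p * (cos th * 'D_((0, 1), 0) ('D_((0, 1), 0) h) ((p, th), al) +
    sin th * 'D_((0, 1), 0) h ((p, th), al)) +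
  sin p * (sin th * 'D_((0, 1), 0) ('D_((1, 0), 0) h) ((p, th), al) -
    cos th * 'D_((1, 0), 0) h ((p, th), al)) = 0.
Proof.
have I := frame_indep p th al; have sA := hatlike_smooth hA I.
have H := HA (N p th al) I.
have H1 := derive_lin_fst (cos th) (sin th) (D al) (F p al) (DA_diff (0, N p th al) p th al).
have H2 := derive_lin_fst (- sin th) (cos th) (D al) (F p al) (A_diff p th al).
have QD := schwarz (0, N p th al) (D al, 0) sA.
have QF := schwarz (0, N p th al) (F p al, 0) sA.
exact: (frame_alg3 (h_al_th p th al) (h_al p th al) (h_th p th al) (h_p_th p th al) (h_p p th al)
  QD QF (etrans (esym H1) (etrans H H2))).
Qed.

Lemma frame_smooth z : smooth_at h z.
Proof.
case: z => -[p th] al.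
have s1 : smooth_at (fun z : S => z.1.1) ((p, th), al).
  by apply: (smooth_at_linl (f := fst) (l := fst)); [exact: is_diff_fst|exact: smooth_at_fst].
have s2 : smooth_at (fun z : S => z.1.2) ((p, th), al).
  by apply: (smooth_at_linl (f := fst) (l := snd)); [exact: is_diff_snd|exact: smooth_at_fst].
have s3 : smooth_at (fun z : S => z.2) ((p, th), al) by exact: smooth_at_snd.
have [sp cp] := (smooth_at_sin_comp s1, smooth_at_cos_comp s1).
have [st ct] := (smooth_at_sin_comp s2, smooth_at_cos_comp s2).
have [sa ca] := (smooth_at_sin_comp s3, smooth_at_cos_comp s3).
have fE : fdim E by exact: fdim_rV.
have Z (f : S -> R) (g : S -> E) z : smooth_at f z -> smooth_at g z ->
  smooth_at (fun z => f z *: g z) z by exact: smooth_atZ.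
have C (e : E) z : smooth_at (fun _ : S => e) z by exact: smooth_at_cst.
have M (f g : S -> R) z : smooth_at f z -> smooth_at g z -> smooth_at (fun z => f z * g z) z.
  exact: smooth_atM.
have P (f g : S -> E) z : smooth_at f z -> smooth_at g z -> smooth_at (fun z => f z + g z) z.
  exact: smooth_atD.
have neg (f : S -> R) z : smooth_at f z -> smooth_at (fun z => - f z) z by exact: smooth_atN.
have negE (f : S -> E) z : smooth_at f z -> smooth_at (fun z => - f z) z.
  move=> sf; have := Z (fun=> -1) f z (smooth_at_cst _ _) sf.
  by under eq_fun do rewrite scaleN1r.
have sX := P _ _ _ (P _ _ _ (Z _ _ _ (M _ _ _ sp ca) (C e1 _)) (Z _ _ _ (M _ _ _ sp sa) (C e2 _)))
  (Z _ _ _ cp (C e3 _)).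
have sF := P _ _ _ (P _ _ _ (Z _ _ _ (M _ _ _ cp ca) (C e1 _)) (Z _ _ _ (M _ _ _ cp sa) (C e2 _)))
  (negE _ _ (Z _ _ _ sp (C e3 _))).
have sD := P _ _ _ (Z _ _ _ (neg _ _ sa) (C e1 _)) (Z _ _ _ ca (C e2 _)).
have sV := P _ _ _ (Z _ _ _ ct sD) (Z _ _ _ st sF).
apply: (smooth_at_comp (f := fun z : S => pt z.1.1 z.1.2 z.2) (g := A)) => //; last first.
  by apply: hatlike_smooth => //; exact: frame_indep.
exact: smooth_at_pair sX sV.
Qed.

Lemma frame_odd : (forall x v, A (x, - v) = - A (x, v)) -> forall p al : R,
  h ((p, pi / 2), al) = - h ((p, - (pi / 2)), al).
Proof.
move=> oddA p al; rewrite -oddA; congr (A (_, _)).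
(* At [th = pi / 2] and [th = - (pi / 2)] the direction is [F] and [- F]: opposite directions at the
   same point. *)
by rewrite /V /= cosN sinN sin_pihalf cos_pihalf !scale0r !add0r scaleN1r opprK scale1r.
Qed.

Lemma frame_period p th : h ((p, th), pi *+ 2) = h ((p, th), 0).
Proof. by rewrite /h /frame_val /pt /X /V /F /D /= sin2pi cos2pi sin0 cos0. Qed.

(** For [p = pi / 2] and [th = 0] the pair [(X, V)] runs along the great circle of [e1] and [e2],
    with [N = - e3]. The left side is thus the second vertical derivative of [A] along [e3], and
    [hamel_second] makes it constant in [al]. *)
Lemma frame_equator al : h ((pi / 2, 0), al) + 'D_((0, 1), 0) ('D_((0, 1), 0) h) ((pi / 2, 0), al) =
  'D_(0, e3) ('D_(0, e3) A) (e1, e2).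
Proof.
pose q : R := pi / 2.
pose B := 'D_(0, e3) ('D_(0, e3) A).
have Bc t : is_derive t (1 : R) (fun t : R => B (pt q 0 t)) 0.
  have I := frame_indep q 0 t; have sA := hatlike_smooth hA I.
  have dB : differentiable B (pt q 0 t) by apply: smooth_at_diff; do 2!apply: smooth_at_derive.
  have := is_derive_curve (dal q 0 t) dB.
  rewrite /q sin_pihalf cos_pihalf oppr0 scale0r add0r cos0 mulr1 scaleN1r -/q scale1r.
  suff -> : 'D_(D t, - X q t) B (pt q 0 t) = 0 by [].
  have eV : V q 0 t = D t by rewrite /V cos0 sin0 scale1r scale0r addr0.
  apply: etrans (derive_split _ _ dB) _.
  have -> : (0, - X q t) = (0, -1 *: X q t) :> E * E by rewrite scaleN1r.
  have H1 := derive_snd_scale (-1) (X q t) dB.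
  have H2 : 'D_(0, X q t) B (pt q 0 t) = 0 by exact: hatlike_derive_snd3.
  have H3 := hamel_second e3 hA HA I; rewrite [X in 'D_(X, 0) _ _]eV in H3.
  by apply: etrans (congr2 +%R H3 H1) _; rewrite H2 mulr0 addr0.
have BE : B (pt q 0 al) = B (e1, e2).
  have -> : B (e1, e2) = B (pt q 0 0).
    have eX : X q 0 = e1.
      by rewrite /X sin_pihalf cos_pihalf sin0 cos0 !mulr1 mulr0 !scale0r scale1r !addr0.
    have eV : V q 0 0 = e2.
      by rewrite /V /D cos0 sin0 oppr0 !scale0r !scale1r add0r addr0.
    by rewrite /pt eX eV.
  pose M := `|al| + 1.
  have Mb (x : R) : `|x| <= `|al| -> x \in `]-M, M[.
    by rewrite in_itv /= -ltr_norml /M => /le_lt_trans; apply; rewrite ltrDl.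
  have Bc' (t : R) : t \in `]- M, M[ -> is_derive t (1 : R) (fun t : R => B (pt q 0 t)) 0.
    by move=> _; exact: Bc.
  apply: (constant_on_oo Bc'); first exact: Mb.
  by apply: Mb; rewrite normr0.
rewrite -/q h_th_th -[RHS]BE.
have -> : N q 0 al = - e3.
  by rewrite /N /F /q sin0 cos0 cos_pihalf sin_pihalf !mul0r oppr0 !scale0r !scale1r !add0r.
have -> : (0, - e3) = - (0, e3) :> E * E by congr pair; rewrite /= oppr0.
rewrite derive_derive_opp; last exact: (hatlike_smooth hA (frame_indep q 0 al)).
exact: frame_alg4.
Qed.

End Frames.

(** * The average over the longitude *)

Section Moments.
Context {R : realType}.

Lemma is_derive_last {U W : normedModType R} (g : U * R -> W) (y : U) (t : R) :
  differentiable g (y, t) -> is_derive t 1 (fun s : R => g (y, s)) ('D_(0, 1) g (y, t)).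
Proof.
have dc : is_derive t 1 (fun s : R => (y, s)) (0, 1).
  exact: is_derive_pair.
by move=> dg; exact: is_derive_curve dc dg.
Qed.

Lemma average_alg (c s cp sp x1 x2 x3 x4 y1 y2 y3 y4 : R) :
  x1 = y1 -> x2 = y2 -> x3 = y3 -> x4 = y4 ->
  - (cp * c) * y1 + (- (cp * s) * y2 + (- (sp * s) * y3 + sp * c * y4)) = 0 ->
  cp * (c * x1 + s * x2) + sp * (s * x3 - c * x4) = 0.
Proof.
by move=> -> -> -> -> H; apply: oppr_inj; rewrite oppr0 -[RHS]H; ring.
Qed.

Lemma average_alg2 (c s cp sp x1 x2 x3 x4 z1 z2 z3 : R) : z1 = z2 ->
  c * z1 + s * z3 + cp * (c * x1 + s * x2) + sp * (s * x3 - c * x4) = 0 ->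
  c * z2 + s * z3 = - (cp * c) * x1 + (- (cp * s) * x2 + (- (sp * s) * x3 + sp * c * x4)).
Proof.
by move=> <- H; apply/eqP; rewrite -subr_eq0; apply/eqP; rewrite -[RHS]H; ring.
Qed.

Lemma cont_lin (a b k : R) (f g : R -> R) : cont_on a b f -> cont_on a b g ->
  cont_on a b (fun t => k * f t + g t).
Proof. by move=> cf cg; apply: cont_onD => //; exact: cont_onZ. Qed.

Lemma integ_lin (a b k : R) (f g : R -> R) : cont_on a b f -> cont_on a b g ->
  integ a b (fun t => k * f t + g t) = k * integ a b f + integ a b g.
Proof. by move=> cf cg; rewrite integD ?integZ//; exact: cont_onZ. Qed.

Variable h : (R * R) * R -> R.
Let T : R := pi *+ 2.
Hypothesis hs : forall z, smooth_at h z.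
Hypothesis pde : forall p th al : R,
  cos th * 'D_((0, 1), 0) ('D_((0, 0), 1) h) ((p, th), al) +
    sin th * 'D_((0, 0), 1) h ((p, th), al) +
  cos p * (cos th * 'D_((0, 1), 0) ('D_((0, 1), 0) h) ((p, th), al) +
    sin th * 'D_((0, 1), 0) h ((p, th), al)) +
  sin p * (sin th * 'D_((0, 1), 0) ('D_((1, 0), 0) h) ((p, th), al) -
    cos th * 'D_((1, 0), 0) h ((p, th), al)) = 0.
Hypothesis h_odd : forall p al : R, h ((p, pi / 2), al) = - h ((p, - (pi / 2)), al).
Hypothesis h_period : forall p th : R, h ((p, th), T) = h ((p, th), 0).

Let T0 : 0 <= T.
Proof. by rewrite /T mulrn_wge0// pi_ge0. Qed.

Let f2 : fdim (R * R)%type.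
Proof. by apply: fdim_prod; exact: fdim_R. Qed.

Let ds u z : smooth_at ('D_u h) z. Proof. exact: smooth_at_derive. Qed.
Let dds u v z : smooth_at ('D_u ('D_v h)) z. Proof. exact: smooth_at_derive. Qed.

Definition average (y : R * R) : R := integ 0 T (fun t => h (y, t)).
Let ab := average.

Lemma average_smooth y : smooth_at ab y.
Proof. by apply: smooth_at_integ. Qed.

Let D1 u y : 'D_u ab y = integ 0 T (fun t => 'D_(u, 0) h (y, t)).
Proof. by apply: derive_integ. Qed.

Lemma derive_derive_average u v y : 'D_u ('D_v ab) y = integ 0 T (fun t => 'D_(u, 0) ('D_(v, 0) h) (y, t)).
Proof.
have -> : 'D_v ab = (fun y => integ 0 T (fun t => 'D_(v, 0) h (y, t))).
  by apply/funext => z; exact: D1.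
by apply: derive_integ => // t _; exact: ds.
Qed.

Let slice (g : (R * R) * R -> R) y : (forall z, smooth_at g z) -> cont_on 0 T (fun t => g (y, t)).
Proof. by move=> sg; apply: cont_on_slice => t _. Qed.

Let sl1 (u : (R * R) * R) (y : R * R) : cont_on 0 T (fun t => 'D_u h (y, t)).
Proof. by apply: (slice (g := 'D_u h)) => z; exact: ds. Qed.

Let sl2 (u v : (R * R) * R) (y : R * R) : cont_on 0 T (fun t => 'D_u ('D_v h) (y, t)).
Proof. by apply: (slice (g := 'D_u ('D_v h))) => z; exact: dds. Qed.

(** The terms of the equation that contain a derivative in [al] are together the derivative of a
    function with period [T], so their integral vanishes. *)
Lemma average_pde p th :
  cos p * (cos th * 'D_(0, 1) ('D_(0, 1) ab) (p, th) + sin th * 'D_(0, 1) ab (p, th)) +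
  sin p * (sin th * 'D_(0, 1) ('D_(1, 0) ab) (p, th) - cos th * 'D_(1, 0) ab (p, th)) = 0.
Proof.
pose ht := 'D_((0, 1), 0) h.
pose G (t : R) := cos th * ht ((p, th), t) + sin th * h ((p, th), t).
pose dG (t : R) := cos th * 'D_((0, 0), 1) ht ((p, th), t) + sin th * 'D_((0, 0), 1) h ((p, th), t).
have dGP (t : R) : is_derive t 1 G (dG t).
  have along (g : (R * R) * R -> R) : smooth_at g ((p, th), t) -> is_derive t (1 : R) (fun t => g ((p, th), t)) ('D_((0, 0), 1) g ((p, th), t)).
    by move=> /smooth_at_diff; exact: is_derive_last.
  exact: is_deriveD (is_derive_cstM (cos th) (along _ (ds _ _))) (is_derive_cstM (sin th) (along _ (hs _))).
have cdG : cont_on 0 T dG.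
  by apply: cont_onD; apply: cont_onZ; [exact: sl2|exact: sl1].
have GT : G T = G 0.
  rewrite /G h_period; congr (_ * _ + _); apply: derive_line_eq => k.
  have line (t : R) : k *: ((0, 1), 0) + ((p, th), t) = ((p, k *: 1 + th), t) :> (R * R) * R.
    by congr (_, _, _); rewrite /= ?scaler0 add0r.
  by rewrite !line h_period.
have := integ_FTC T0 cdG (fun t _ => dGP t); rewrite GT subrr.
move=> I0.
pose b1 (t : R) := 'D_((0, 1), 0) ht ((p, th), t).
pose b2 (t : R) := ht ((p, th), t).
pose b3 (t : R) := 'D_((0, 1), 0) ('D_((1, 0), 0) h) ((p, th), t).
pose b4 (t : R) := 'D_((1, 0), 0) h ((p, th), t).
have c1 : cont_on 0 T b1 by exact: sl2.
have c2 : cont_on 0 T b2 by exact: sl1.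
have c3 : cont_on 0 T b3 by exact: sl2.
have c4 : cont_on 0 T b4 by exact: sl1.
have e (t : R) : t \in `[0, T] -> dG t =
   (- (cos p * cos th)) * b1 t + ((- (cos p * sin th)) * b2 t +
   ((- (sin p * sin th)) * b3 t + (sin p * cos th) * b4 t)).
  move=> _; have S := schwarz (((0, 1), 0) : (R * R) * R) ((0, 0), 1) (hs ((p, th), t)).
  exact: average_alg2 S (pde p th t).
set k1 := - (cos p * cos th) in e; set k2 := - (cos p * sin th) in e.
set k3 := - (sin p * sin th) in e; set k4 := sin p * cos th in e.
have d4 : cont_on 0 T (fun t => k4 * b4 t) by exact: cont_onZ.
have d3 : cont_on 0 T (fun t => k3 * b3 t + k4 * b4 t) by exact: cont_lin.
have d2 : cont_on 0 T (fun t => k2 * b2 t + (k3 * b3 t + k4 * b4 t)) by exact: cont_lin.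
move: I0; rewrite (eq_integ e) (integ_lin k1 c1 d2) (integ_lin k2 c2 d3) (integ_lin k3 c3 d4) integZ//.
exact: (average_alg (derive_derive_average _ _ _) (D1 _ _) (derive_derive_average _ _ _) (D1 _ _)).
Qed.

End Moments.

(** * Odd moments of the average *)

Section Abel.
Context {R : realType}.

Lemma is_derive_exp (f : R -> R) (t d : R) m : is_derive t 1 f d ->
  is_derive t 1 (fun s => f s ^+ m.+1) (m.+1%:R * f t ^+ m * d).
Proof.
move=> df; elim: m => [|m IH].
  by under eq_fun do rewrite expr1; rewrite expr0 mulr1 mul1r.
under eq_fun do rewrite exprS; have := is_derive_mulR df IH.
by congr is_derive; rewrite exprS -(natr1 m.+1); ring.
Qed.

Lemma abel_alg (k j cp sp s c Q r a at_ att ap apt : R) : k = 2 * j + 1 ->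
  s * s = 1 - c * c -> r * c = 2 * j * Q ->
  cp * (c * att + s * at_) + sp * (s * apt - c * ap) = 0 ->
  cp * (c * Q * att + (c * - (r * s) + - s * Q) * at_ +
        (k + 1) * (s * Q * at_ + (s * - (r * s) + c * Q) * a)) +
  sp * (s * Q * apt + (s * - (r * s) + c * Q) * ap) =
  cp * (k + 1) * k * (a * (c * Q)) + (- (cp * (k + 1)) * (a * r) +
    (sp * (k + 1) * (ap * (c * Q)) + - sp * (ap * r))).
Proof.
move=> -> ss rc pde; apply/eqP; rewrite -subr_eq0; apply/eqP.
transitivity (Q * (cp * (c * att + s * at_) + sp * (s * apt - c * ap))
  - (r * c - 2 * j * Q) * (s * cp * at_)
  + (- cp * (2 * j + 1 + 1) * a - sp * ap) * ((s * s - (1 - c * c)) * r - c * (r * c - 2 * j * Q))).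
  by ring.
by rewrite pde ss rc; ring.
Qed.

Lemma abel_alg2 (k j s c Q r a at_ att : R) : k = 2 * j + 1 ->
  s * s = 1 - c * c -> r * c = 2 * j * Q ->
  c * Q * att + (c * - (r * s) + - s * Q) * at_ + k * (s * Q * at_ + (s * - (r * s) + c * Q) * a) =
  1 * (att * (c * Q)) + (k * k * (a * (c * Q)) + - k * (a * r)).
Proof.
move=> -> ss rc; apply/eqP; rewrite -subr_eq0; apply/eqP.
transitivity (- (r * c - 2 * j * Q) * (s * at_)
  - (2 * j + 1) * a * ((s * s - (1 - c * c)) * r - c * (r * c - 2 * j * Q))).
  by ring.
by rewrite ss rc; ring.
Qed.

Variable ab : R * R -> R.
Let a : R := - (pi / 2).
Let b : R := pi / 2.
Hypothesis sab : forall y, smooth_at ab y.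
Hypothesis pde : forall p th : R,
  cos p * (cos th * 'D_(0, 1) ('D_(0, 1) ab) (p, th) + sin th * 'D_(0, 1) ab (p, th)) +
  sin p * (sin th * 'D_(0, 1) ('D_(1, 0) ab) (p, th) - cos th * 'D_(1, 0) ab (p, th)) = 0.
Hypothesis ab_odd : forall p : R, ab (p, b) = - ab (p, a).

Let alt : a < b.
Proof. by rewrite /a /b; have := @pihalf_ge1 R; lra. Qed.

Let q j (t : R) : R := (cos t ^+ 2) ^+ j.
(** With [k = 2 * j + 1], [cos * q j] is the weight [cos ^ k] and [r j] is
    [(k - 1) * cos ^ (k - 2)]. The case distinction avoids the exponent -1 at [j = 0], where the
    coefficient vanishes. *)
Let r j (t : R) : R := if j is j'.+1 then 2 * j%:R * (q j' t * cos t) else 0.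
Let k j : R := 2 * j%:R + 1.

Let dq j (t : R) : is_derive t 1 (q j) (- (r j t * sin t)).
Proof.
case: j => [|j]; first by rewrite /= mul0r oppr0 /q; under eq_fun do rewrite expr0; exact: is_derive_cst.
have := is_derive_exp j (is_derive_exp 1 (is_derive_cos t)).
by congr is_derive; rewrite /= /q expr1; ring.
Qed.

Let rc j (t : R) : r j t * cos t = 2 * j%:R * q j t.
Proof.
case: j => [|j] /=; first by rewrite mul0r mulr0 mul0r.
by rewrite /q (exprS _ j) expr2; ring.
Qed.

Let ss (t : R) : sin t * sin t = 1 - cos t * cos t.
Proof. by have := cos2Dsin2 t; rewrite !expr2 => /esym ->; rewrite addrC addKr. Qed.

Let sX {U : normedModType R} (f : U -> R) x m : smooth_at f x -> smooth_at (fun y => f y ^+ m) x.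
Proof.
move=> sf; elim: m => [|m IH]; first by under eq_fun do rewrite expr0; exact: smooth_at_cst.
by under eq_fun do rewrite exprS; exact: smooth_atM.
Qed.

Let scos (t : R) : smooth_at (@cos R) t. Proof. by have [] := smooth_at_sin t. Qed.
Let sq j (t : R) : smooth_at (q j) t. Proof. by do 2!apply: sX. Qed.
Let sr j (t : R) : smooth_at (r j) t.
Proof.
case: j => [|j]; first exact: smooth_at_cst.
by apply: smooth_atM; [exact: smooth_at_cst|exact: smooth_atM].
Qed.
Let scq j (t : R) : smooth_at (fun t => cos t * q j t) t. Proof. exact: smooth_atM. Qed.

Let moment (f : R * R -> R) (w : R -> R) (p : R) : R := integ a b (fun t => f (p, t) * w t).

Let mcont (f : R * R -> R) (w : R -> R) (p : R) : (forall y, smooth_at f y) -> (forall t : R, smooth_at w t) ->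
  cont_on a b (fun t => f (p, t) * w t).
Proof.
move=> sf sw; apply: cont_onM => t _; last exact: smooth_at_cont.
have : is_derive t (1 : R) (fun t => f (p, t)) ('D_(0, 1) f (p, t)).
  by apply: is_derive_last; exact: smooth_at_diff.
by move=> [d _]; apply: differentiable_continuous; apply/derivable1_diffP.
Qed.

Let dmoment (w : R -> R) (p : R) : (forall t : R, smooth_at w t) ->
  is_derive p 1 (moment ab w) (moment ('D_(1, 0) ab) w p).
Proof.
move=> sw; pose g (z : R * R) := ab z * w z.2.
have sg z : smooth_at g z.
  apply: smooth_atM => //.
  apply: (smooth_at_comp (f := snd) (g := w)) => //.
  exact: smooth_at_snd.
have ab' : a <= b by exact: ltW.
have sg' : forall t : R, t \in `[a, b] -> smooth_at g (p, t) by [].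
have d := integ_diff fdim_R ab' sg'; have D := derive_integ fdim_R ab' (1 : R) sg'.
apply: DeriveDef; first exact: diff_derivable d.
rewrite [LHS]D; apply: eq_integ => t _.
have da : derivable ab (p, t) (1, 0) by apply: diff_derivable; exact: smooth_at_diff.
apply: etrans (etrans (deriveZ (w t) da) (mulrC _ _)).
apply: derive_line_eq => h; rewrite /g [RHS]mulrC; congr (_ * w _).
by rewrite /= scaler0 add0r.
Qed.

Let along (f : R * R -> R) (p t : R) : smooth_at f (p, t) ->
  is_derive t 1 (fun t => f (p, t)) ('D_(0, 1) f (p, t)).
Proof. by move=> /smooth_at_diff; exact: is_derive_last. Qed.

Let sD u y : smooth_at ('D_u ab) y. Proof. exact: smooth_at_derive. Qed.
Let sDD u v y : smooth_at ('D_u ('D_v ab)) y. Proof. exact: smooth_at_derive. Qed.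

Let abp_odd (p : R) : 'D_(1, 0) ab (p, b) = - 'D_(1, 0) ab (p, a).
Proof.
have d : derivable ab (p, a) (1, 0) by apply: diff_derivable; exact: smooth_at_diff.
apply: etrans (deriveN d); apply: derive_line_eq => h.
have line (t : R) : h *: (1, 0) + (p, t) = (h *: 1 + p, t) :> R * R.
  by congr pair; rewrite /= scaler0 add0r.
by rewrite !line ab_odd.
Qed.

Let cosb : cos b = 0. Proof. exact: cos_pihalf. Qed.
Let sinb : sin b = 1. Proof. exact: sin_pihalf. Qed.
Let cosa : cos a = 0. Proof. by rewrite cosN cosb. Qed.
Let sina : sin a = -1. Proof. by rewrite sinN sinb. Qed.
Let qab j : q j a = q j b. Proof. by rewrite /q cosa cosb. Qed.

(** [J] arises from the equation times [q j] by moving derivatives in theta onto the cosines; the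
    coefficient [k j + 1] restores the term in the first derivative of [ab]. At the ends the cosine
    kills the first term of [J], and oddness cancels the other two. *)
Let moment_eq j (p : R) :
  cos p * (k j + 1) * k j * moment ab (fun t => cos t * q j t) p +
  (- (cos p * (k j + 1)) * moment ab (r j) p +
    (sin p * (k j + 1) * moment ('D_(1, 0) ab) (fun t => cos t * q j t) p +
     - sin p * moment ('D_(1, 0) ab) (r j) p)) = 0.
Proof.
pose J (t : R) := cos p * (cos t * q j t * 'D_(0, 1) ab (p, t) +
   (k j + 1) * (sin t * q j t * ab (p, t))) + sin p * (sin t * q j t * 'D_(1, 0) ab (p, t)).
pose dJ (t : R) := cos p * (k j + 1) * k j * (ab (p, t) * (cos t * q j t)) +
  (- (cos p * (k j + 1)) * (ab (p, t) * r j t) +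
    (sin p * (k j + 1) * ('D_(1, 0) ab (p, t) * (cos t * q j t)) +
     - sin p * ('D_(1, 0) ab (p, t) * r j t))).
have dJP (t : R) : is_derive t 1 J (dJ t).
  have d1 := is_derive_mulR (is_derive_mulR (is_derive_cos t) (dq j t)) (along (sD (0, 1) (p, t))).
  have dsq := is_derive_mulR (is_derive_sin t) (dq j t).
  have d2 := is_derive_mulR dsq (along (sab (p, t))).
  have d3 := is_derive_mulR dsq (along (sD (1, 0) (p, t))).
  have := is_deriveD (is_derive_cstM (cos p) (is_deriveD d1 (is_derive_cstM (k j + 1) d2)))
     (is_derive_cstM (sin p) d3).
  by rewrite (abel_alg (ab (p, t)) (erefl (k j)) (ss t) (rc j t) (pde p t)).
have c1 := @mcont _ _ p sab (scq j); have c2 := @mcont _ _ p sab (sr j).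
have c3 := @mcont _ _ p (sD (1, 0)) (scq j); have c4 := @mcont _ _ p (sD (1, 0)) (sr j).
have d4 : cont_on a b (fun t => - sin p * ('D_(1, 0) ab (p, t) * r j t)) by exact: cont_onZ.
have d3 := cont_lin (k := sin p * (k j + 1)) c3 d4.
have d2 := cont_lin (k := - (cos p * (k j + 1))) c2 d3.
have d1 := cont_lin (k := cos p * (k j + 1) * k j) c1 d2.
have := integ_FTC (ltW alt) d1 (fun t _ => dJP t).
rewrite (integ_lin _ c1 d2) (integ_lin _ c2 d3) (integ_lin _ c3 d4) (integZ _ c4) => ->.
rewrite /J cosa cosb sina sinb qab ab_odd abp_odd.
by move: ('D_(1, 0) ab _) ('D_(0, 1) ab _) ('D_(0, 1) ab _) => x1 x2 x3; ring.
Qed.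

(** Once the lower moment vanishes, [c] solves [k cos p c + sin p c' = 0], so [sin p ^ k * c] is
    constant and vanishes with [sin p] at [p = 0]. Where [sin p0 = 0] the equation itself gives
    [c p0 = 0]. *)
Let step j : (forall p, moment ab (r j) p = 0) -> forall p, moment ab (fun t => cos t * q j t) p = 0.
Proof.
move=> M0 p0.
pose c (p : R) := moment ab (fun t => cos t * q j t) p.
pose c' (p : R) := moment ('D_(1, 0) ab) (fun t => cos t * q j t) p.
have dc (p : R) : is_derive p 1 c (c' p) by apply: dmoment; exact: scq.
have M1 p : moment ('D_(1, 0) ab) (r j) p = 0.
  have d1 := @dmoment (r j) p (sr j).
  have d2 : is_derive p (1 : R) (moment ab (r j)) 0.
    have -> : moment ab (r j) = cst 0 by apply/funext => y; rewrite M0.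
    exact: is_derive_cst.
  exact: is_derive_unique d1 d2.
have k1 : 0 < k j + 1 by rewrite /k; have : 0 <= j%:R :> R by []; lra.
have ode p : k j * cos p * c p + sin p * c' p = 0.
  have := moment_eq j p; rewrite M0 M1 -/(c p) -/(c' p) => H.
  apply: (mulfI (lt0r_neq0 k1)); rewrite mulr0 -[RHS]H; ring.
pose G (p : R) := sin p ^+ (j.*2).+1 * c p.
have nE : (j.*2).+1 = (2 * j + 1)%N by rewrite addn1 mul2n.
have kE : k j = (j.*2).+1%:R by rewrite nE natrD natrM.
have dG (p : R) : is_derive p 1 G 0.
  have := is_derive_mulR (is_derive_exp j.*2 (is_derive_sin p)) (dc p).
  congr is_derive; rewrite -kE exprS.
  transitivity (sin p ^+ j.*2 * (k j * cos p * c p + sin p * c' p)); first by ring.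
  by rewrite ode mulr0.
have G0 : G p0 = 0.
  have -> : 0 = G 0 by rewrite /G sin0 expr0n mul0r.
  pose M := `|p0| + 1.
  have Mb (x : R) : `|x| <= `|p0| -> x \in `]-M, M[.
    by rewrite in_itv /= -ltr_norml /M => /le_lt_trans; apply; rewrite ltrDl.
  have dG' (t : R) : t \in `]- M, M[ -> is_derive t (1 : R) G 0 by move=> _; exact: dG.
  by apply: (constant_on_oo dG'); [exact: Mb|apply: Mb; rewrite normr0].
rewrite -/(c p0); have [s0|s0] := eqVneq (sin p0) 0; last first.
  by move: G0; rewrite /G => /eqP; rewrite mulf_eq0 expf_eq0 (negPf s0) andbF /= => /eqP.
have c0 : cos p0 != 0.
  by apply/eqP => c0; have := sin0cos1 s0; rewrite c0 normr0 => /eqP; rewrite eq_sym oner_eq0.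
have := ode p0; rewrite s0 mul0r addr0 => /eqP; rewrite !mulf_eq0 (negPf c0) orbF.
by rewrite kE pnatr_eq0 /= => /eqP.
Qed.

Let moments j : forall p, moment ab (r j) p = 0.
Proof.
elim: j => [|j IH] p.
  rewrite /moment (eq_integ (g := fun=> 0)) ?integ_cst ?mul0r//; last by move=> t _ /=; rewrite mulr0.
  exact: ltW.
rewrite /moment (eq_integ (g := fun t => 2 * j.+1%:R * (ab (p, t) * (cos t * q j t)))).
  by rewrite integZ ?[integ _ _ _](step IH) ?mulr0//; exact: mcont.
by move=> t _ /=; ring.
Qed.

(** All odd moments of [ab] vanish, and two integrations by parts carry this over to its second
    derivative in theta. So [cos * (cos ^ 2) ^ j] annihilates the sum for every [j], and
    [concentration] evaluates the sum at theta = 0. *)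
Lemma abel_equator : ab (pi / 2, 0) + 'D_(0, 1) ('D_(0, 1) ab) (pi / 2, 0) = 0.
Proof.
pose p : R := pi / 2.
pose g (t : R) := ab (p, t) + 'D_(0, 1) ('D_(0, 1) ab) (p, t).
have cslice (f : R * R -> R) : (forall y, smooth_at f y) -> cont_on a b (fun t => f (p, t)).
  by move=> sf; have := @mcont f (fun=> 1) p sf (smooth_at_cst _); under eq_fun do rewrite mulr1.
have cg : cont_on a b g.
  apply: cont_onD; first exact: cslice.
  by apply: (cslice ('D_(0, 1) ('D_(0, 1) ab))) => y; exact: sDD.
have cc : cont_on a b (@cos R) by move=> t _; exact: smooth_at_cont (scos t).
have cc2 : cont_on a b (fun t => cos t ^+ 2).
  by move=> t _; apply: smooth_at_cont; exact: sX.
apply: (concentration (a := a) (b := b) (t0 := 0) (g := g) (w := @cos R) (p := fun t => cos t ^+ 2)) => //.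
- by rewrite in_itv /= /a /b; have := @pihalf_ge1 R; lra.
- by move=> t; rewrite in_itv /=; exact: cos_ge0_pihalf.
- by move=> t; rewrite in_itv /=; exact: cos_gt0_pihalf.
- by move=> t _; exact: sqr_ge0.
- move=> t; rewrite in_itv /= => tab t0; rewrite cos0 expr1n.
  have s0 : sin t != 0.
    apply/eqP => s0; move/eqP: t0; apply.
    have ti : t \in `[- (pi / 2), pi / 2] by rewrite in_itv.
    by apply: sin_inj => //; rewrite ?sin0// in_itv /= /a /b; have := @pihalf_ge1 R; lra.
  have : 0 < sin t ^+ 2 by rewrite exprn_even_gt0.
  by have := cos2Dsin2 t; lra.
move=> j; rewrite (eq_integ (g := fun t => 1 * (ab (p, t) * (cos t * q j t)) +
  'D_(0, 1) ('D_(0, 1) ab) (p, t) * (cos t * q j t))); last first.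
  by move=> t _; rewrite mul1r -mulrDl.
have c1 := @mcont _ _ p sab (scq j); have c2 := @mcont _ _ p sab (sr j).
have c3 := @mcont _ _ p (sDD (0, 1) (0, 1)) (scq j).
rewrite integ_lin// [integ _ _ (fun t => ab _ * _)](step (moments j)) mulr0 add0r.
(* The integral of [dJ] expresses the k-th moment of the second derivative through those of [ab]
   with weights [cos * q j] and [r j], both zero; the boundary terms cancel as in [moment_eq]. *)
pose J (t : R) := cos t * q j t * 'D_(0, 1) ab (p, t) + k j * (sin t * q j t * ab (p, t)).
pose dJ (t : R) := 1 * ('D_(0, 1) ('D_(0, 1) ab) (p, t) * (cos t * q j t)) +
  (k j * k j * (ab (p, t) * (cos t * q j t)) + - k j * (ab (p, t) * r j t)).
have dJP (t : R) : is_derive t 1 J (dJ t).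
  have d1 := is_derive_mulR (is_derive_mulR (is_derive_cos t) (dq j t)) (along (sD (0, 1) (p, t))).
  have dsq := is_derive_mulR (is_derive_sin t) (dq j t).
  have d2 := is_derive_mulR dsq (along (sab (p, t))).
  have := is_deriveD d1 (is_derive_cstM (k j) d2).
  by rewrite (abel_alg2 (ab (p, t)) _ _ (erefl (k j)) (ss t) (rc j t)).
have d4 : cont_on a b (fun t => - k j * (ab (p, t) * r j t)) by exact: cont_onZ.
have d3 := cont_lin (k := k j * k j) c1 d4.
have d1 := cont_lin (k := 1) c3 d3.
have := integ_FTC (ltW alt) d1 (fun t _ => dJP t).
rewrite (integ_lin _ c3 d3) (integ_lin _ c1 d4) (integZ _ c2).
rewrite [integ _ _ (fun t => ab _ * (cos t * _))](step (moments j)) [integ _ _ (fun t => ab _ * r j t)](moments j).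
rewrite mul1r !mulr0 !addr0 => ->.
rewrite /J cosa cosb sina sinb qab ab_odd.
by move: ('D_(0, 1) ab _) ('D_(0, 1) ab _) => x1 x2; ring.
Qed.

End Abel.

Lemma derive0_constant {R : realType} (g : R -> R) :
  (forall s : R, is_derive s 1 g 0) -> forall s, g s = g 0.
Proof.
move=> dg s; have dg' (r : R) : r \in `]- (`|s| + 1), `|s| + 1[ -> is_derive r 1 g 0 by move=> _; exact: dg.
apply: (constant_on_oo dg'); rewrite in_itv /= -ltr_norml ?normr0; last by rewrite ltr_wpDl.
by rewrite ltrDl.
Qed.

(** * The odd part is a closed linear form *)

Section OddPart.
Context {R : realType} {n : nat}.
Local Notation E := 'rV[R]_n.+1.
Implicit Types (x v w y : E).
Variable A : E * E -> R.
Hypotheses (hA : hatlike A) (HA : hamel A).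
Hypothesis oddA : forall x v, A (x, - v) = - A (x, v).

Lemma free_triple x v w : indep x v -> (forall a b : R, w != a *: x + b *: v) ->
  forall a b c : R, a *: x + b *: v + c *: w = 0 -> [/\ a = 0, b = 0 & c = 0].
Proof.
move=> [x0 vx] wxv a b c e.
have c0 : c = 0.
  apply: contrapT => /eqP c0; move/eqP: (wxv (- (c^-1 * a)) (- (c^-1 * b))); apply.
  apply: (scalerI c0); rewrite scalerDr !scalerA !mulrN !mulrA divff// !mul1r.
  by apply/eqP; rewrite -subr_eq0 !scaleNr opprD !opprK addrC e.
have b0 : b = 0.
  apply: contrapT => /eqP b0; move/eqP: (vx (- (b^-1 * a))); apply.
  apply: (scalerI b0); rewrite scalerA mulrN mulrA divff// mul1r scaleNr.
  by apply/eqP; rewrite -addr_eq0 addrC; apply/eqP; rewrite -[RHS]e c0 scale0r addr0.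
split=> //; move: e; rewrite b0 c0 !scale0r !addr0 => /eqP.
by rewrite scaler_eq0 (negPf x0) orbF => /eqP.
Qed.

(** The frame is [x], [v], [w] itself. The average at the equator integrates a constant over a full
    turn, so its vanishing makes the constant vanish. *)
Lemma odd_second_free x v w : indep x v -> (forall a b : R, w != a *: x + b *: v) ->
  'D_(0, w) ('D_(0, w) A) (x, v) = 0.
Proof.
move=> I F; have f3 := free_triple I F.
pose h := frame_val A x v w.
have sh z : smooth_at h z by exact: frame_smooth.
have pde p th al := frame_pde hA HA f3 p th al.
have od p al := frame_odd x v w oddA p al.
have pe p th := frame_period A x v w p th.
have T0 : 0 < pi *+ 2 :> R by rewrite pmulrn_rgt0// pi_gt0.
have abs (z : R * R) : smooth_at (average h) z by exact: average_smooth.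
have apde p th := average_pde sh pde pe p th.
have cs (f : (R * R) * R -> R) (y : R * R) : (forall z, smooth_at f z) -> cont_on 0 (pi *+ 2) (fun t => f (y, t)).
  by move=> sf; apply: cont_on_slice => t _.
have aodd p : average h (p, pi / 2) = - average h (p, - (pi / 2)).
  rewrite /average -mulN1r -integZ; last exact: cs.
  by apply: eq_integ => t _; rewrite mulN1r; exact: od.
have := abel_equator abs apde aodd.
rewrite derive_derive_average// /average -integD; [|exact: cs|]; last first.
  by apply: (cs ('D_((0, 1), 0) ('D_((0, 1), 0) h))) => z; do 2!apply: smooth_at_derive.
rewrite (eq_integ (g := fun=> 'D_(0, w) ('D_(0, w) A) (x, v))); last first.
  by move=> t _; exact: (frame_equator hA HA f3 t).
rewrite integ_cst ?ltW// subr0 => /eqP; rewrite mulf_eq0 (gt_eqF T0) orbF.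
by move=> /eqP.
Qed.

Lemma odd_second x v w : indep x v -> 'D_(0, w) ('D_(0, w) A) (x, v) = 0.
Proof.
move=> I; have [F|] := pselect (forall a b : R, w != a *: x + b *: v).
  exact: odd_second_free.
(* For [w] in the span of [x] and [v] both components are null directions of the vertical
   Hessian. *)
move=> /existsNP[a /existsNP[b /negP]]; rewrite negbK => /eqP e.
have [x0 _] := I; have dA := hatlike_derive_diff hA (0, w) I.
have H := derive_lin_snd a b x v dA; rewrite -e in H; apply: etrans H _.
by rewrite (hatlike_derive_snd2 hA w v x0) (hatlike_euler0 hA w I) !mulr0 addr0.
Qed.

Lemma odd_zero x : A (x, 0) = 0.
Proof. by have := oddA x 0; rewrite oppr0; lra. Qed.

Lemma odd_scale (a : R) x v : A (x, a *: v) = a * A (x, v).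
Proof.
have [a0|a0|->] := ltgtP a 0; last by rewrite scale0r mul0r odd_zero.
  have := hatlike_hom hA x v (_ : 0 < - a); rewrite oppr_gt0 scaleNr oddA mulNr => /(_ a0).
  exact: oppr_inj.
exact: hatlike_hom.
Qed.

Lemma odd_affine x v w : (forall t : R, indep x (v + t *: w)) -> forall t : R,
  A (x, v + t *: w) = A (x, v) + t * 'D_(0, w) A (x, v).
Proof.
move=> I t.
have e (s : R) : (x, v) + s *: (0, w) = (x, v + s *: w) by congr pair; rewrite /= ?scaler0 ?addr0.
have along (G : E * E -> R) (s : R) : differentiable G (x, v + s *: w) ->
    is_derive s 1 (fun s : R => G (x, v + s *: w)) ('D_(0, w) G (x, v + s *: w)).
  rewrite -e => dG; have := is_derive_along dG.
  by congr is_derive; apply/funext => r; rewrite e.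
have g0 (s : R) : 'D_(0, w) A (x, v + s *: w) = 'D_(0, w) A (x, v).
  have d0 (r : R) : is_derive r 1 (fun s : R => 'D_(0, w) A (x, v + s *: w)) 0.
    by have := along _ _ (hatlike_derive_diff hA (0, w) (I r)); rewrite odd_second.
  by have := derive0_constant d0 s; rewrite scale0r addr0.
have df (s : R) : is_derive s 1 (fun s : R => A (x, v + s *: w) - 'D_(0, w) A (x, v) * s) 0.
  have d1 := along _ _ (hatlike_diff hA (I s)).
  have := is_deriveB d1 (is_derive_cstM ('D_(0, w) A (x, v)) (is_derive_id s 1)).
  by rewrite g0 mulr1 subrr.
have := derive0_constant df t; rewrite mulr0 subr0 scale0r addr0 => <-.
by rewrite [t * _]mulrC subrK.
Qed.

(** For independent [x], [v], [w] the function is affine along [v + s w] and along [w + s v].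
    Homogeneity identifies the value at [w + s v] with [s] times that at [v + w / s]; comparing
    [s = 1] and [s = 2] determines both slopes. *)
Lemma odd_linear x v w : indep x v -> 'D_(0, w) A (x, v) = A (x, w).
Proof.
move=> I; have [x0 vx] := I; have [F|] := pselect (forall a b : R, w != a *: x + b *: v); last first.
  move=> /existsNP[a /existsNP[b /negP]]; rewrite negbK => /eqP ->.
  apply: etrans (derive_lin_snd a b x v (hatlike_diff hA I)) _.
  rewrite (hatlike_derive_snd hA v x0) (hatlike_euler hA I) mulr0 add0r.
  by rewrite addrC (hatlike_shift hA)// odd_scale.
have f3 := free_triple I F.
have Iv (t : R) : indep x (v + t *: w).
  split=> // b; apply/eqP => e.
  have [|_ h _] := f3 (- b) 1 t; last by move/eqP: h; rewrite oner_eq0.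
  by rewrite scale1r -addrA e scaleNr addNr.
have Iw (t : R) : indep x (w + t *: v).
  split=> // b; apply/eqP => e.
  have [|_ _ h] := f3 (- b) t 1; last by move/eqP: h; rewrite oner_eq0.
  by rewrite scale1r -addrA [_ + w]addrC e scaleNr addNr.
have Hv := odd_affine Iv; have Hw := odd_affine Iw.
have E (s : R) : 0 < s -> A (x, w) + s * 'D_(0, v) A (x, w) =
    s * (A (x, v) + s^-1 * 'D_(0, w) A (x, v)).
  move=> s0; rewrite -Hv -Hw -odd_scale; congr (A (_, _)).
  by rewrite scalerDr scalerA divff ?gt_eqF// scale1r addrC.
have e1 := E 1 ltr01; have e2 := E 2 (ltr0n _ 2).
move: e1 e2; rewrite invr1 !mul1r mulrDr mulrA divff ?pnatr_eq0// mul1r.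
by move: ('D_(0, v) A _) ('D_(0, w) A _) (A (x, v)) (A (x, w)) => a b c d; lra.
Qed.

Hypothesis n1 : (0 < n)%N.

Lemma ex_indep x : x != 0 -> exists v, indep x v.
Proof.
move=> x0; have [i xi] := ex_coord_neq0 x0.
exists ('e_(lift i (Ordinal n1))); split=> // b; apply/eqP => e.
have b0 : b = 0.
  move/rowP/(_ i): e; rewrite !mxE eqxx /= (negPf (neq_lift _ _)) => /esym/eqP.
  by rewrite mulf_eq0 (negPf xi) orbF => /eqP.
move/rowP/(_ (lift i (Ordinal n1))): e; rewrite b0 scale0r !mxE !eqxx /= => /eqP.
by rewrite oner_eq0.
Qed.

(** Smoothness of [A] was known only at independent pairs. By linearity [A (y, w)] is a combination
    of the derivatives of [A] at [(y, u)], with a fixed [u] that stays independent of all [y] near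
    [x], so multiples of [x] are covered too. *)
Lemma odd_smooth x v : x != 0 -> smooth_at A (x, v).
Proof.
move=> /ex_indep[u I].
have sA := hatlike_smooth hA I.
have near_x : \forall z \near (x, v), indep z.1 u.
  have c : {for (x, v), continuous (fun z : E * E => (z.1, u))}.
    apply: smooth_at_cont; apply: smooth_at_pair; first exact: smooth_at_fst.
    exact: smooth_at_cst.
  exact: (c (fun z : E * E => indep z.1 z.2) (near_indep I)).
pose B (z : E * E) : R := \sum_j z.2 ord0 j * 'D_(0, 'e_j) A (z.1, u).
have nE : \forall z \near (x, v), B z = A z.
  apply: filterS near_x => -[y w] /= Iy.
  rewrite /B -(odd_linear w Iy) derive_pair_sum; last exact: hatlike_diff.
  apply: eq_bigr => j _; rewrite mxE.
  by apply: etrans (esym (add0r _)) _; congr (_ + _); exact/esym/mul0r.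
apply: (smooth_at_eq nE); apply: smooth_at_sum => j; apply: smooth_atM.
  exact: ((smooth_at_rV _ _).1 (smooth_at_snd _) j).
apply: (smooth_at_comp (f := fun z : E * E => (z.1, u)) (g := 'D_(0, 'e_j) A)) => //.
  by apply: smooth_at_pair; [exact: smooth_at_fst|exact: smooth_at_cst].
exact: smooth_at_derive.
Qed.

Lemma odd_additive x v w : x != 0 -> A (x, v + w) = A (x, v) + A (x, w).
Proof.
move=> /ex_indep[u I]; rewrite -!(odd_linear _ I).
have := derive_lin_snd 1 1 v w (hatlike_diff hA I).
by rewrite !scale1r !mul1r.
Qed.

(** Linearity turns ['D_(0, w) A] into the coefficient [A (_, w)]; Hamel's condition then is the
    symmetry of a closed form. *)
Lemma odd_closed_indep x v w : indep x v ->
  'D_v (fun y => A (y, w)) x = 'D_w (fun y => A (y, v)) x.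
Proof.
move=> I; have <- : 'D_(w, 0) A (x, v) = 'D_w (fun y => A (y, v)) x.
  by apply: derive_line_eq => h; congr (A (_, _)); rewrite /= scaler0 add0r.
rewrite -(HA w I).
have nE : \forall z \near (x, v), 'D_(0, w) A z = A (z.1, w).
  by apply: filterS (near_indep I) => -[y u]; exact: odd_linear.
by rewrite (near_eq_derive _ nE); apply: derive_line_eq => h.
Qed.

Lemma odd_closed x v w : x != 0 -> 'D_v (fun y => A (y, w)) x = 'D_w (fun y => A (y, v)) x.
Proof.
move=> x0; have [vx|] := pselect (forall b : R, v != b *: x).
  exact: odd_closed_indep.
move=> /existsNP[b /negP]; rewrite negbK => /eqP ->.
have [wx|] := pselect (forall b : R, w != b *: x).
  by apply/esym; exact: odd_closed_indep.
move=> /existsNP[c /negP]; rewrite negbK => /eqP ->.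
have dg : differentiable (fun y => A (y, x)) x.
  apply: smooth_at_diff; apply: (smooth_at_comp (f := fun y => (y, x)) (g := A)) => //.
    by apply: smooth_at_pair; [apply: smooth_at_lin; exact: is_diff_id|exact: smooth_at_cst].
  exact: odd_smooth.
have H (a d : R) : 'D_(a *: x) (fun y => A (y, d *: x)) x = d * (a * 'D_x (fun y => A (y, x)) x).
  have -> : (fun y => A (y, d *: x)) = (fun y => d *: A (y, x)) by apply/funext => y; exact: odd_scale.
  have dx : derivable (fun y => A (y, x)) x (a *: x) by exact: diff_derivable.
  by apply: etrans (deriveZ d dx) _; congr (_ * _); exact: deriveZr.
by rewrite !H mulrCA.
Qed.

End OddPart.

(** * Closed forms on the projective space *)

Section Potential.
Context {R : realType} {n : nat}.
Local Notation E := 'rV[R]_n.+1.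
Implicit Types (x v w y o : E).
Variable A : E * E -> R.
Hypothesis n2 : (2 <= n)%N.
Hypothesis sA : forall x v, x != 0 -> smooth_at A (x, v).
Hypothesis closed : forall x v w, x != 0 ->
  'D_v (fun y => A (y, w)) x = 'D_w (fun y => A (y, v)) x.
Hypothesis A_scale : forall (a : R) x v, A (x, a *: v) = a * A (x, v).
Hypothesis A_add : forall x v w, x != 0 -> A (x, v + w) = A (x, v) + A (x, w).
Hypothesis A_inv : forall (a b : R) x v, a != 0 -> x != 0 ->
  A (a *: x, a *: v + b *: x) = A (x, v).

Variable o : E.
Hypothesis o0 : o != 0.

(** The space minus the closed ray opposite to [o]: exactly the points whose segment from [o] avoids
    the origin. [A] need not be smooth at the origin, and the primitive integrates along that
    segment. *)
Let star x : Prop := forall c : R, c <= 0 -> x != c *: o.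

Let starP x : star x <-> forall t : R, t \in `[0, 1] -> o + t *: (x - o) != 0.
Proof.
split=> [S t|H c c0]; last first.
  have c1 : 0 < 1 - c by lra.
  apply/eqP => e; have := H (1 - c)^-1; rewrite in_itv /= invr_ge0 (ltW c1) invf_le1//.
  rewrite (_ : (1 <= 1 - c) = true); last by apply/idP; lra.
  move=> /(_ isT)/eqP; apply; rewrite e; apply/rowP => j; rewrite !mxE.
  by field; rewrite gt_eqF.
rewrite in_itv /= => /andP[t0 t1]; apply/eqP => e.
have [t00|tn0] := eqVneq t 0; first by move/eqP: o0; apply; rewrite -e t00 scale0r addr0.
have tp : 0 < t by rewrite lt_neqAle eq_sym tn0.
have := S (- ((1 - t) / t)); rewrite oppr_le0 divr_ge0//; last by lra.
move=> /(_ isT)/eqP; apply; apply/rowP => j; move/rowP/(_ j): e; rewrite !mxE => e.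
apply: (mulfI tn0); have -> : t * (- ((1 - t) / t) * o 0 j) = - (1 - t) * o 0 j by field.
by move: (o _ _) (x _ _) e => u v e; rewrite -[LHS](subr0) -e; ring.
Qed.

Let near_star x : star x -> \forall y \near x, star y.
Proof.
move=> /starP S.
have near_t (t : R) : t \in `[0, 1] -> \forall z \near (x, t), o + z.2 *: (z.1 - o) != 0.
  move=> t01; have [i ti] := ex_coord_neq0 (S t t01).
  have s1 : smooth_at (fun z : E * R => (o + z.2 *: (z.1 - o)) ord0 i) (x, t).
    apply: (@smooth_at_eq _ _ _ (fun z : E * R => o ord0 i + z.2 * (z.1 ord0 i - o ord0 i))).
      by apply: filterE => z; rewrite !mxE.
    apply: smooth_atD; first exact: smooth_at_cst.
    apply: smooth_atM; first exact: smooth_at_snd.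
    apply: smooth_atB; last exact: smooth_at_cst.
    exact: ((smooth_at_rV _ _).1 (smooth_at_fst _) i).
  by apply: filterS (near_neq0 (smooth_at_cont s1) ti) => z; exact: coord_neq0.
by apply: filterS (tube near_t) => y Hy; apply/starP.
Qed.

Let g (z : E * R) : R := A (o + z.2 *: (z.1 - o), z.1 - o).
Definition potential x : R := integ 0 1 (fun t => g (x, t)).
Let h := potential.

Let sg x (t : R) : o + t *: (x - o) != 0 -> smooth_at g (x, t).
Proof.
move=> X0; pose c (z : E * R) := (o + z.2 *: (z.1 - o), z.1 - o).
apply: (smooth_at_comp (f := c) (g := A)) => //; last exact: sA.
have s1 : smooth_at (fun z : E * R => z.1 - o) (x, t).
  by apply: smooth_atD; [exact: smooth_at_fst|exact: smooth_at_cst].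
apply: smooth_at_pair => //; apply: smooth_atD; first exact: smooth_at_cst.
by apply: smooth_atZ => //; exact: smooth_at_snd.
Qed.

Let sg' x : star x -> forall t : R, t \in `[0, 1] -> smooth_at g (x, t).
Proof. by move=> /starP S t /S; exact: sg. Qed.

Lemma potential_smooth x : star x -> smooth_at h x.
Proof. by move=> /sg' S; apply: smooth_at_integ. Qed.

Let A_fst w x v : x != 0 -> differentiable (fun y => A (y, w)) x /\
  'D_v (fun y => A (y, w)) x = 'D_(v, 0) A (x, w).
Proof.
move=> x0; split.
  apply: smooth_at_diff; apply: (smooth_at_comp (f := fun y => (y, w)) (g := A)) => //; last exact: sA.
  by apply: smooth_at_pair; [apply: smooth_at_lin; exact: is_diff_id|exact: smooth_at_cst].
by apply: derive_line_eq => k; congr (A (_, _)); rewrite /= scaler0 add0r.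
Qed.

Let A_snd x v w : x != 0 -> 'D_(0, w) A (x, v) = A (x, w).
Proof.
move=> x0.
have -> : A (x, w) = 'D_1 (fun s : R => A (x, v) + s * A (x, w)) (0 : R).
  have [_ ->] := is_deriveD (is_derive_cst (A (x, v)) (0 : R) (1 : R))
    (is_derive_mulR (is_derive_id (0 : R) 1) (is_derive_cst (A (x, w)) (0 : R) (1 : R))).
  by rewrite mul0r mul1r !add0r.
apply: derive_line_eq => k; rewrite addr0 /GRing.scale /= mulr1 -A_scale -A_add//.
by congr (A (_, _)); rewrite /= ?scaler0 ?add0r// addrC.
Qed.

(** Poincare's lemma. By closedness the derivative of the integrand along [w] is the derivative in
    [t] of [t * A (X t, w)], which integrates to the value at [t = 1]. *)
Lemma derive_potential x w : star x -> 'D_w h x = A (x, w).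
Proof.
move=> S; have sgx := sg' S.
have D := derive_integ (fdim_rV _) (ler01 : (0 : R) <= 1) w sgx.
apply: etrans D _.
pose X (t : R) := o + t *: (x - o).
pose F (t : R) := t * A (X t, w).
have X0 (t : R) : t \in `[0, 1] -> X t != 0 by move/starP: S; exact.
have dF (t : R) : t \in `[0, 1] -> is_derive t 1 F ('D_(w, 0) g (x, t)).
  move=> t01; have Xt := X0 t t01.
  have -> : 'D_(w, 0) g (x, t) = 'D_(t *: w, w) A (X t, x - o).
    apply: derive_line_eq => k; congr (A (_, _)) => /=; last by rewrite -addrA.
    rewrite scaler0 add0r /X -[k *: w + x - o]addrA scalerDr addrCA.
    by rewrite !scalerA mulrC addrA.
  have dA := smooth_at_diff (sA (x - o) Xt).
  have [dw _] := A_fst w 0 Xt.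
  have dX := is_derive_line o (x - o) t.
  have d1 := is_derive_mulR (is_derive_id t 1) (is_derive_curve dX dw).
  apply: (is_derive_eq d1).
  have E1 := etrans (closed (x - o) w Xt) (A_fst (x - o) w Xt).2.
  apply: etrans (congr2 (fun a b => t * a + b) E1 (etrans (mul1r _) (esym (A_snd (x - o) w Xt)))) _.
  by apply/esym; apply: etrans (derive_split _ _ dA) _; congr (_ + _); exact: derive_fst_scale.
have cdF : cont_on 0 1 (fun t => 'D_(w, 0) g (x, t)).
  by apply: (cont_on_slice (h := 'D_(w, 0) g)) => t t01; apply: smooth_at_derive; exact: sgx.
rewrite (integ_FTC ler01 cdF dF) /F /X mul0r subr0 mul1r scale1r addrC subrK//.
Qed.

Let line_notin x y (t : R) : (forall a b : R, y != a *: x + b *: o) -> (forall c : R, x != c *: o) ->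
  forall c : R, x + t *: (y - x) != c *: o.
Proof.
move=> yS xS c; apply/eqP => e.
have [t0|t0] := eqVneq t 0; first by move/eqP: (xS c); apply; rewrite -e t0 scale0r addr0.
move/eqP: (yS (t^-1 * (t - 1)) (t^-1 * c)); apply; apply: (scalerI t0).
rewrite scalerDr !scalerA !mulrA divff// !mul1r -e.
by apply/rowP => j; rewrite !mxE; ring.
Qed.

Let starN x : (forall c : R, x != c *: o) -> star x /\ star (- x).
Proof.
move=> H; split=> c _ //; apply/eqP => e; move/eqP: (H (- c)); apply.
by rewrite scaleNr -e opprK.
Qed.

Let k x : R := h x - h (- x).

(** The differential of [k] vanishes, because [A] takes the same value at [(z, w)] and [(- z, - w)].
    A point outside the plane of [x] and [o] is joined to [x] by a segment that misses the line of
    [o], on which [h z] or [h (- z)] could be undefined. *)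
Let k_const x y : (forall a b : R, y != a *: x + b *: o) -> (forall c : R, x != c *: o) -> k x = k y.
Proof.
move=> yS xS.
have S (s : R) := starN (line_notin s yS xS).
have opp_lin : linear (fun z : E => - z) by move=> a u v; rewrite opprD scalerN.
have sN z : smooth_at (fun z : E => - z) z by apply: smooth_at_lin => z'; exact: is_diff_fdim.
have sk z : star z -> star (- z) -> smooth_at k z.
  move=> S1 S2; apply: smooth_atB; first exact: potential_smooth.
  apply: (smooth_at_comp (f := fun z => - z) (g := h)) => //; exact: potential_smooth.
have Dk z w : z != 0 -> star z -> star (- z) -> 'D_w k z = 0.
  move=> z0 S1 S2.
  have d1 : derivable h z w by apply: diff_derivable; apply: smooth_at_diff; exact: potential_smooth.
  have s2 : smooth_at (fun z => h (- z)) z.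
    by apply: (smooth_at_comp (f := fun z => - z) (g := h)) => //; exact: potential_smooth.
  have d2 : derivable (fun z => h (- z)) z w by apply: diff_derivable; exact: smooth_at_diff.
  apply: etrans (deriveB d1 d2) _.
  have -> : 'D_w (fun z => h (- z)) z = 'D_(- w) h (- z).
    by apply: derive_line_eq => s; rewrite opprD scalerN.
  rewrite !derive_potential//.
  have := A_inv 0 w (_ : -1 != 0 :> R) z0; rewrite oppr_eq0 oner_eq0 scale0r addr0 !scaleN1r => -> //.
  exact: subrr.
have z0 z : star z -> z != 0 by move=> /(_ 0 (lexx 0)); rewrite scale0r.
have [|s s01] := @MVT_along _ _ k x (y - x) 1 ltr01.
  by move=> s _; have [S1 S2] := S s; apply: smooth_at_diff; exact: sk.
have [S1 S2] := S s; rewrite Dk ?mul0r//; last exact: z0.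
have -> : x + 1 *: (y - x) = y by rewrite scale1r addrCA subrr addr0.
by move=> /eqP; rewrite subr_eq0 => /eqP.
Qed.

Let ex_outside x : exists y, forall a b : R, y != a *: x + b *: o.
Proof.
(* Two vectors do not span a space of dimension [n.+1 >= 3]. *)
have : ~~ (fullv <= <<[:: x; o]>>)%VS.
  apply/negP => /dimvS; rewrite dimvf /dim /= mul1n leqNgt => /negP; apply.
  by apply: leq_ltn_trans (dim_span _) _.
move=> /subvPn[y _ yS]; exists y => a b; apply: contraNneq yS => ->.
by rewrite memvD// memvZ// memv_span// !inE eqxx ?orbT.
Qed.

(** Through a point [y] outside the plane of [x] and [o], [k x = k y = k (- x)]. Since
    [k (- x) = - k x] by definition, [k x = 0]. *)
Lemma potential_even x : star x -> star (- x) -> h (- x) = h x.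
Proof.
move=> S1 S2.
have xS c : x != c *: o.
  have [c0|c0] := leP c 0; first exact: S1.
  have nc : - c <= 0 by rewrite oppr_le0 ltW.
  by apply/eqP => e; move/eqP: (S2 _ nc); apply; rewrite e scaleNr.
have [y yS] := ex_outside x.
have NyS a b : y != a *: - x + b *: o by rewrite scalerN -scaleNr; exact: yS.
have NxS c : - x != c *: o.
  by apply/eqP => e; move/eqP: (xS (- c)); apply; rewrite scaleNr -e opprK.
have := etrans (k_const yS xS) (esym (k_const NyS NxS)).
by rewrite /k opprK; lra.
Qed.

Let star_scale (a : R) x : 0 < a -> star x -> star (a *: x).
Proof.
move=> a0 S c c0; apply/eqP => e.
have ac : a^-1 * c <= 0 by rewrite pmulr_rle0 ?invr_gt0.
move/eqP: (S _ ac); apply.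
by rewrite -scalerA -e scalerA mulVf ?scale1r// gt_eqF.
Qed.

(** The form vanishes on radial directions, by its invariance under adding a multiple of the point
    to the direction. *)
Let potential_scale1 (a : R) x : 1 < a -> star x -> h (a *: x) = h x.
Proof.
move=> a1 S; have a0 : 0 < a - 1 by rewrite subr_gt0.
have e (s : R) : x + s *: x = (1 + s) *: x by rewrite scalerDl scale1r.
have Ss (s : R) : s \in `[0, a - 1] -> star (x + s *: x).
  by rewrite in_itv /= e => /andP[s0 _]; apply: star_scale => //; lra.
have [|s sI] := @MVT_along _ _ h x x (a - 1) a0.
  by move=> s /Ss Sx; apply: smooth_at_diff; exact: potential_smooth.
have x0 : x != 0 by have := S 0 (lexx 0); rewrite scale0r.
have s1 : 1 + s != 0 by move: sI; rewrite in_itv /= => /andP[? _]; apply/eqP; lra.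
rewrite derive_potential; last exact: Ss.
rewrite !e; have := A_inv (1 : R) 0 s1 x0.
rewrite scaler0 add0r scale1r => ->.
have A0 : A (x, 0) = 0 by have := A_scale 0 x 0; rewrite scale0r mul0r.
have -> : 1 + (a - 1) = a by rewrite addrCA subrr addr0.
by rewrite A0 mul0r => /eqP; rewrite subr_eq0 => /eqP.
Qed.

Lemma potential_scale (a : R) x : 0 < a -> star x -> h (a *: x) = h x.
Proof.
move=> a0 S; have [a1|a1|<-] := ltgtP 1 a; last by rewrite scale1r.
  exact: potential_scale1.
have ai : 1 < a^-1 by rewrite invf_gt1.
have := potential_scale1 ai (star_scale a0 S).
by rewrite scalerA mulVf ?gt_eqF// scale1r => ->.
Qed.

Let star_or x : x != 0 -> star x \/ star (- x).
Proof.
move=> x0; have [S|] := pselect (star x); first by left.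
move=> /existsNP[c /not_implyP[c0 /negP]]; rewrite negbK => /eqP e; right => d d0.
apply/eqP => e'; have : (c + d) *: o = 0 by rewrite scalerDl -e -e' subrr.
move=> /eqP; rewrite scaler_eq0 (negPf o0) orbF => /eqP cd.
have c00 : c = 0 by lra.
by move/eqP: x0; apply; rewrite e c00 scale0r.
Qed.

(** At least one of [x] and [- x] lies in the domain of [h]. Where both do, [potential_even] shows
    that the choice does not matter. *)
Definition descended (p : RP R n) : R :=
  let x := val (repr p) in if `[< star x >] then h x else h (- x).

Lemma descended_ph x : star x -> descended (ph x) = h x.
Proof.
move=> S; have x0 : x != 0 by have := S 0 (lexx 0); rewrite scale0r.
rewrite /descended /ph; have [a a0 ->] := repr_pi_RP (nzv x); rewrite nzvK//.
have [S'|S'] := asboolP (star (a *: x)).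
  have [ap|an|a00] := ltgtP a 0; last by rewrite a00 eqxx in a0.
    rewrite -potential_even//; last first.
      by rewrite -scaleNr; apply: star_scale => //; rewrite oppr_gt0.
    by rewrite -scaleNr potential_scale// oppr_gt0.
  exact: potential_scale.
have [ap|an|a00] := ltgtP a 0; last by rewrite a00 eqxx in a0.
  by rewrite -scaleNr potential_scale// oppr_gt0.
by exfalso; apply: S'; exact: star_scale.
Qed.

Lemma descended_chart i (y w : 'rV[R]_n) : smooth_at (descended \o chart_point i) y /\
  'D_w (descended \o chart_point i) y = A (insert i 1 y, insert i 0 w).
Proof.
pose x := insert i 1 y; have x0 : x != 0 by exact: insert1_neq0.
(* The sign [e] puts the chart's representative into the domain of [h]; that domain is open, so one
   sign works near [y]. *)
have [e [e2 S]] : exists e : R, e ^+ 2 = 1 /\ star (e *: x).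
  by have [S|S] := star_or x0; [exists 1|exists (-1)]; rewrite ?scale1r ?scaleN1r ?sqrrN expr1n.
have e0 : e != 0 by apply/eqP => e0; move: e2; rewrite e0 expr0n /= => /eqP; rewrite eq_sym oner_eq0.
have sx : smooth_at (fun y' : 'rV[R]_n => e *: insert i 1 y') y.
  apply: smooth_atZ => //; first exact: smooth_at_cst.
  by apply: smooth_at_insert; apply: smooth_at_lin; exact: is_diff_id.
have nE : \forall y' \near y, h (e *: insert i 1 y') = (descended \o chart_point i) y'.
  have nS : \forall y' \near y, star (e *: insert i 1 y') by exact: (smooth_at_cont sx (near_star S)).
  apply: filterS nS => y' S'; rewrite /= chart_pointE -(ph_eq e0) ?insert1_neq0//.
  by rewrite descended_ph.
have sh : smooth_at (fun y' : 'rV[R]_n => h (e *: insert i 1 y')) y.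
  by apply: (smooth_at_comp (f := fun y' : 'rV[R]_n => e *: insert i 1 y') (g := h)) => //; exact: potential_smooth.
split; first exact: smooth_at_eq sh.
rewrite -(near_eq_derive _ nE).
have -> : 'D_w (fun y' : 'rV[R]_n => h (e *: insert i 1 y')) y = 'D_(e *: insert i 0 w) h (e *: x).
  apply: derive_line_eq => s; congr (h _).
  by rewrite scalerA mulrC -scalerA -scalerDr -insert_lin mulr0 add0r.
rewrite derive_potential//.
by have := A_inv 0 (insert i 0 w) e0 x0; rewrite scale0r addr0.
Qed.

End Potential.

(** * The even part is a projective Finsler metric *)

Lemma hess_sqr_gt0 {R : realType} (d a h : R) : 0 < a -> 0 < h \/ h = 0 /\ d != 0 ->
  0 < 2 * d ^+ 2 + 2 * a * h.
Proof.
move=> a0 [h0|[-> d0]].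
  have d2 : 0 <= d ^+ 2 by exact: sqr_ge0.
  have ah : 0 < a * h by exact: mulr_gt0.
  by lra.
by rewrite mulr0 addr0 mulr_gt0// exprn_even_gt0.
Qed.

Lemma half_sum_gt0 {R : realType} (a b b' : R) : 0 < a -> 0 < b -> b' = b ->
  0 < 2^-1 * a + 2^-1 * b'.
Proof. by move=> a0 b0 ->; rewrite addr_gt0// mulr_gt0// invr_gt0. Qed.

Lemma pos_factor {R : realType} (a b : R) : 0 < a -> 0 < 2 * 0 ^+ 2 + 2 * a * b -> 0 < b.
Proof. by move=> a0; rewrite expr0n /= mulr0 add0r pmulr_rgt0// mulr_gt0. Qed.

Section SecondVariation.
Context {R : realType} {V W : normedModType R}.
Variables (f : V * W -> R) (y : V) (w : W).
Hypothesis hom : forall (a : R) (y' : V) (w' : W), 0 < a -> f (y', a *: w') = a * f (y', w').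
Hypothesis sf : forall a : R, 0 < a -> smooth_at f (y, a *: w).
Hypothesis fpos : 0 < f (y, w).

Let s1 : smooth_at f (y, w).
Proof. by have := sf ltr01; rewrite scale1r. Qed.

Let eu0 xi : 'D_(0, w) ('D_(0, xi) f) (y, w) = 0.
Proof. by apply: euler0 => // a a0; apply: smooth_at_diff; exact: sf. Qed.

Let Dd u : differentiable ('D_u f) (y, w).
Proof. by apply: smooth_at_diff; exact: smooth_at_derive. Qed.

Lemma derive_derive_sqr (u : V * W) : 'D_u ('D_u (fun z => f z ^+ 2)) (y, w) =
  2 * 'D_u f (y, w) ^+ 2 + 2 * f (y, w) * 'D_u ('D_u f) (y, w).
Proof.
have nE : \forall z \near (y, w), 'D_u (fun z => f z ^+ 2) z = 2 * (f z * 'D_u f z).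
  by apply: filterS (near_smooth_at s1) => z /smooth_at_diff dz; rewrite derive_sqr// mulrA.
rewrite (near_eq_derive _ nE).
have df := smooth_at_diff s1.
have d1 : derivable f (y, w) u by exact: diff_derivable.
have d2 : derivable ('D_u f) (y, w) u by exact: diff_derivable.
have d3 : derivable (f * 'D_u f) (y, w) u := derivableM d1 d2.
apply: etrans (deriveZ 2 d3) _; have := deriveM d1 d2.
rewrite /GRing.scale /= => ->; rewrite expr2.
by move: ('D_u ('D_u f) _) ('D_u f _) (f _) => a b c; ring.
Qed.

(* Removing from [v] its component along [w], on which [f] is linear, leaves a
   direction in which the first derivative vanishes; there the Hessian of
   [f ^ 2] is [2 f] times that of [f]. *)
Lemma second_derivative_gt0 (v : W) :
  (forall a : R, 0 < 'D_(0, v - a *: w) ('D_(0, v - a *: w) (fun z => f z ^+ 2)) (y, w)) ->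
  0 < 'D_(0, v) ('D_(0, v) f) (y, w).
Proof.
pose a := 'D_(0, v) f (y, w) / f (y, w).
have df := smooth_at_diff s1.
have e : v - a *: w = 1 *: v + (- a) *: w by rewrite scale1r scaleNr.
move=> /(_ a); rewrite derive_derive_sqr.
have e1 : 'D_(0, v - a *: w) f (y, w) = 0.
  rewrite e; apply: etrans (derive_lin_snd 1 (- a) v w df) _.
  have Ew : 'D_(0, w) f (y, w) = f (y, w) by apply: euler; exact: hom.
  by rewrite Ew mul1r mulNr /a divfK ?subrr// gt_eqF.
have e2 : 'D_(0, v - a *: w) ('D_(0, v - a *: w) f) (y, w) = 'D_(0, v) ('D_(0, v) f) (y, w).
  have nE : \forall z \near (y, w), 'D_(0, v - a *: w) f z = 1 * 'D_(0, v) f z + - a * 'D_(0, w) f z.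
    by apply: filterS (near_smooth_at s1) => z /smooth_at_diff dz; rewrite e; exact: derive_lin_snd.
  rewrite (near_eq_derive _ nE) derive_comb// mul1r.
  rewrite (schwarz (0, v - a *: w) (0, w) s1) eu0 mulr0 addr0.
  rewrite (schwarz (0, v - a *: w) (0, v) s1).
  rewrite (near_eq_derive _ nE) derive_comb// mul1r.
  by rewrite (schwarz (0, v) (0, w) s1) eu0 mulr0 addr0.
by rewrite e1 e2; exact: pos_factor.
Qed.

End SecondVariation.

Section EvenPart.
Context {R : realType} {n : nat}.
Local Notation E := 'rV[R]_n.+1.
Local Notation V := 'rV[R]_n.
Variable L : TRP R n -> R.
Hypothesis FL : Finsler L.

Definition even_part (u : TRP R n) : R :=
  let z := (val (repr u).1, (repr u).2) in (hat L z + refl (hat L) z) / 2.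
Let F := even_part.

Lemma hat_even_part : hat F = (fun z => 2^-1 * hat L z + 2^-1 * refl (hat L) z).
Proof.
suff H x v : x != 0 -> hat F (x, v) = 2^-1 * hat L (x, v) + 2^-1 * refl (hat L) (x, v).
  apply/funext => -[x v]; have := H _ v (svalP (nzv x)).
  by rewrite /refl /hat /= -!th_nzv.
move=> x0; rewrite {1}/hat /F /even_part /=.
have /asboolP[a a0 /= [e1 [b e2]]] := repr_pi_TRP (nzv x, v).
rewrite -/(th x v) in e1 e2; rewrite e1 e2 nzvK// /refl /=.
rewrite hat_inv// opprD -scalerN -scaleNr hat_inv//.
by rewrite mulrDl ![_ / 2]mulrC.
Qed.

Lemma insertN i (w : V) : insert i 0 (- w) = - insert i (0 : R) w.
Proof. by apply/rowP => j; rewrite !mxE; case: unliftP => [k _|_]; rewrite ?mxE ?oppr0. Qed.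

Lemma even_part_chart i (y w : V) :
  F (chart_vec i y w) = 2^-1 * L (chart_vec i y w) + 2^-1 * L (chart_vec i y (- w)).
Proof. by rewrite -!hat_insert hat_even_part /refl /= -insertN. Qed.

Lemma even_part_reversible : reversible F.
Proof. by move=> i y w; rewrite !even_part_chart opprK addrC. Qed.

Let sL i (y w : V) : w != 0 -> smooth_at (chartfun L i) (y, w).
Proof. exact: chartfun_smooth. Qed.

Let sF i (y w : V) : w != 0 -> smooth_at (chartfun F i) (y, w).
Proof.
move=> w0; pose m (z : V * V) := (z.1, - z.2).
apply: (@smooth_at_eq _ _ _ (fun z => 2^-1 * chartfun L i z + 2^-1 * chartfun L i (m z))).
  by apply: filterE => z; rewrite /chartfun even_part_chart.
apply: smooth_atD; apply: smooth_atM; [exact: smooth_at_cst|exact: sL|exact: smooth_at_cst|].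
apply: (smooth_at_comp (f := m) (g := chartfun L i)) => //.
  apply: smooth_at_pair; first exact: smooth_at_fst.
  by apply: (smooth_at_linl (f := snd) (l := -%R)); last exact: smooth_at_snd.
by apply: sL; rewrite oppr_eq0.
Qed.

Lemma derive2_chartfun (M : TRP R n -> R) i (y w v : V) :
  'D_(0, v) ('D_(0, v) (fun z => chartfun M i z ^+ 2)) (y, w) =
  'D_v ('D_v (fun w' => M (chart_vec i y w') ^+ 2)) w.
Proof.
have line (h : R) w' : h *: (0 : V, v) + (y, w') = (y, h *: v + w').
  by congr pair; rewrite /= ?scaler0 ?add0r.
have D1 w' : 'D_(0, v) (fun z => chartfun M i z ^+ 2) (y, w') =
    'D_v (fun w' => M (chart_vec i y w') ^+ 2) w'.
  by apply: derive_line_eq => h; rewrite line.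
by apply: derive_line_eq => h; rewrite line D1.
Qed.

Let L_pos i (y w : V) : w != 0 -> 0 < L (chart_vec i y w).
Proof.
move=> w0; apply: (Finsler_pos FL); rewrite chart_vecE.
by apply/indep_zero; [exact: insert1_neq0|exact: indep_insert].
Qed.

Let L_second i (y w v : V) : w != 0 -> (forall a : R, v != a *: w) ->
  0 < 'D_(0, v) ('D_(0, v) (chartfun L i)) (y, w).
Proof.
move=> w0 vw; apply: second_derivative_gt0.
- by move=> a y' w' a0; apply: (Finsler_homog FL); exact: ltW.
- by move=> a a0; apply: sL; rewrite scaler_eq0 negb_or gt_eqF.
- exact: L_pos.
by move=> a; rewrite derive2_chartfun; apply: (Finsler_convex FL) => //; rewrite subr_eq0.
Qed.

(** Reflection of the direction preserves second vertical derivatives, so this is half the sum of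
    two positive values, those of [L] at [w] and at [- w]. *)
Let F_second i (y w v : V) : w != 0 -> (forall a : R, v != a *: w) ->
  0 < 'D_(0, v) ('D_(0, v) (chartfun F i)) (y, w).
Proof.
move=> w0 vw; pose m (z : V * V) := (z.1, - z.2).
have Nw0 : - w != 0 by rewrite oppr_eq0.
have -> : chartfun F i = (fun z => 2^-1 * chartfun L i z + 2^-1 * chartfun L i (m z)).
  by apply/funext => z; rewrite /chartfun even_part_chart.
have Dm p z (G : V * V -> R) : 'D_p (G \o m) z = 'D_(m p) G (m z).
  by apply: derive_line_eq => h; congr (G (_, _)); rewrite /= opprD scalerN.
have sm (w' : V) : w' != 0 -> smooth_at (chartfun L i \o m) (y, w').
  move=> w'0; apply: (smooth_at_comp (f := m) (g := chartfun L i)) => //.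
    apply: smooth_at_pair; first exact: smooth_at_fst.
    by apply: (smooth_at_linl (f := snd) (l := -%R)); last exact: smooth_at_snd.
  by apply: sL; rewrite oppr_eq0.
have nE : \forall z \near (y, w), 'D_(0, v) (fun z => 2^-1 * chartfun L i z + 2^-1 * chartfun L i (m z)) z =
    2^-1 * 'D_(0, v) (chartfun L i) z + 2^-1 * 'D_(0, v) (chartfun L i \o m) z.
  apply: filterS2 (near_smooth_at (sL i y w0)) (near_smooth_at (sm w w0)) => z h1 h2.
  by apply: derive_comb; exact: smooth_at_diff.
rewrite (near_eq_derive _ nE) derive_comb; last 2 first.
- by apply: smooth_at_diff; apply: smooth_at_derive; exact: sL.
- by apply: smooth_at_diff; apply: smooth_at_derive; exact: sm.
have -> : 'D_(0, v) (chartfun L i \o m) = 'D_(m (0, v)) (chartfun L i) \o m.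
  by apply/funext => z; rewrite Dm.
have m0 : m (0, v) = - (0, v) by congr pair; rewrite /= oppr0.
have E2 := Dm (0, v) (y, w) ('D_(m (0, v)) (chartfun L i)).
have E3 := derive_derive_opp (0, v) (sL i y Nw0).
have P1 := L_second i y w0 vw.
have vNw (a : R) : v != a *: - w.
  by apply/eqP => e; move/eqP: (vw (- a)); apply; rewrite e scalerN scaleNr.
have P2 := L_second i y Nw0 vNw.
rewrite m0 in E2; rewrite m0; exact: half_sum_gt0 P1 P2 (etrans E2 E3).
Qed.

Let F_pos i (y w : V) : w != 0 -> 0 < F (chart_vec i y w).
Proof.
move=> w0; rewrite even_part_chart.
by rewrite addr_gt0// mulr_gt0 ?invr_gt0 ?L_pos// oppr_eq0.
Qed.

Let F_hom i (y w : V) (a : R) : 0 <= a -> F (chart_vec i y (a *: w)) = a * F (chart_vec i y w).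
Proof.
move=> a0; rewrite !even_part_chart -scalerN !(Finsler_homog FL)// mulrDr.
by rewrite ![a * (_ * _)]mulrCA.
Qed.

(** For convexity, the second derivative of [F ^ 2] is [2 (F')^2 + 2 F F'']. If [v] is not a
    multiple of [w], then [F''] is positive; if [v = a w], then [F'' = 0] but [F' = a F] is
    nonzero. *)
Lemma even_part_Finsler : Finsler F.
Proof.
split.
- by move=> i y w w0; exact: sF.
- move=> u; have [x [v [x0 ->]]] := TRP_th u; move=> /(indep_zero _ x0) I.
  have [i xi] := ex_coord_neq0 x0; rewrite (th_chart v xi).
  by apply: F_pos; exact: indep_dehomv.
- by move=> i y w a; exact: F_hom.
move=> i y w v w0 v0; rewrite -derive2_chartfun.
have hom (a : R) (y' w' : V) : 0 < a -> chartfun F i (y', a *: w') = a * chartfun F i (y', w').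
  by move=> a0; apply: F_hom; exact: ltW.
have s1 (a : R) : 0 < a -> smooth_at (chartfun F i) (y, a *: w).
  by move=> a0; apply: sF; rewrite scaler_eq0 negb_or gt_eqF.
rewrite (derive_derive_sqr s1).
have Fw : 0 < chartfun F i (y, w) by exact: F_pos.
have [vw|] := pselect (forall a : R, v != a *: w).
  by apply: (hess_sqr_gt0 Fw); left; exact: F_second.
move=> /existsNP[a /negP]; rewrite negbK => /eqP e.
have a0 : a != 0 by apply: contraNneq v0 => a0; rewrite e a0 scale0r.
have df : differentiable (chartfun F i) (y, w) by apply: smooth_at_diff; exact: sF.
have D1 : 'D_(0, v) (chartfun F i) (y, w) = a * chartfun F i (y, w).
  have Ew : 'D_(0, w) (chartfun F i) (y, w) = chartfun F i (y, w) by apply: euler; exact: hom.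
  by rewrite e; apply: etrans (derive_snd_scale a w df) _; rewrite Ew.
have D2 : 'D_(0, v) ('D_(0, v) (chartfun F i)) (y, w) = 0.
  have dd : differentiable ('D_(0, v) (chartfun F i)) (y, w).
    by apply: smooth_at_diff; apply: smooth_at_derive; exact: sF.
  have H := derive_snd_scale a w dd; rewrite -e in H; apply: etrans H _.
  rewrite (euler0 (f := chartfun F i) (y := y) (w := w)) ?mulr0// => b b0.
  by apply: smooth_at_diff; exact: s1.
apply: (hess_sqr_gt0 Fw); right; split; first exact: D2.
by rewrite D1; apply: (mulf_neq0 a0); exact: lt0r_neq0 Fw.
Qed.

Lemma even_part_hamel : projective L -> hamel (hat F).
Proof.
move=> PL; rewrite hat_even_part.
have hL := hat_hatlike FL; have HL := hat_hamel FL PL.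
by apply: hamel_comb => //; [exact: hatlike_refl|exact: hamel_refl].
Qed.

End EvenPart.

Lemma near_comp {T U : topologicalType} (z : T -> U) (t : T) (P : U -> Prop) :
  {for t, continuous z} -> (\forall y \near z t, P y) -> \forall s \near t, P (z s).
Proof. by move=> cz H; apply: cz. Qed.

Section Moving.
Context {R : realType} {n : nat}.
Local Notation E := 'rV[R]_n.
Variable G : E * E -> R.

Lemma derive_snd_sum z (v : E) : differentiable G z ->
  'D_(0, v) G z = \sum_j v ord0 j * 'D_(0, 'e_j) G z.
Proof.
move=> dG; rewrite derive_pair_sum//; apply: eq_bigr => j _; rewrite mxE.
by apply: etrans (add0r _); congr (_ + _); exact: mul0r.
Qed.

(** Both the direction of differentiation and the base point move; in coordinates this is the
    product rule. *)
Lemma is_derive_moving (m : R -> E) (z : R -> E * E) (t : R) m' z' :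
  smooth_at G (z t) -> is_derive t 1 m m' -> is_derive t 1 z z' ->
  is_derive t 1 (fun s => 'D_(0, m s) G (z s))
    ('D_(0, m') G (z t) + 'D_z' ('D_(0, m t) G) (z t)).
Proof.
move=> sG dm dz.
have cz : {for t, continuous z}.
  by have [d _] := dz; apply: differentiable_continuous; apply/derivable1_diffP.
have nE : \forall s \near t, \sum_j m s ord0 j * 'D_(0, 'e_j) G (z s) = 'D_(0, m s) G (z s).
  have : \forall s \near t, smooth_at G (z s).
    by apply: (near_comp (P := fun y => smooth_at G y) cz); exact: near_smooth_at sG.
  by apply: filterS => s /smooth_at_diff dG; rewrite derive_snd_sum.
have dj j : differentiable ('D_(0, 'e_j) G) (z t).
  by apply: smooth_at_diff; exact: smooth_at_derive.
have dS : is_derive t (1 : R) (fun s => \sum_j m s ord0 j * 'D_(0, 'e_j) G (z s))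
    (\sum_j (m t ord0 j * 'D_z' ('D_(0, 'e_j) G) (z t) + m' ord0 j * 'D_(0, 'e_j) G (z t))).
  apply: is_derive_sumR => j.
  exact: is_derive_mulR (is_derive_coord j dm) (is_derive_curve dz (dj j)).
have e : 'D_z' ('D_(0, m t) G) (z t) = \sum_j m t ord0 j * 'D_z' ('D_(0, 'e_j) G) (z t).
  have nE' : \forall y \near z t, 'D_(0, m t) G y = \sum_j m t ord0 j * 'D_(0, 'e_j) G y.
    by apply: filterS (near_smooth_at sG) => y /smooth_at_diff; exact: derive_snd_sum.
  rewrite (near_eq_derive _ nE').
  have dd j : derivable (fun y => m t ord0 j * 'D_(0, 'e_j) G y) (z t) z'.
    by apply: derivableZ; exact: diff_derivable.
  have := derive_sum dd; rewrite fct_sumE => ->; apply: eq_bigr => j _.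
  have dj' : derivable ('D_(0, 'e_j) G) (z t) z' by exact: diff_derivable.
  exact: (deriveZ (m t ord0 j) dj').
have := near_eq_is_derive nE dS.
congr is_derive; rewrite e derive_snd_sum; last exact: smooth_at_diff.
by rewrite -big_split; apply: eq_bigr => j _ /=; exact: addrC.
Qed.

Lemma smooth_at_moving (u m : R -> E) (z : R -> E * E) (t : R) :
  smooth_at G (z t) -> smooth_at u t -> smooth_at m t -> smooth_at z t ->
  smooth_at (fun s => 'D_(u s, m s) G (z s)) t.
Proof.
move=> sG su sm sz.
have nE : \forall s \near t, \sum_j (u s ord0 j * 'D_('e_j, 0) G (z s) +
    m s ord0 j * 'D_(0, 'e_j) G (z s)) = 'D_(u s, m s) G (z s).
  have : \forall s \near t, smooth_at G (z s).
    apply: (near_comp (P := fun y => smooth_at G y)); first exact: smooth_at_cont.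
    exact: near_smooth_at sG.
  by apply: filterS => s /smooth_at_diff dG; rewrite derive_pair_sum.
apply: (smooth_at_eq nE); apply: smooth_at_sum => j.
have sD p : smooth_at (fun s => 'D_p G (z s)) t.
  by apply: (smooth_at_comp (f := z) (g := 'D_p G)) => //; exact: smooth_at_derive.
by apply: smooth_atD; apply: smooth_atM => //;
  [exact: ((smooth_at_rV _ _).1 su j)|exact: ((smooth_at_rV _ _).1 sm j)].
Qed.

End Moving.

Lemma smooth_at_id {R : realType} {U : normedModType R} (x : U) : smooth_at (fun y : U => y) x.
Proof. by apply: (smooth_at_lin (l := fun y : U => y)) => y; exact: is_diff_id. Qed.

(** * The fundamental lemma of the calculus of variations *)

Section FundamentalLemma.
Context {R : realType}.
Variables (a b : R) (f : R -> R).
Hypotheses (ab : a < b) (cf : cont_on a b f).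
Hypothesis f_test : forall eta : R -> R, (forall t : R, smooth_at eta t) ->
  eta a = 0 -> eta b = 0 -> integ a b (fun t => f t * eta t) = 0.

(* The test functions (t - a) (b - t) (1 - ((t - t0) / (b - a)) ^ 2) ^ k
   concentrate at t0, so no bump function is needed. *)
Let inner (t0 : R) : t0 \in `]a, b[ -> f t0 = 0.
Proof.
move=> t0ab; move: (t0ab); rewrite in_itv /= => /andP[at0 t0b].
pose w (t : R) : R := (t - a) * (b - t).
pose p (t : R) : R := 1 - ((t - t0) / (b - a)) ^+ 2.
have ba : 0 < b - a by rewrite subr_gt0.
have sid (r : R) : smooth_at (fun t : R => t) r by exact: smooth_at_id.
have sc (k r : R) : smooth_at (fun _ : R => k) r by exact: smooth_at_cst.
have sw (r : R) : smooth_at w r := smooth_atM (smooth_atB (sid r) (sc a r)) (smooth_atB (sc b r) (sid r)).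
have sq (r : R) : smooth_at (fun t => (t - t0) / (b - a)) r.
  exact: smooth_atM (smooth_atB (sid r) (sc t0 r)) (sc _ r).
have sp (r : R) : smooth_at p r := smooth_atB (sc 1 r) (smooth_at_sqr (sq r)).
have spk k (r : R) : smooth_at (fun t => p t ^+ k) r.
  elim: k => [|k IH]; first by under eq_fun do rewrite expr0; exact: smooth_at_cst.
  by under eq_fun do rewrite exprS; exact: smooth_atM.
have pt0 : p t0 = 1 by rewrite /p subrr mul0r expr0n subr0.
apply: (concentration (a := a) (b := b) (g := f) (w := w) (p := p)) => //.
- by move=> t _; exact: smooth_at_cont.
- by move=> t _; exact: smooth_at_cont.
- by move=> t; rewrite in_itv /= => /andP[h1 h2]; rewrite mulr_ge0 ?subr_ge0.
- by move=> t; rewrite in_itv /= => /andP[h1 h2]; rewrite mulr_gt0 ?subr_gt0.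
- move=> t; rewrite in_itv /= => /andP[h1 h2].
  have h3 : -1 <= (t - t0) / (b - a) by rewrite ler_pdivlMr//; lra.
  have h4 : (t - t0) / (b - a) <= 1 by rewrite ler_pdivrMr//; lra.
  by rewrite /p; move: (_ / _) h3 h4 => q h3 h4; nra.
- move=> t _ tt0; rewrite pt0 /p.
  have : 0 < ((t - t0) / (b - a)) ^+ 2.
    by rewrite exprn_even_gt0//= mulf_neq0 ?invr_neq0 ?subr_eq0// gt_eqF.
  by lra.
move=> k; apply: (f_test (eta := fun t => w t * p t ^+ k)).
- by move=> t; apply: smooth_atM.
- by rewrite /w subrr !mul0r.
- by rewrite /w subrr mulr0 mul0r.
Qed.

Lemma fundamental_lemma (t : R) : t \in `[a, b] -> f t = 0.
Proof.
move=> tab; apply: contrapT => /eqP ft.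
have [e e0 He] := near_ball_cc (near_neq0 (cf tab) ft).
(* A nonzero value at an end point persists at distance [m]. The bound [(b - a) / 4] keeps the
   shifted point inside the open interval, where [inner] applies. *)
pose m := Num.min e ((b - a) / 4).
have m0 : 0 < m by rewrite lt_min e0 divr_gt0// subr_gt0.
have m1 : m <= e by rewrite ge_min lexx.
have m2 : m <= (b - a) / 4 by rewrite ge_min lexx orbT.
move: tab; rewrite in_itv /= => /andP[ta tb].
move: m m0 m1 m2 => m m0 m1 m2.
have [h|h] := leP t ((a + b) / 2).
  have : f (t + m) != 0 by apply: He; rewrite in_itv /=; lra.
  by rewrite inner ?eqxx// in_itv /=; lra.
have : f (t - m) != 0 by apply: He; rewrite in_itv /=; lra.
by rewrite inner ?eqxx// in_itv /=; lra.
Qed.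

End FundamentalLemma.

Lemma zero_ends {R : realType} (x y u v : R) : x = 0 -> y = 0 -> x * u - y * v = 0.
Proof. by move=> -> ->; rewrite !mul0r subrr. Qed.

Lemma test_alg {R : realType} (e e' P Q Q' : R) :
  e * P + e' * Q - (e * Q' + e' * Q) = (P - Q') * e.
Proof. by ring. Qed.

Lemma geodesic_alg {R : realType} (p1 p2 q2 q3 P d : R) :
  P = p1 + p2 -> d = q2 + q3 -> q2 = p1 -> P - (p2 + d) = - q3.
Proof. by move=> -> -> ->; ring. Qed.

(** * Acceleration of geodesics under Hamel's condition *)

Section Geodesics.
Context {R : realType} {n : nat}.
Local Notation E := 'rV[R]_n.+1.
Variables (F : TRP R n -> R) (a b : R) (c : R -> RP R n).
Hypotheses (FF : Finsler F) (HF : hamel (hat F)) (ab : a < b).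
Hypothesis c_geo : geodesic F a b c.
Let G := hat F.
Let hG : hatlike G. Proof. exact: hat_hatlike. Qed.

Let c_smooth (t : R) : t \in `[a, b] -> smooth_map_at c t.
Proof. by case: c_geo => H _ _; exact: H. Qed.

Let c_reg (t : R) : t \in `[a, b] -> ~ zero_section (velocity c t).
Proof. by case: c_geo => _ H _; exact: H. Qed.

Definition lift_at (t : R) (X : R -> E) : Prop :=
  [/\ smooth_at X t, indep (X t) ('D_1 X t) & \forall s \near t, c s = ph (X s)].

Lemma lift_velocity t X : lift_at t X -> velocity c t = th (X t) ('D_1 X t).
Proof.
move=> [sX [X0 _] cX]; apply: velocity_lift => //; apply: DeriveDef => //.
by apply: diff_derivable; exact: smooth_at_diff.
Qed.

Let sD1 t (X : R -> E) : smooth_at X t -> smooth_at ('D_1 X) t.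
Proof. exact: smooth_at_derive. Qed.

Let sdX t (X : R -> E) : smooth_at X t -> smooth_at (fun s => (X s, 'D_1 X s)) t.
Proof. by move=> sX; apply: smooth_at_pair => //; exact: smooth_at_derive. Qed.

Lemma near_lift t X : lift_at t X -> \forall s \near t, lift_at s X.
Proof.
move=> [sX I cX].
have nI : \forall s \near t, indep (X s) ('D_1 X s).
  apply: (near_comp (z := fun s => (X s, 'D_1 X s)) (P := fun z => indep z.1 z.2)).
    exact: smooth_at_cont (sdX sX).
  exact: near_indep.
by apply: filterS3 (near_smooth_at sX) nI (nbhs_interior cX).
Qed.

(** Only local lifts are used. The one from a chart has [i]-th coordinate 1, so its derivatives have
    [i]-th coordinate 0. *)
Lemma ex_lift t : t \in `[a, b] -> exists i (y : R -> 'rV[R]_n),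
  smooth_at y t /\ lift_at t (fun s => insert i 1 (y s)).
Proof.
move=> tab; pose i := chart_at (c t); pose y := Defs.coord i \o c.
have [sy cy] := lift_smooth_map (c_smooth tab) (in_chart_at (c t)).
exists i, y; split=> //.
have sX : smooth_at (fun s => insert i 1 (y s)) t by exact: smooth_at_insert.
split=> //; apply/indep_zero; first exact: insert1_neq0.
have dX : is_derive t 1 (fun s => insert i 1 (y s)) ('D_1 (fun s => insert i 1 (y s)) t).
  by apply: DeriveDef => //; apply: diff_derivable; exact: smooth_at_diff.
by rewrite -(velocity_lift (insert1_neq0 i (y t)) dX cy); exact: c_reg.
Qed.

Section Direction.
Variable B : 'M[R]_n.+1.

Let rx (u : TRP R n) : E := val (repr u).1.
Let rv (u : TRP R n) : E := (repr u).2.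

(** [P] and [Q] are the coefficients of [eta] and [eta'] in the first variation. They are read off
    any representative of the velocity, so they are defined along the whole curve although lifts are
    only local. *)
Let Q (t : R) : R := 'D_(0, rx (velocity c t) *m B) G (rx (velocity c t), rv (velocity c t)).
Let P (t : R) : R := 'D_(rx (velocity c t) *m B, rv (velocity c t) *m B) G
  (rx (velocity c t), rv (velocity c t)).

(** The field [x *m B] is linear, so changing [(x, v)] to another representative changes its
    prolongation [(x *m B, v *m B)] by the same linear map, and [hatlike_derive_affine] applies. *)
Let PQ_lift t X : lift_at t X ->
  P t = 'D_(X t *m B, 'D_1 X t *m B) G (X t, 'D_1 X t) /\
  Q t = 'D_(0, X t *m B) G (X t, 'D_1 X t).
Proof.
move=> lX; rewrite /P /Q (lift_velocity lX); have [_ I _] := lX.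
move: (X t) ('D_1 X t) I => x v I; have [x0 _] := I.
have /asboolP[k k0 /= [e1 [l e2]]] := repr_pi_TRP (nzv x, v).
rewrite -/(th x v) -/(rx (th x v)) in e1; rewrite -/(th x v) -/(rv (th x v)) in e2.
rewrite nzvK// in e1 e2; rewrite e1 e2.
have H p := hatlike_derive_affine hG l k0 (z := (x, v)) p I.
have := H (x *m B, v *m B); have := H (0, x *m B); rewrite /= => H1 H2.
rewrite !scaler0 addr0 in H1.
by rewrite -H1 -H2 mulmxDl -!scalemxAl.
Qed.

Let mulB : linear (fun x : E => x *m B).
Proof. by move=> k x y; rewrite mulmxDl scalemxAl. Qed.

Let diffB (x : E) : is_diff x (fun x : E => x *m B) (fun x : E => x *m B).
Proof. exact: is_diff_fdim. Qed.

Let smoothB {U : normedModType R} (f : U -> E) x : smooth_at f x -> smooth_at (fun y => f y *m B) x.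
Proof. by move=> sf; apply: (smooth_at_linl (l := fun x : E => x *m B)). Qed.

Let PQ_smooth t : t \in `[a, b] -> smooth_at P t /\ smooth_at Q t.
Proof.
move=> /ex_lift[i [y [_ lX]]]; set X := (fun s => _) in lX.
have [sX I _] := lX; have sz := sdX sX.
have sG : smooth_at G (X t, 'D_1 X t) by exact: hatlike_smooth.
have sB := smoothB sX; have sB' := smoothB (sD1 sX).
have nl := near_lift lX.
split.
  apply: smooth_at_eq (smooth_at_moving (z := fun s => (X s, 'D_1 X s)) sG sB sB' sz).
  by apply: filterS nl => s /PQ_lift[-> _].
apply: smooth_at_eq (smooth_at_moving (u := fun=> 0) (z := fun s => (X s, 'D_1 X s)) sG (smooth_at_cst _ _) sB sz).
by apply: filterS nl => s /PQ_lift[_ ->].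
Qed.

Let K (t : R) : R := P t - 'D_1 Q t.

Let K_smooth t : t \in `[a, b] -> smooth_at K t.
Proof. by move=> /PQ_smooth[sP sQ]; apply: smooth_atB => //; exact: smooth_at_derive. Qed.

Let dX1 (X : R -> E) t : smooth_at X t -> is_derive t 1 X ('D_1 X t).
Proof. by move=> sX; apply: DeriveDef => //; apply: diff_derivable; exact: smooth_at_diff. Qed.

(** In [P - Q'] the vertical term along [X' *m B] cancels, and Hamel's condition cancels the
    derivative in the point against the part of [Q'] along [X']. Only the acceleration term is
    left. *)
Lemma K_lift t X : lift_at t X ->
  K t = - 'D_(0, 'D_1 ('D_1 X) t) ('D_(0, X t *m B) G) (X t, 'D_1 X t).
Proof.
move=> lX; have [sX I _] := lX; have [eP _] := PQ_lift lX.
have sG : smooth_at G (X t, 'D_1 X t) by exact: hatlike_smooth.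
have d1 := dX1 sX; have d2 := dX1 (sD1 sX).
have dz := is_derive_pair d1 d2; have dm := is_derive_lin diffB d1.
have nE : \forall s \near t, 'D_(0, X s *m B) G (X s, 'D_1 X s) = Q s.
  by apply: filterS (near_lift lX) => s ls; have [_ eQ] := PQ_lift ls; exact: esym eQ.
have [_ dQ] := near_eq_is_derive nE (is_derive_moving (z := fun s => (X s, 'D_1 X s)) sG dm dz).
have dG := smooth_at_diff sG.
have dD : differentiable ('D_(0, X t *m B) G) (X t, 'D_1 X t).
  by apply: smooth_at_diff; exact: smooth_at_derive.
have e1 := derive_split (X t *m B) ('D_1 X t *m B) dG.
have e2 := derive_split ('D_1 X t) ('D_1 ('D_1 X) t) dD.
have e3 := HF (X t *m B) I.
rewrite /K eP dQ; exact: geodesic_alg e1 e2 e3.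
Qed.

Section Test.
Variable eta : R -> R.
Hypothesis s_eta : forall t : R, smooth_at eta t.
Hypotheses (eta_a : eta a = 0) (eta_b : eta b = 0).

(** The point is moved by a multiple of [x *m B], which scales with [x]. The variation therefore
    does not depend on the representative and is defined on the whole curve at once. *)
Let V (s t : R) : RP R n :=
  ph (val (repr (c t)) + (s * eta t) *: (val (repr (c t)) *m B)).

Let Xt (X : R -> E) (z : R * R) : E := X z.2 + (z.1 * eta z.2) *: (X z.2 *m B).

Let s_fst (z : R * R) : smooth_at (fst : R * R -> R) z. Proof. exact: smooth_at_fst. Qed.

Let Xt_smooth (X : R -> E) t : smooth_at X t -> smooth_at (Xt X) (0, t).
Proof.
move=> sX; have s2 : smooth_at (fun z : R * R => X z.2) (0, t).
  by apply: (smooth_at_comp (f := snd) (g := X)) => //; exact: smooth_at_snd.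
apply: smooth_atD => //; apply: smooth_atZ => //; last exact: smoothB.
apply: smooth_atM => //.
by apply: (smooth_at_comp (f := snd) (g := eta)) => //; exact: smooth_at_snd.
Qed.

Let Xt0 (X : R -> E) t : Xt X (0, t) = X t.
Proof. by rewrite /Xt /= mul0r scale0r addr0. Qed.

Let V_lift t X : lift_at t X -> \forall z \near (0, t), V z.1 z.2 = ph (Xt X z).
Proof.
move=> [sX [X0 _] cX].
have [i Xi] := ex_coord_neq0 X0.
have sXi : smooth_at (fun z => Xt X z ord0 i) (0, t).
  exact: ((smooth_at_rV _ _).1 (Xt_smooth sX) i).
have nX : \forall z \near (0, t), Xt X z ord0 i != 0.
  by apply: near_neq0; [exact: smooth_at_cont|rewrite Xt0].
have ncX : \forall z \near ((0, t) : R * R), c z.2 = ph (X z.2) /\ X z.2 != 0.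
  apply: (near_comp (z := snd : R * R -> R) (t := (0, t)) (P := fun s => c s = ph (X s) /\ X s != 0)).
    by apply: smooth_at_cont; exact: smooth_at_snd.
  have sXi' : smooth_at (fun s => X s ord0 i) t by exact: ((smooth_at_rV _ _).1 sX i).
  by apply: filterS2 cX (near_neq0 (smooth_at_cont sXi') Xi) => s h1 /coord_neq0 h2.
apply: filterS2 nX ncX => z /coord_neq0 Xz [cz Xz2].
rewrite /V cz /ph; have [k k0 ->] := repr_pi_RP (nzv (X z.2)); rewrite nzvK//.
have -> : k *: X z.2 + (z.1 * eta z.2) *: (k *: X z.2 *m B) = k *: Xt X z.
  by rewrite /Xt scalerDr -scalemxAl !scalerA mulrC.
exact: ph_eq.
Qed.

Let V_variation : Defs.variation a b c V.
Proof.
have V0 s t : s * eta t = 0 -> V s t = c t.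
  by move=> e; rewrite /V e scale0r addr0 /ph /nzv valKd reprK.
split=> [t tab|t tab|].
- have [i [y [_ lX]]] := ex_lift tab; have [sX [X0 _] _] := lX.
  by apply: smooth_map_lift (Xt_smooth sX) _ (V_lift lX); rewrite Xt0.
- by apply: V0; rewrite mul0r.
- by apply: filterE => s; split; apply: V0; rewrite ?eta_a ?eta_b mulr0.
Qed.

Let derive_fst_Xt X (z : R * R) : 'D_(1, 0) (Xt X) z = eta z.2 *: (X z.2 *m B).
Proof.
have [_ <-] := is_derive_line (Xt X z) (eta z.2 *: (X z.2 *m B)) (0 : R).
apply: derive_line_eq => h; rewrite /Xt /= scaler0 add0r addr0 -addrA scalerA -scalerDl.
by congr (_ + _ *: _); rewrite mulrDl addrC /GRing.scale /= mulr1.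
Qed.

Let speed_V t X : lift_at t X ->
  'D_(1, 0) (speed F V) (0, t) = eta t * P t + 'D_1 eta t * Q t.
Proof.
move=> lX; have [sX I _] := lX; have [eP eQ] := PQ_lift lX.
have e1 : 'D_(0, 1) (Xt X) (0, t) = 'D_1 X t.
  apply: derive_line_eq => h; rewrite -[RHS]Xt0; congr (Xt X (_, _)).
  by rewrite /= scaler0 add0r.
have e2 : 'D_(0, 1) ('D_(1, 0) (Xt X)) (0, t) = 'D_1 eta t *: (X t *m B) + eta t *: ('D_1 X t *m B).
  have -> : 'D_(0, 1) ('D_(1, 0) (Xt X)) (0, t) = 'D_1 (fun s => eta s *: (X s *m B)) t.
    apply: derive_line_eq => h; rewrite derive_fst_Xt /=.
    by [].
  have dm := is_derive_lin diffB (dX1 sX).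
  have de : is_derive t 1 eta ('D_1 eta t).
    by apply: DeriveDef => //; apply: diff_derivable; exact: smooth_at_diff.
  have [] // : is_derive t 1 (fun s => eta s *: (X s *m B)) ('D_1 eta t *: (X t *m B) + eta t *: ('D_1 X t *m B)).
  apply: is_derive_rV => j.
  have := is_derive_mulR de (is_derive_coord j dm).
  congr is_derive; first by apply/funext => s; rewrite [RHS]mxE.
  by rewrite !mxE addrC.
have Ie : indep (Xt X (0, t)) ('D_(0, 1) (Xt X) (0, t)) by rewrite Xt0 e1.
rewrite (speed_derive FF (Xt_smooth sX) Ie (V_lift lX)) e1 e2 derive_fst_Xt Xt0 /=.
have dG : differentiable G (X t, 'D_1 X t) by apply: smooth_at_diff; exact: hatlike_smooth.
have -> : (eta t *: (X t *m B), 'D_1 eta t *: (X t *m B) + eta t *: ('D_1 X t *m B)) =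
   eta t *: (X t *m B, 'D_1 X t *m B) + 'D_1 eta t *: (0, X t *m B) :> E * E.
  by congr pair; rewrite /= ?scaler0 ?addr0// addrC.
by apply: etrans (derive_lin _ _ _ dG) _; rewrite eP eQ; congr (_ + _); exact: deriveZr.
Qed.

(** The first variation is the integral of [eta * P + eta' * Q]; since [eta] vanishes at both ends,
    integration by parts replaces [Q eta'] by [- Q' eta]. *)
Lemma K_test : integ a b (fun t => K t * eta t) = 0.
Proof.
have [_ _ H] := c_geo.
have I0 := is_derive_unique (first_variation FF ab c_smooth c_reg V_variation) (H _ V_variation).
have s_deta t : smooth_at ('D_1 eta) t by exact: smooth_at_derive.
have [cP cQ] : (forall t : R, t \in `[a, b] -> smooth_at P t) /\
    (forall t : R, t \in `[a, b] -> smooth_at Q t) by split=> t /PQ_smooth[].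
have cont (f : R -> R) : (forall t : R, t \in `[a, b] -> smooth_at f t) -> cont_on a b f.
  by move=> sf t /sf; exact: smooth_at_cont.
have cPe : cont_on a b (fun t => eta t * P t).
  by apply: cont => t tab; apply: smooth_atM => //; exact: cP.
have cQe : cont_on a b (fun t => 'D_1 eta t * Q t).
  by apply: cont => t tab; apply: smooth_atM => //; exact: cQ.
have cQd : cont_on a b (fun t => eta t * 'D_1 Q t).
  by apply: cont => t tab; apply: smooth_atM => //; apply: smooth_at_derive; exact: cQ.
have cF : cont_on a b (fun t => eta t * 'D_1 Q t + 'D_1 eta t * Q t) by exact: cont_onD.
have FTC := integ_FTC (ltW ab) cF.
have {}FTC : integ a b (fun t => eta t * 'D_1 Q t + 'D_1 eta t * Q t) = 0.
  have dE (t : R) : t \in `[a, b] ->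
      is_derive t 1 (fun t => eta t * Q t) (eta t * 'D_1 Q t + 'D_1 eta t * Q t).
    move=> tab; have de : is_derive t 1 eta ('D_1 eta t).
      by apply: DeriveDef => //; apply: diff_derivable; exact: smooth_at_diff.
    have dQ : is_derive t 1 Q ('D_1 Q t).
      by apply: DeriveDef => //; apply: diff_derivable; apply: smooth_at_diff; exact: cQ.
    exact: is_derive_mulR de dQ.
  exact: etrans (FTC _ dE) (zero_ends _ _ eta_b eta_a).
have I1 : integ a b (fun t => eta t * P t + 'D_1 eta t * Q t) = 0.
  rewrite -I0; apply: eq_integ => t tab.
  by have [i [y [_ lX]]] := ex_lift tab; rewrite (speed_V lX).
have cPQ : cont_on a b (fun t => eta t * P t + 'D_1 eta t * Q t) by exact: cont_onD.
have := integB cPQ cF; rewrite FTC I1 subrr => <-.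
by apply: eq_integ => t _; exact/esym/test_alg.
Qed.

End Test.

Lemma K_eq0 (t : R) : t \in `[a, b] -> K t = 0.
Proof.
move=> tab; apply: fundamental_lemma tab => //.
  by move=> s /K_smooth; exact: smooth_at_cont.
exact: K_test.
Qed.

End Direction.

Lemma geodesic_second (t : R) X w : t \in `[a, b] -> lift_at t X ->
  'D_(0, 'D_1 ('D_1 X) t) ('D_(0, w) G) (X t, 'D_1 X t) = 0.
Proof.
move=> tab lX; have [_ [X0 _] _] := lX; have [i Xi] := ex_coord_neq0 X0.
(* A rank-one matrix, with only the [i]-th row nonzero, that sends the vector [X t] to [w]. *)
pose B : 'M[R]_n.+1 := \matrix_(k, l) if k == i then (X t ord0 i)^-1 * w ord0 l else 0.
have XB : X t *m B = w.
  apply/rowP => l; rewrite mxE (bigD1 i)//= big1 => [|k ki]; last by rewrite mxE (negPf ki) mulr0.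
  by rewrite mxE eqxx addr0 mulrA divff// mul1r.
by apply: oppr_inj; rewrite oppr0 -XB -K_lift// K_eq0.
Qed.

(** The vertical Hessian of [F] is positive on vectors outside the span of the point and the
    velocity, whereas [geodesic_second] with [w] equal to the acceleration says that it vanishes
    there. *)
Lemma geodesic_span (t : R) X : t \in `[a, b] -> lift_at t X ->
  exists p q : R, 'D_1 ('D_1 X) t = p *: X t + q *: 'D_1 X t.
Proof.
move=> tab lX; have H := geodesic_second ('D_1 ('D_1 X) t) tab lX.
have [_ I _] := lX; move: (X t) ('D_1 X t) ('D_1 ('D_1 X) t) H I => x v u H I.
apply: contrapT => /forallNP nspan.
have : 0 < 'D_(0, u) ('D_(0, u) G) (x, v).
  apply: second_derivative_gt0.
  - by move=> k y w k0; exact: hatlike_hom.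
  - by move=> k k0; apply: hatlike_smooth => //; apply: indep_scale; rewrite ?gt_eqF.
  - exact: hat_pos.
  move=> k; apply: hat_convex => //; have [x0 _] := I; split=> // l; apply/eqP => e.
  by apply: (nspan l); exists k; rewrite -e subrK.
by rewrite H ltxx.
Qed.

End Geodesics.

Lemma div_eq {R : realType} (x y K : R) : y != 0 -> x / y = K -> x = y * K.
Proof. by move=> y0 <-; rewrite mulrC divfK. Qed.

Lemma line_alg {R : realType} (v x y x' y' d : R) :
  x' = v * x -> y' = v * y -> (x' * y - x * y') / d = 0.
Proof. by move=> -> ->; rewrite (_ : v * x * y - x * (v * y) = 0) ?mul0r//; ring. Qed.

Section LocallyConstant.
Context {R : realType}.

Lemma constant_on_cc (g : R -> R) (a b : R) :
  (forall s : R, s \in `[a, b] -> is_derive s 1 g 0) ->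
  forall s t : R, s \in `[a, b] -> t \in `[a, b] -> g s = g t.
Proof.
move=> dg; suff H (s t : R) : s \in `[a, b] -> t \in `[a, b] -> s < t -> g s = g t.
  move=> s t sab tab; have [st|st|->//] := ltgtP s t; first exact: H.
  by apply/esym; exact: H.
rewrite !in_itv /= => /andP[as_ sb] /andP[at_ tb] st.
have dg' (x : R) : x \in `[s, t] -> is_derive x 1 g ((cst 0 : R -> R) x).
  by rewrite in_itv /= => /andP[x1 x2]; apply: dg; rewrite in_itv /=; lra.
have [x _ e] := MVT_cc st dg'.
by apply/eqP; rewrite eq_sym -subr_eq0 e mul0r.
Qed.

(** The indicator of [phi = phi a] has derivative zero, hence is constant. Clamping the argument to
    [[a, b]] makes this derivative two-sided at the end points too. *)
Lemma locally_constant {T : Type} (phi : R -> T) (a b : R) :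
  (forall t : R, t \in `[a, b] -> exists2 e : R, 0 < e &
    forall s : R, s \in `[a, b] -> s \in `[t - e, t + e] -> phi s = phi t) ->
  forall t : R, t \in `[a, b] -> phi t = phi a.
Proof.
move=> loc t tab; have ab : a <= b by move: tab; rewrite in_itv /= => /andP[]; exact: le_trans.
pose clamp (s : R) := Num.max a (Num.min b s).
have clampP s : clamp s \in `[a, b].
  by rewrite in_itv /= /clamp le_max lexx /= ge_max ab ge_min lexx.
have clampK s : s \in `[a, b] -> clamp s = s.
  by rewrite in_itv /= => /andP[h1 h2]; rewrite /clamp (min_r h2) (max_r h1).
pose g (s : R) : R := if `[< phi (clamp s) = phi a >] then 1 else 0.
have dg (s : R) : s \in `[a, b] -> is_derive s 1 g 0.
  move=> sab; have [e e0 He] := loc s sab.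
  have nE : \forall r \near s, g s = g r.
    have se : s \in `]s - e, s + e[ by rewrite in_itv /=; lra.
    apply: filterS (near_in_itvoo se) => r re; rewrite /g (clampK s sab) (He (clamp r))//.
    move: re sab; rewrite !in_itv /= => /andP[r1 r2] /andP[s1 s2].
    rewrite /clamp le_max ge_max le_min ge_min; apply/andP; split.
      by apply/orP; right; apply/andP; split; lra.
    by apply/andP; split; [lra|apply/orP; right; lra].
  by apply: (near_eq_is_derive (f := cst (g s)) nE).
have aab : a \in `[a, b] by rewrite in_itv /= lexx.
have := constant_on_cc dg tab aab; rewrite /g (clampK t tab) (clampK a aab) (asboolT (erefl (phi a))).
by case: asboolP => // _ /eqP; rewrite eq_sym oner_eq0.
Qed.

End LocallyConstant.

(** * The plane of a geodesic *)

Section Planes.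
Context {R : realType} {n : nat}.
Local Notation E := 'rV[R]_n.+1.

Lemma indep_dim (x v : E) : indep x v -> \dim <<[:: x; v]>> = 2.
Proof.
move=> [x0 H]; have fr : free [:: x; v].
  rewrite free_cons seq1_free; apply/andP; split.
    rewrite span_seq1; apply/negP => /vlineP[k e].
    have [k0|k0] := eqVneq k 0; first by move/eqP: x0; apply; rewrite e k0 scale0r.
    by have := H k^-1; rewrite e scalerA mulVf// scale1r eqxx.
  by have := H 0; rewrite scale0r.
by move: fr; rewrite /free => /eqP ->.
Qed.

Lemma span2_eq (x v x' v' : E) : indep x v -> indep x' v' ->
  x' \in <<[:: x; v]>>%VS -> v' \in <<[:: x; v]>>%VS -> <<[:: x'; v']>>%VS = <<[:: x; v]>>%VS.
Proof.
move=> I I' xS vS; apply/eqP; rewrite eqEdim !indep_dim// leqnn andbT.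
by apply/span_subvP => z; rewrite !inE => /orP[/eqP->|/eqP->].
Qed.

Lemma mem_span2 (x v : E) (k l : R) : k *: x + l *: v \in <<[:: x; v]>>%VS.
Proof. by rewrite memvD// memvZ// memv_span// !inE eqxx ?orbT. Qed.

Definition plane (u : TRP R n) : {vspace E} := <<[:: val (repr u).1; (repr u).2]>>%VS.

Lemma plane_th (x v : E) : indep x v -> plane (th x v) = <<[:: x; v]>>%VS.
Proof.
move=> I; have [x0 _] := I; rewrite /plane /th.
have /asboolP[k k0 /= [-> [l ->]]] := repr_pi_TRP (nzv x, v).
rewrite nzvK//; apply: span2_eq => //; first exact: indep_affine.
  by have := mem_span2 x v k 0; rewrite scale0r addr0.
by rewrite addrC mem_span2.
Qed.

End Planes.

Section Line.
Context {R : realType} {n : nat}.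
Local Notation E := 'rV[R]_n.+1.
Variables (F : TRP R n -> R) (a b : R) (c : R -> RP R n).
Hypotheses (FF : Finsler F) (HF : hamel (hat F)) (ab : a < b).
Hypothesis c_geo : geodesic F a b c.

Let plane_lift t X : lift_at c t X -> plane (velocity c t) = <<[:: X t; 'D_1 X t]>>%VS.
Proof. by move=> lX; rewrite (lift_velocity lX) plane_th//; case: lX. Qed.

Let chart_derivatives i (y : R -> 'rV[R]_n) (t : R) : smooth_at y t ->
  'D_1 (fun s => insert i 1 (y s)) t = insert i 0 ('D_1 y t) /\
  'D_1 ('D_1 (fun s => insert i 1 (y s))) t = insert i 0 ('D_1 ('D_1 y) t).
Proof.
move=> sy; have D1 s : smooth_at y s -> 'D_1 (fun s => insert i 1 (y s)) s = insert i 0 ('D_1 y s).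
  by move=> /smooth_at_diff dy; have [] := derive_insert i 1 (1 : R) dy.
split; first exact: D1.
have nE : \forall s \near t, 'D_1 (fun s => insert i 1 (y s)) s = insert i 0 ('D_1 y s).
  by apply: filterS (near_smooth_at sy) => s; exact: D1.
rewrite (near_eq_derive _ nE).
have dy' : differentiable ('D_1 y) t by apply: smooth_at_diff; exact: smooth_at_derive.
by have [] := derive_insert i 0 (1 : R) dy'.
Qed.

(** In an affine chart the acceleration is a multiple of the velocity, so the ratios of the
    velocity's coordinates are constant. The curve thus runs on an affine line, and its lift and
    velocity stay in one plane. *)
Let plane_locally_constant (t : R) : t \in `[a, b] -> exists2 e : R, 0 < e &
  forall s : R, s \in `[a, b] -> s \in `[t - e, t + e] ->
    plane (velocity c s) = plane (velocity c t).
Proof.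
move=> tab; have [i [y [sy lX]]] := ex_lift c_geo tab.
pose X s := insert i 1 (y s); rewrite -/X in lX.
have [_ I _] := lX; have [eX1 _] := chart_derivatives i sy.
have dy0 : 'D_1 y t != 0.
  apply/eqP => e; have [_ H] := I; move/eqP: (H 0); apply.
  by rewrite scale0r eX1 e insert00.
have [j yj] : exists j, 'D_1 y t ord0 j != 0.
  apply: contrapT => /forallNP H; move/eqP: dy0; apply; apply/rowP => j.
  by rewrite mxE; apply/eqP/negPn/negP/H.
have sdy : smooth_at ('D_1 y) t by exact: smooth_at_derive.
have sdyj : smooth_at (fun s => 'D_1 y s ord0 j) t by exact: ((smooth_at_rV _ _).1 sdy j).
have near_ok : \forall s \near t, [/\ lift_at c s X, smooth_at y s & 'D_1 y s ord0 j != 0].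
  by apply: filterS3 (near_lift lX) (near_smooth_at sy) (near_neq0 (smooth_at_cont sdyj) yj).
have [e e0 He] := near_ball_cc near_ok.
exists e; [exact: e0 | move=> s sab ste].
(* The equation for the acceleration holds only on [[a, b]], so the window around [t] is cut down to
   it. *)
pose p := Num.max a (t - e); pose q := Num.min b (t + e).
have pq (r : R) : r \in `[p, q] = (r \in `[a, b]) && (r \in `[t - e, t + e]).
  by rewrite !in_itv /= ge_max le_min andbACA.
have spq : s \in `[p, q] by rewrite pq sab ste.
have tpq : t \in `[p, q] by rewrite pq tab in_itv /=; lra.
have dyk (r : R) k : smooth_at y r -> is_derive r 1 (fun r => y r ord0 k) ('D_1 y r ord0 k).
  move=> syr; apply: is_derive_coord; apply: DeriveDef => //.
  by apply: diff_derivable; exact: smooth_at_diff.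
have ddyk (r : R) k : smooth_at y r ->
    is_derive r 1 (fun r => 'D_1 y r ord0 k) ('D_1 ('D_1 y) r ord0 k).
  move=> syr; apply: is_derive_coord; apply: DeriveDef => //.
  by apply: diff_derivable; apply: smooth_at_diff; exact: smooth_at_derive.
have ratio k (r : R) : r \in `[p, q] ->
    'D_1 y r ord0 k / 'D_1 y r ord0 j = 'D_1 y t ord0 k / 'D_1 y t ord0 j.
  move=> rpq; apply: (constant_on_cc (g := fun r => 'D_1 y r ord0 k / 'D_1 y r ord0 j) _ rpq tpq).
  move=> {rpq}r; rewrite pq => /andP[rab /He[lr syr yjr]].
  have [u [v]] := geodesic_span FF HF ab c_geo rab lr.
  have [-> ->] := chart_derivatives i syr => eX.
  (* The lift has [i]-th coordinate 1 and its derivatives have 0, so the acceleration has no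
     component along the point. *)
  have u0 : u = 0 by move/rowP/(_ i): eX; rewrite insertE !mxE !unlift_none mulr1 mulr0 addr0.
  have ey l : 'D_1 ('D_1 y) r ord0 l = v * 'D_1 y r ord0 l.
    by move/rowP/(_ (lift i l)): eX; rewrite u0 scale0r add0r insert_lift => ->; rewrite !mxE liftK.
  have := is_derive_div yjr (ddyk r k syr) (ddyk r j syr).
  by congr is_derive; exact: line_alg (ey k) (ey j).
pose kap : 'rV[R]_n := \row_k ('D_1 y t ord0 k / 'D_1 y t ord0 j).
have ydir (r : R) : r \in `[p, q] -> 'D_1 y r = 'D_1 y r ord0 j *: kap.
  move=> rpq; have yjr : 'D_1 y r ord0 j != 0 by move: rpq; rewrite pq => /andP[_ /He[]].
  apply/rowP => k; have := div_eq yjr (ratio k r rpq).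
  by move=> H; apply: etrans H _; rewrite !mxE.
have yline : y s = y t + (y s ord0 j - y t ord0 j) *: kap.
  apply/rowP => k; rewrite !mxE.
  have dg (r : R) : r \in `[p, q] -> is_derive r 1 (fun r => y r ord0 k - kap ord0 k * y r ord0 j) 0.
    move=> rpq; have syr : smooth_at y r by move: rpq; rewrite pq => /andP[_ /He[]].
    have := is_deriveB (dyk r k syr) (is_derive_cstM (kap ord0 k) (dyk r j syr)).
    congr is_derive; rewrite (ydir r rpq) !mxE [in X in _ - X]mulrC.
    by rewrite divff// mulr1 mulrC subrr.
  have := constant_on_cc dg spq tpq; rewrite !mxE.
  by move: (y s ord0 k) (y t ord0 k) (_ / _) => Y Z K; lra.
have [ls sys _] := He s ste.
apply: etrans (plane_lift ls) (etrans _ (esym (plane_lift lX))).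
have [_ Is _] := ls.
have eXs : X s = 1 *: X t + ((y s ord0 j - y t ord0 j) / 'D_1 y t ord0 j) *: 'D_1 X t.
  rewrite scale1r eX1 /X {1}yline.
  apply/rowP => k; rewrite !mxE; case: unliftP => [l _|_]; rewrite ?mxE ?mulr0 ?addr0//.
  by rewrite mulrA mulrAC.
have eDs : 'D_1 X s = 0 *: X t + ('D_1 y s ord0 j / 'D_1 y t ord0 j) *: 'D_1 X t.
  have [-> _] := chart_derivatives i sys.
  rewrite scale0r add0r eX1 {1}(ydir s spq).
  apply/rowP => k; rewrite !mxE; case: unliftP => [l _|_]; rewrite ?mxE ?mulr0//.
  by rewrite mulrA mulrAC.
apply: (span2_eq I Is); first by rewrite eXs; exact: mem_span2.
by rewrite eDs; exact: mem_span2.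
Qed.

Lemma base_velocity t : base (velocity c t) = c t.
Proof. by rewrite /velocity base_chart_vec Defs.coordK// in_chart_at. Qed.

Lemma hamel_geodesic_line : exists2 l, projective_line l &
  forall t : R, t \in `[a, b] -> l (c t).
Proof.
have aab : a \in `[a, b] by rewrite in_itv /= lexx ltW.
exists (projectivization (plane (velocity c a))).
  exists (plane (velocity c a)) => //.
  have [i [y [_ lX]]] := ex_lift c_geo aab.
  by rewrite (plane_lift lX) indep_dim//; case: lX.
move=> t tab; rewrite /projectivization /=.
rewrite -(locally_constant (phi := fun t => plane (velocity c t)) plane_locally_constant tab).
rewrite -[in X in val X](base_velocity t) /base.
have [k k0 ->] := repr_pi_RP (repr (velocity c t)).1.
by rewrite memvZ// memv_span// inE eqxx.
Qed.

End Line.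

Theorem hamel_projective {R : realType} {n : nat} (F : TRP R n -> R) :
  Finsler F -> hamel (hat F) -> projective F.
Proof. by move=> FF HF a b c ab geo; exact: hamel_geodesic_line FF HF ab geo. Qed.

Theorem mainTheorem2 (R : realType) (n : nat) (n_ge2 : (2 <= n)%N)
    (L : TRP R n -> R) (L_Finsler : Finsler L) (L_projective : projective L) :
  exists (F : TRP R n -> R) (f : RP R n -> R),
    [/\ Finsler F, reversible F, projective F, smooth_function f &
        forall v : TRP R n, L v = F v + differential f v].
Proof.
have hL := hat_hatlike L_Finsler; have HL := hat_hamel L_Finsler L_projective.
(* The odd part of [hat L]; the even part is the metric, and the sum of the two is [hat L]. *)
pose A z := 2^-1 * hat L z + - 2^-1 * refl (hat L) z.
have hA : hatlike A by apply: hatlike_comb => //; exact: hatlike_refl.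
have HA : hamel A by apply: hamel_comb => //; [exact: hatlike_refl|exact: hamel_refl].
have oA x v : A (x, - v) = - A (x, v) by rewrite /A /refl /= opprK; ring.
have n1 : (0 < n)%N by exact: leq_trans n_ge2.
have FF := even_part_Finsler L_Finsler.
(* Any nonzero vector serves as the origin of the segments; it only fixes the additive constant of
   [f]. *)
pose o : 'rV[R]_n.+1 := insert ord0 1 0.
have o0 : o != 0 by exact: insert1_neq0.
pose f := descended A o.
have fP i y w : smooth_at (f \o chart_point i) y /\
    'D_w (f \o chart_point i) y = A (insert i 1 y, insert i 0 w).
  apply: descended_chart => //.
  - by move=> x v; exact: odd_smooth.
  - by move=> x v u; exact: odd_closed.
  - by move=> a x v; exact: odd_scale.
  - by move=> x v u; exact: odd_additive.
  - by move=> a b x v; exact: hatlike_inv.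
exists (even_part L), f; split=> //.
- exact: even_part_reversible.
- by apply: hamel_projective => //; exact: even_part_hamel.
- by move=> i y; have [] := fP i y 0.
move=> u; rewrite /differential; set i := chart_at (base u).
set y := Defs.coord i (base u); set w := tcoord i u.
have eu : u = chart_vec i y w by rewrite tcoordK// in_chart_at.
have [sf Df] := fP i y w.
rewrite -deriveE; last exact: smooth_at_diff.
rewrite Df eu even_part_chart// /A /refl /= -insertN !hat_insert.
by move: (L _) (L _) => p q; lra.
Qed.
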